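(* For $n\in\mathbb{N}$ let $F_n(x)=\sum_{k=0}^n {n\brace k}\,k!\,x^k$ be the $n$-th Fubini polynomial. The sequence of probability measures $[\![F_n]\!]_n$ converges weakly, as $n\to\infty$, to a probability measure $\mu_F$ on the interval $(-1,0)$ which has the following properties. Cauchy transform: $$\int_{(-1,0)}\frac{\mu_F(\mathrm{d}z)}{t-z}=\frac{1}{t(t+1)\log\left(1+\frac1t\right)},\qquad t\in\mathbb{C}\setminus[-1,0].$$ Lebesgue density: $$p_F(x)=\frac{1}{|x|(x+1)\left(\pi^2+\log^2\left|1+\frac1x\right|\right)},\qquad x\in(-1,0).$$ Moments: $$\int_{-1}^0x^k\,\mu_F(\mathrm{d}x)=(-1)^k\frac{C_k}{k!},\qquad k\in\mathbb{N}_0,$$ where $C_k=\int_0^1x(x+1)\cdots(x+k-1)\,\mathrm{d}x$ are the Cauchy numbers (with $C_0=1$). Logarithmic potential: $$\int_{(-1,0)}\log|t-z|\,\mu_F(\mathrm{d}z)=-\log\left|\log\left(1+\frac1t\right)\right|,\qquad t\in\mathbb{C}\setminus[-1,0].$$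
   Context: ${n\brace k}$ denotes the Stirling number of the second kind, i.e. the number of partitions of an $n$-element set into $k$ nonempty blocks. For a polynomial $P\not\equiv0$ of degree at most $n$, $[\![P]\!]_n:=\frac1n\sum_{z\in\mathbb{C}:P(z)=0}\delta_z+\frac{n-\deg P}{n}\delta_\infty$ (zeros counted with multiplicity) is the empirical distribution of zeros. The polynomials $F_n$ have only real nonpositive zeros. In the complex formulas $\log$ denotes the principal branch of the logarithm. *)

(* Defs.v *)
From HB Require Import structures.
From mathcomp Require Import all_boot all_order all_algebra.
From mathcomp Require Import complex.
From mathcomp Require Import all_classical all_reals all_analysis.
Import Order.TTheory GRing.Theory Num.Theory.
Import numFieldNormedType.Exports.

Set Implicit Arguments.
Unset Strict Implicit.
Unset Printing Implicit Defensive.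

Local Open Scope classical_set_scope.
Local Open Scope ring_scope.
Local Open Scope complex_scope.

Definition stirling2 (n k : nat) : nat :=
  #|[set P : {set {set 'I_n}} |
      finset.partition P [set: 'I_n]%SET && (#|P| == k)]%SET|.

Definition fubini_poly (R : nzRingType) (n : nat) : {poly R} :=
  \sum_(k < n.+1) (stirling2 n k * k`!)%:R *: 'X^k.

Definition cauchy_number (R : realType) (k : nat) : R :=
  \int[lebesgue_measure]_(x in `[0, 1]) \prod_(j < k) (x + j%:R).

Definition fubini_density (R : realType) (x : R) : R :=
  (`|x| * (x + 1) * (pi ^+ 2 + (ln `|1 + x^-1|) ^+ 2))^-1.

(* For z != 0, carg z is the argument of z lying in ]-pi, pi], so that clog is
   the principal branch of the logarithm. *)
Definition carg (R : realType) (z : R[i]) : R :=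
  let a := acos (complex.Re z / Normc.normc z) in
  if 0 <= complex.Im z then a else - a.

Definition clog (R : realType) (z : R[i]) : R[i] :=
  ln (Normc.normc z) +i* carg z.

(* The complex-valued f has integral v: its real and imaginary parts have finite
   integrals Re v and Im v. As v is finite, this excludes the conventional
   values of integrals of non-integrable functions. *)
Definition has_cintegral d (T : measurableType d) (R : realType)
    (mu : {measure set T -> \bar R}) (D : set T) (f : T -> R[i]) (v : R[i]) :=
  (\int[mu]_(x in D) (complex.Re (f x))%:E = (complex.Re v)%:E)%E /\
  (\int[mu]_(x in D) (complex.Im (f x))%:E = (complex.Im v)%:E)%E.

(* T with its Borel sigma-algebra *)
Notation borel T := (g_sigma_algebraType (@open T)).

Definition weakly_cvg (T : ptopologicalType) (R : realType)
    (mu_ : {measure set (borel T) -> \bar R}^nat)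
    (mu : {measure set (borel T) -> \bar R}) :=
  forall f : T -> R, continuous f -> bounded_fun f ->
    ((\int[mu_ n]_x (f x)%:E)%E @[n --> \oo] --> (\int[mu]_x (f x)%:E)%E).

(* C together with the point at infinity, which is None *)
Definition sphere (R : realType) : ptopologicalType :=
  one_point_compactification (R[i] : numFieldType).

(* The zeros of p != 0, listed with multiplicity *)
Definition zeros (R : realType) (p : {poly R[i]}) : seq R[i] :=
  sval (closed_field_poly_normal p).

Lemma size_zeros (R : realType) (p : {poly R[i]}) :
  p != 0 -> size (zeros p) = (size p).-1.
Proof.
move=> p0; rewrite /zeros; case: closed_field_poly_normal => r /= pE.
by rewrite [in RHS]pE size_scale ?lead_coef_eq0// size_prod_XsubC.
Qed.

Section zero_distribution.
Variables (R : realType) (n : nat) (p : {poly R[i]}).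
Local Open Scope ereal_scope.

(* The truncated subtraction is harmless: it is used for deg p <= n only. *)
Definition zero_distribution (A : set (borel (sphere R))) : \bar R :=
  (n%:R^-1)%R%:E * (\sum_(z <- zeros p) \d_(Some z : borel (sphere R)) A) +
  ((n - (size p).-1)%:R / n%:R)%R%:E * \d_(None : borel (sphere R)) A.

Let zero_distributionE : zero_distribution =
  measure_add
    (mscale ((n%:R^-1 : R)%:nng)%R
      (msum (fun k => \d_(Some (nth 0%R (zeros p) k) : borel (sphere R)))
         (size (zeros p))))
    (mscale (((n - (size p).-1)%:R / n%:R : R)%:nng)%R
      \d_(None : borel (sphere R))).
Proof.
apply/funext => A.
by rewrite measure_addE /mscale /msum /zero_distribution (big_nth 0%R) big_mkord.
Qed.

Let zd0 : zero_distribution set0 = 0.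
Proof. by rewrite zero_distributionE; exact: measure0. Qed.

Let zd_ge0 A : 0 <= zero_distribution A.
Proof. by rewrite zero_distributionE; exact: measure_ge0. Qed.

Let zd_sigma_additive : semi_sigma_additive zero_distribution.
Proof. by rewrite zero_distributionE; exact: measure_semi_sigma_additive. Qed.

HB.instance Definition _ := isMeasure.Build _ _ _ zero_distribution
  zd0 zd_ge0 zd_sigma_additive.

Lemma zero_distribution_setT :
  (0 < n)%N -> p != 0%R -> (size p <= n.+1)%N -> zero_distribution setT = 1.
Proof.
move=> n0 p0 pn; rewrite /zero_distribution diracT mule1.
under eq_bigr do rewrite diracT.
rewrite sumEFin -EFinM -EFinD; congr (_%:E).
rewrite big_const_seq count_predT iter_addr_0 size_zeros// mulrC -mulrDl.
have dn : ((size p).-1 <= n)%N by case: (size p) pn.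
by rewrite -natrD subnKC// divff// pnatr_eq0 gtn_eqF.
Qed.

End zero_distribution.

Section on_sphere.
Variable R : realType.

Definition real_to_sphere (x : measurableTypeR R) : borel (sphere R) :=
  Some x%:C.

Lemma continuous_real_to_sphere :
  continuous (real_to_sphere : R -> sphere R).
Proof.
move=> x; apply: (@continuous_comp R (R[i] : numFieldType) (sphere R)
  (real_complex R) Some); last exact: one_point_compactification_some_continuous.
apply/cvgrPdist_lt => e e0.
have eE : e = (complex.Re e)%:C.
  by case: e e0 => a b; rewrite ltcE/= => /andP[/eqP -> _].
have : 0 < complex.Re e by move: e0; rewrite eE ltcR.
move=> /[dup] re0; move: (@cvg_id _ (nbhs x)) => /cvgrPdist_lt /[apply].
apply: filterS => y.
by rewrite eE -rmorphB/= normc_def/= expr0n/= addr0 sqrtr_sqr ltcR.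
Qed.

Lemma measurable_real_to_sphere : measurable_fun setT real_to_sphere.
Proof.
apply: (@measurability _ _ (measurableTypeR R) (borel (sphere R)) setT real_to_sphere (@open (sphere R))) => // _ [B oB <-].
rewrite setTI; apply: measurable_realfun.open_measurable.
by move/continuousP : continuous_real_to_sphere; exact.
Qed.

Variable mu : {measure set (measurableTypeR R) -> \bar R}.

Definition on_sphere := pushforward mu real_to_sphere.

Let on_sphere0 : on_sphere set0 = 0%E.
Proof. by rewrite /on_sphere /pushforward preimage_set0 measure0. Qed.

Let on_sphere_ge0 A : (0 <= on_sphere A)%E.
Proof. by rewrite /on_sphere /pushforward; exact: measure_ge0. Qed.

Let on_sphere_sigma_additive : semi_sigma_additive on_sphere.
Proof.
have mf B : measurable B -> measurable (real_to_sphere @^-1` B).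
  by move=> mB; rewrite -[X in measurable X]setTI;
    exact: measurable_real_to_sphere.
move=> F mF tF mUF; rewrite /on_sphere /pushforward preimage_bigcup.
apply: measure_semi_sigma_additive.
- by move=> n; exact: mf.
- apply/trivIsetP => /= i j _ _ ij; rewrite -preimage_setI.
  by move/trivIsetP : tF => /(_ _ _ _ _ ij) ->//; rewrite preimage_set0.
- by rewrite -preimage_bigcup; exact: mf.
Qed.

HB.instance Definition _ := isMeasure.Build _ _ _ on_sphere
  on_sphere0 on_sphere_ge0 on_sphere_sigma_additive.

End on_sphere.

(* Main.v *)
Require Import Defs.
From HB Require Import structures.
From mathcomp Require Import all_boot all_order all_algebra.
From mathcomp Require Import complex.
From mathcomp Require Import all_classical all_reals all_analysis.
From mathcomp Require Import measurable_realfun.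
From mathcomp Require Import ring lra zify.
Import Order.TTheory GRing.Theory Num.Theory.
Import numFieldNormedType.Exports.

Set Implicit Arguments.
Unset Strict Implicit.
Unset Printing Implicit Defensive.

Local Open Scope classical_set_scope.
Local Open Scope ring_scope.
Local Open Scope complex_scope.

(** The recurrence [F (n + 1) = X ((1 + X) F n)'] keeps the zeros of the Fubini
    polynomials in the segment [[-1, 0]] (Gauss-Lucas). On a segment, weak
    convergence is convergence of moments ([continuous_mean_cvg]), so that the
    zeros and the limit law only have to be compared through their moments.

    Moments of the zeros. The identity behind everything is
    [sum_n F n (x) u^n / n! = 1 / (1 - x (exp u - 1))], whose pole closest to
    the origin is [log (1 + 1/x)]; hence [F n (x) / n!] behaves like
    [1 / ((1 + x) log (1 + 1/x) ^ (n + 1))]. In algebraic form: if [G n] is the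
    product of the [1 - x X] over the zeros [x] of [F n], and
    [L = log (1 + X) / X], then [G n (1 + X) L ^ (n + 1) = 1] modulo
    [X ^ (n + 1)] ([recip_fubini_log]). The logarithmic derivative of [G n]
    generates the power sums of the zeros (Newton), and therefore the [k]-th
    power sum is affine in [n] for [n > k], its slope being the [k]-th
    coefficient of [1 / ((1 + X) L)] ([fubini_power_sum]). That coefficient is
    the integral of the binomial [binom(-s, k)] over [s] in [[0, 1]], i.e. the
    stated moment.

    The limit law. The density is a mixture over [s] in [[0, 1]], with weight
    [sin (pi s) / pi], of the functions
    [beta_weight s x = (-x) ^ (s - 1) (1 + x) ^ (- s)]
    ([fubini_density_mixture]). Integration by parts gives the transforms of
    each of these up to its mass: the moments are the binomials [binom(-s, k)]
    ([beta_moment]) and, when [1/t = exp L - 1], the integral of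
    [beta_weight s x / (1 - x/t)] is [exp (- s L)] times the mass
    ([beta_cauchyE]). Taking [L] purely imaginary and integrating over it up to
    the singular value [i pi] determines the mass, [pi / sin (pi s)]
    ([beta_massE], Euler's reflection formula). Averaging over [s] then gives
    the moments of the density and its Cauchy transform, since the average of
    [exp (- s L)] is [(1 - exp (- L)) / L] ([fubini_density_cauchy]). Finally,
    the logarithmic potential is recovered by integrating the Cauchy transform
    along the ray of [L], starting from [L = 0], that is from [t] at infinity
    ([log_potentialE]). *)

(** * Stirling numbers and Fubini polynomials *)

Section set_partitions.
Local Open Scope set_scope.
Local Open Scope nat_scope.
Variable T : finType.
Implicit Types (D : {set T}) (P : {set {set T}}) (x : T).

(** Partitions of a subset, so that the recurrence of the Stirling numbers can
    remove one element without changing the ambient type. *)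
Definition partitions_in D k : {set {set {set T}}} :=
  [set P | finset.partition P D && (#|P| == k)].

Lemma partition_notin {P D B x} :
  finset.partition P D -> x \notin D -> B \in P -> x \notin B.
Proof.
by move=> PD xD BP; apply: contra xD; apply/fintype.subsetP/(partitionS PD BP).
Qed.

Lemma partition_mem_disjoint {P D B C x} : finset.partition P D ->
  B \in P -> C \in P -> x \in B -> x \in C -> B = C.
Proof.
move=> /partition_trivIset tP BP CP xB xC.
by rewrite -(finset.def_pblock tP BP xB) (finset.def_pblock tP CP xC).
Qed.

(** Removing the block [[set x]] is a bijection. *)
Lemma card_partitions_with_singleton D k x : x \notin D ->
  #|[set P in partitions_in (x |: D) k.+1 | [set x] \in P]| =
  #|partitions_in D k|.
Proof.
move=> xD.
have xP P : P \in partitions_in D k -> [set x] \notin P.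
  rewrite inE => /andP[PD _]; apply/negP => /(partition_notin PD xD).
  by rewrite inE eqxx.
rewrite -[RHS](@card_in_imset _ _ (fun P => [set x] |: P)); last first.
  move=> P Q /xP xP1 /xP xQ PQ.
  by rewrite -(finset.setU1K xP1) PQ finset.setU1K.
apply: eq_card => P; rewrite !inE.
apply/andP/imsetP => [[/andP[PD /eqP Pk] xP1]|[Q]].
  exists (P :\ [set x]); last by rewrite finset.setD1K.
  rewrite inE; apply/andP; split.
    have := partitionD1 PD xP1.
    by rewrite finset.setU1K.
  by move: Pk; rewrite (finset.cardsD1 [set x]) xP1 add1n => -[->].
move=> Qk ->; move: (Qk) (xP _ Qk); rewrite inE => /andP[QD /eqP Qk'] xQ.
split; last by rewrite finset.setU11.
rewrite finset.cardsU1 xQ Qk' add1n eqxx andbT.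
apply: partitionU1 => //; last by rewrite finset.disjoints1.
by apply/finset.set0Pn; exists x; rewrite inE.
Qed.

(** A partition in which [x] is not isolated arises from exactly one partition
    of the rest by adjoining [x] to one of its blocks. *)
Lemma card_partitions_without_singleton D k x : x \notin D ->
  #|[set P in partitions_in (x |: D) k | [set x] \notin P]| =
  k * #|partitions_in D k|.
Proof.
move=> xD.
pose glue (QB : {set {set T}} * {set T}) := (x |: QB.2) |: (QB.1 :\ QB.2).
pose A := [set QB | (QB.1 \in partitions_in D k) && (QB.2 \in QB.1)].
have cA : #|A| = k * #|partitions_in D k|.
  rewrite -sum1_card /A.
  rewrite (eq_bigl (fun QB => (QB.1 \in partitions_in D k) && (QB.2 \in QB.1))); last first.
    by move=> QB; rewrite inE.
  rewrite -(pair_big_dep (fun Q => Q \in partitions_in D k) (fun Q B => B \in Q) (fun _ _ => 1)) /=.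
  rewrite (eq_bigr (fun _ => k)).
    by rewrite sum_nat_const mulnC.
  by move=> Q; rewrite inE sum1_card => /andP[_ /eqP].
have glueD Q B : finset.partition Q D -> B \in Q -> x |: B \notin Q :\ B.
  move=> QD BQ; rewrite inE negb_and; apply/orP; right.
  by apply/negP => /(partition_notin QD xD); rewrite finset.setU11.
have glue_block Q B C : finset.partition Q D -> B \in Q -> C \in glue (Q, B) ->
    x \in C -> C = x |: B.
  move=> QD BQ; rewrite /glue !inE => /orP[/eqP//|/andP[_ CQ]].
  by rewrite (negPf (partition_notin QD xD CQ)).
rewrite -cA -(@card_in_imset _ _ glue); last first.
  move=> [Q B] [Q' B']; rewrite !inE/= => /andP[/andP[QD _] BQ] /andP[/andP[QD' _] BQ'] e.
  have BB' : x |: B = x |: B'.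
    by apply: (glue_block Q' B') => //; rewrite -?e ?finset.setU11//.
  have {}BB' : B = B'.
    by rewrite -(finset.setU1K (partition_notin QD xD BQ)) BB' finset.setU1K ?(partition_notin QD' xD BQ').
  subst B'; congr (_, _).
  rewrite -(finset.setD1K BQ) -(finset.setD1K BQ'); congr (_ |: _).
  rewrite -(finset.setU1K (glueD _ _ QD BQ)) -[RHS](finset.setU1K (glueD _ _ QD' BQ')).
  by move: e; rewrite /glue/= => ->.
apply: eq_card => P; rewrite !inE.
apply/andP/imsetP => [[/andP[PD /eqP Pk] xP]|[[Q B]]].
  pose C := finset.pblock P x.
  have xcov : x \in finset.cover P by rewrite (cover_partition PD) finset.setU11.
  have CP : C \in P by apply: finset.pblock_mem.
  have xC : x \in C by rewrite finset.mem_pblock.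
  have C0 : C :\ x != finset.set0.
    apply: contra xP => /eqP C0.
    by rewrite (_ : [set x] = C) // -(finset.setD1K xC) C0 finset.setU0.
  have CxP : C :\ x \notin P.
    apply/negP => CxP; have /finset.set0Pn[y yC] := C0.
    have := partition_mem_disjoint PD CxP CP yC.
    by move: yC; rewrite !inE => /andP[yx yC] /(_ yC) CC; move: xC; rewrite -CC !inE eqxx.
  (* [C] is the block of [x]: it is replaced by what remains of it without [x]. *)
  exists ((C :\ x) |: (P :\ C), C :\ x).
    rewrite !inE eqxx /= andbT; apply/andP; split; last first.
      rewrite finset.cardsU1 !inE (negPf CxP) andbF/=.
      by rewrite -Pk (finset.cardsD1 C P) CP.
    have -> : D = (C :\ x) :|: ((x |: D) :\: C).
      apply/setP => y; rewrite !inE; have [->/=|yx/=] := eqVneq y x.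
        by rewrite xC/= (negPf xD).
      have [yC/=|//] := boolP (y \in C).
      by have /fintype.subsetP/(_ _ yC) := partitionS PD CP; rewrite !inE (negPf yx).
    apply: partitionU1 => //; first exact: partitionD1.
    rewrite finset.disjoints_subset; apply/fintype.subsetP => y.
    by rewrite !inE => /andP[_ ->].
  rewrite /glue/= finset.setD1K//.
  rewrite finset.setU1K ?finset.setD1K//.
  by rewrite !inE (negPf CxP) andbF.
rewrite inE/= => /andP[]; rewrite inE => /andP[QD /eqP Qk] BQ ->; split; last first.
  apply/negP => xP; have := glue_block _ _ _ QD BQ xP; rewrite inE eqxx => /(_ isT) e.
  have /finset.set0Pn[y yB] := partition_neq0 QD BQ.
  have : y \in x |: B by rewrite !inE yB orbT.
  rewrite -e inE => /eqP yx; move: (partition_notin QD xD BQ).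
  by rewrite -yx yB.
apply/andP; split; last first.
  by rewrite /glue/= finset.cardsU1 (glueD _ _ QD BQ) -Qk (finset.cardsD1 B Q) BQ.
rewrite /glue/=.
have -> : x |: D = (x |: B) :|: (D :\: B).
  apply/setP => y; rewrite !inE -orbA; congr orb.
  have [yB/=|//] := boolP (y \in B).
  by have /fintype.subsetP/(_ _ yB) := partitionS QD BQ => ->.
apply: partitionU1; first exact: partitionD1.
  by apply/finset.set0Pn; exists x; rewrite finset.setU11.
rewrite finset.disjoints_subset; apply/fintype.subsetP => y.
rewrite !inE => /orP[/eqP ->|->//]; by rewrite (negPf xD) andbF.
Qed.

Lemma card_partitions_inU1 D k x : x \notin D ->
  #|partitions_in (x |: D) k.+1| =
  k.+1 * #|partitions_in D k.+1| + #|partitions_in D k|.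
Proof.
move=> xD; rewrite -(card_partitions_without_singleton _ xD) addnC.
rewrite -(card_partitions_with_singleton _ xD).
rewrite -(finset.cardsID [set P : {set {set T}} | [set x] \in P] (partitions_in (x |: D) k.+1)).
by congr addn; apply: eq_card => P; rewrite !inE// andbC.
Qed.

Lemma card_partitions_in0 D k :
  #|partitions_in D 0| = (D == finset.set0) /\ #|partitions_in finset.set0 k| = (k == 0).
Proof.
split.
  have [->|D0] := eqVneq D finset.set0.
    rewrite (_ : partitions_in finset.set0 0 = [set finset.set0]) ?cards1//.
    by apply/setP => P; rewrite !inE partition_set0 cards_eq0 andbb.
  apply/eqP; rewrite cards_eq0; apply/eqP/setP => P; rewrite !inE cards_eq0.
  apply/negP => /andP[/cover_partition PD /eqP P0]; move: D0.
  by rewrite -PD P0 /finset.cover big_set0 eqxx.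
rewrite (eq_card (B := [pred P | (P == finset.set0) && (k == 0)])); last first.
  move=> P; rewrite !inE partition_set0; apply/andP/andP => -[/eqP -> k0].
    by move: k0; rewrite cards0 eq_sym.
  by rewrite (eqP k0) cards0.
case: k => [|k]/=.
  rewrite (eq_card (B := pred1 (finset.set0 : {set {set T}}))) ?card1// => P.
  exact: andbT.
by rewrite eq_card0// => P; exact: andbF.
Qed.

End set_partitions.

(** Both sides obey the same recurrence, so only the cardinal of the ground set
    matters; this moves the recurrence to the ordinals. *)
Lemma card_partitions_in_eq (T T' : finType) (D : {set T}) (D' : {set T'}) k :
  #|D| = #|D'| -> #|partitions_in D k| = #|partitions_in D' k|.
Proof.
elim: {D}_.+1 {-2}D (ltnSn #|D|) D' k => // m IH D Dm D' k DD'.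
have [D0|/finset.set0Pn[x xD]] := eqVneq D finset.set0.
  move: DD'; rewrite D0 cards0 => /esym/eqP; rewrite cards_eq0 => /eqP ->.
  by rewrite !(card_partitions_in0 finset.set0 k).2.
have D'0 : D' != finset.set0 by rewrite -cards_eq0 -DD' (finset.cardsD1 x) xD.
have /finset.set0Pn[x' xD'] := D'0.
case: k => [|k].
  rewrite (card_partitions_in0 _ 0).1 (card_partitions_in0 _ 0).1 (negPf D'0).
  by rewrite -cards_eq0 (finset.cardsD1 x) xD.
have e : #|(D :\ x)%SET| = #|(D' :\ x')%SET|.
  by move: DD'; rewrite (finset.cardsD1 x) (finset.cardsD1 x' D') xD xD' => -[].
have l : (#|(D :\ x)%SET| < m)%N by move: Dm; rewrite (finset.cardsD1 x) xD.
rewrite -(finset.setD1K xD) -(finset.setD1K xD') !card_partitions_inU1 ?inE ?eqxx//.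
by rewrite !(IH _ _ _ _ e).
Qed.

Lemma stirling2S n k :
  stirling2 n.+1 k.+1 = (k.+1 * stirling2 n k.+1 + stirling2 n k)%N.
Proof.
pose D : {set 'I_n.+1} := (finset.setT :\ ord0)%SET.
have cD : #|[set: 'I_n]%SET| = #|D|.
  by have := finset.cardsD1 ord0 [set: 'I_n.+1]%SET; rewrite inE !cardsT !card_ord => -[].
rewrite /stirling2 -!/(partitions_in _ _) !(card_partitions_in_eq _ cD).
have o0 : ord0 \notin D by rewrite !inE eqxx.
by rewrite -(card_partitions_inU1 k o0) finset.setD1K// inE.
Qed.

Lemma stirling2n0 n : stirling2 n 0 = (n == 0)%N.
Proof.
rewrite /stirling2 -/(partitions_in _ _) (card_partitions_in0 _ 0).1.
by rewrite -cards_eq0 cardsT card_ord.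
Qed.

Lemma stirling20n k : stirling2 0 k = (k == 0)%N.
Proof.
rewrite /stirling2 -/(partitions_in _ _).
have -> : [set: 'I_0]%SET = finset.set0.
  by apply/eqP; rewrite -cards_eq0 cardsT card_ord.
by rewrite (card_partitions_in0 finset.set0 k).2.
Qed.

Lemma stirling2_small n k : (n < k)%N -> stirling2 n k = 0%N.
Proof.
elim: n k => [|n IH] [|k]//; first by rewrite stirling20n.
by rewrite ltnS stirling2S => nk; rewrite !IH ?muln0// ltnW.
Qed.

Lemma stirling2nn n : stirling2 n n = 1%N.
Proof.
elim: n => [|n IH]; first by rewrite stirling20n.
by rewrite stirling2S IH stirling2_small// muln0.
Qed.

Section fubini_polynomials.
Variable R : nzRingType.

Lemma coef_fubini_poly n k :
  (fubini_poly R n)`_k = (stirling2 n k * k`!)%:R.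
Proof.
rewrite /fubini_poly -(poly_def n.+1 (fun k => (stirling2 n k * k`!)%:R)).
by rewrite coef_poly; case: ltnP => // nk; rewrite stirling2_small.
Qed.

Lemma fubini_poly0 : fubini_poly R 0 = 1.
Proof.
apply/polyP => k; rewrite coef_fubini_poly stirling20n coef1.
by case: k.
Qed.

(** Coefficientwise this is the triangular recurrence of the Stirling numbers. *)
Lemma fubini_polyS n :
  fubini_poly R n.+1 = 'X * ((1 + 'X) * fubini_poly R n)^`().
Proof.
apply/polyP => -[|k]; rewrite coefXM coef_fubini_poly.
  by rewrite stirling2n0 mul0n.
rewrite coef_deriv mulrDl mul1r coefD coefXM !coef_fubini_poly/=.
rewrite -natrD -mulrnA; congr (_%:R).
by rewrite stirling2S factS; ring.
Qed.

End fubini_polynomials.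

Lemma size_fubini_poly (R : numDomainType) n : size (fubini_poly R n) = n.+1.
Proof.
apply/anti_leq/andP; split.
  by apply/leq_sizeP => j nj; rewrite coef_fubini_poly stirling2_small.
rewrite ltnNge; apply/negP => /leq_sizeP/(_ n (leqnn n)).
rewrite coef_fubini_poly stirling2nn mul1n => /eqP.
by rewrite pnatr_eq0 eqn0Ngt fact_gt0.
Qed.

(** * Location of the zeros *)

Section roots_of_derivative.
Variable R : realType.
Implicit Types (l : seq R) (z : R[i]).

Let prod_roots l : {poly R[i]} := \prod_(x <- l) ('X - (x%:C)%:P).

Lemma horner_deriv_prod_XsubC l z : (forall x, x \in l -> z != x%:C) ->
  ((prod_roots l)^`()).[z] = (prod_roots l).[z] * \sum_(x <- l) (z - x%:C)^-1.
Proof.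
elim: l => [|x l IH] zl; first by rewrite /prod_roots !big_nil derivC !hornerE.
rewrite /prod_roots !big_cons derivM derivXsubC mul1r hornerD !hornerM !hornerXsubC.
rewrite -/(prod_roots l) IH => [|y yl]; last by rewrite zl// inE yl orbT.
have zx : z - x%:C != 0 by rewrite subr_eq0 zl// mem_head.
by field.
Qed.

Lemma complex_invE (u v : R) :
  (u +i* v)^-1 = (u / (u ^+ 2 + v ^+ 2)) +i* (- v / (u ^+ 2 + v ^+ 2)).
Proof. by rewrite /GRing.inv/= mulNr. Qed.

Lemma Re_sum (I : Type) (r : seq I) (F : I -> R[i]) :
  complex.Re (\sum_(i <- r) F i) = \sum_(i <- r) complex.Re (F i).
Proof. by elim/big_rec2: _ => // i x y _ <-; case: (F i) y => ? ? []. Qed.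

Lemma Im_sum (I : Type) (r : seq I) (F : I -> R[i]) :
  complex.Im (\sum_(i <- r) F i) = \sum_(i <- r) complex.Im (F i).
Proof. by elim/big_rec2: _ => // i x y _ <-; case: (F i) y => ? ? []. Qed.

(** The logarithmic derivative [\sum (z - x)^-1] cannot vanish off the interval:
    its terms all lie strictly on one side of the real axis when [z] is not
    real, and all have the same sign when [z] is real but outside. *)
Lemma roots_deriv_in_itv (a b : R) l z : l != [::] ->
  {in l, forall x, x \in `[a, b]} -> root ((prod_roots l)^`()) z ->
  exists2 x, x \in `[a, b] & z = x%:C.
Proof.
move=> l0 lab rz; apply: contrapT => nz.
have zl x : x \in l -> z != x%:C.
  by move=> xl; apply/eqP => zx; apply: nz; exists x => //; exact: lab.
have := rz; rewrite /root horner_deriv_prod_XsubC// mulf_eq0 => /orP[|].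
  rewrite /prod_roots horner_prod; under eq_bigr do rewrite hornerXsubC.
  rewrite prodf_seq_eq0 => /hasP[x xl] /=; rewrite subr_eq0 => zx.
  by have := zl _ xl; rewrite zx.
case: z nz rz zl => u v nz _ zl /eqP S0.
have sum_neq0 (f : R -> R) : {in l, forall x, 0 < f x} -> \sum_(x <- l) f x != 0.
  case: {+}l l0 => [//|y l' _ f0]; rewrite big_cons gt_eqF//.
  rewrite ltr_wpDr ?f0 ?mem_head// big_seq sumr_ge0// => x xl'.
  by rewrite ltW// f0// inE xl' orbT.
have den x : (u +i* v - x%:C)^-1 = ((u - x) / ((u - x) ^+ 2 + v ^+ 2)) +i*
    (- v / ((u - x) ^+ 2 + v ^+ 2)).
  by rewrite -complex_invE; congr (_^-1); simpc; rewrite ?subr0.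
have [v0|v0] := eqVneq v 0.
  have uab : u < a \/ b < u.
    have [ua|au] := ltP u a; first by left.
    right; rewrite ltNge; apply/negP => ub; apply: nz; exists u.
      by rewrite in_itv/= au.
    by rewrite v0.
  have := congr1 (@complex.Re _) S0; rewrite Re_sum.
  have -> : \sum_(x <- l) complex.Re (u +i* v - x%:C)^-1 =
      \sum_(x <- l) (u - x) / (u - x) / (u - x).
    by apply: eq_bigr => x _; rewrite den/= v0 expr0n addr0 expr2 invfM mulrA.
  case: uab => [ua|bu]; last first.
    move/eqP; apply/negP/sum_neq0 => x /lab; rewrite in_itv/= => /andP[ax xb].
    have ux : 0 < u - x by rewrite subr_gt0 (le_lt_trans xb).
    by rewrite divff ?gt_eqF// mul1r invr_gt0.
  move/eqP; rewrite -oppr_eq0 -sumrN; apply/negP/sum_neq0 => x /lab.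
  rewrite in_itv/= => /andP[ax xb].
  have ux : u - x < 0 by rewrite subr_lt0 (lt_le_trans ua).
  by rewrite divff ?lt_eqF// mul1r oppr_gt0 invr_lt0.
have := congr1 (@complex.Im _) S0; rewrite Im_sum.
have -> : \sum_(x <- l) complex.Im (u +i* v - x%:C)^-1 =
    \sum_(x <- l) - (v / ((u - x) ^+ 2 + v ^+ 2)).
  by apply: eq_bigr => x _; rewrite den/= mulNr.
rewrite sumrN -mulr_sumr => /eqP; rewrite oppr_eq0 mulf_eq0 (negPf v0)/=.
apply/negP/sum_neq0 => x xl; rewrite invr_gt0 ltr_wpDl ?sqr_ge0//.
by rewrite exprn_even_gt0.
Qed.

End roots_of_derivative.

Section zeros_of_fubini.
Variable R : realType.

Lemma fubini_poly_neq0 n : fubini_poly R[i] n != 0.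
Proof. by rewrite -size_poly_gt0 size_fubini_poly. Qed.

Lemma lead_coef_fubini_poly n : lead_coef (fubini_poly R[i] n) = n`!%:R.
Proof.
by rewrite lead_coefE size_fubini_poly coef_fubini_poly stirling2nn mul1n.
Qed.

Lemma zerosE (p : {poly R[i]}) :
  p = lead_coef p *: \prod_(z <- zeros p) ('X - z%:P).
Proof. by rewrite /zeros; case: closed_field_poly_normal. Qed.

Lemma root_zeros (p : {poly R[i]}) z : p != 0 -> (z \in zeros p) = root p z.
Proof.
move=> p0; rewrite [in RHS](zerosE p) rootZ ?lead_coef_eq0//.
by rewrite root_prod_XsubC.
Qed.

(** The zeros of [F (n + 1)] are [0] and those of the derivative of
    [(1 + X) F n], whose zeros are [-1] and the zeros of [F n]. *)
Lemma zeros_fubini_real n z : z \in zeros (fubini_poly R[i] n) ->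
  exists2 x : R, x \in `[-1, 0] & z = x%:C.
Proof.
elim: n z => [|n IH] z; rewrite root_zeros ?fubini_poly_neq0//.
  by rewrite fubini_poly0 (negPf (root1 _)).
rewrite fubini_polyS rootM rootX => /orP[/eqP ->|].
  by exists 0 => //; rewrite in_itv/= lexx lerN10.
pose l := -1 :: map (@complex.Re R) (zeros (fubini_poly R[i] n)).
have -> : (1 + 'X) * fubini_poly R[i] n =
    n`!%:R *: \prod_(x <- l) ('X - (x%:C)%:P).
  rewrite [in LHS](zerosE (fubini_poly _ n)) lead_coef_fubini_poly.
  rewrite -scalerAr big_cons; congr (_ *: (_ * _)).
    have -> : (-1 : R)%:C = -1 by apply/eqP; rewrite eq_complex/= oppr0 !eqxx.
    by rewrite addrC (polyCN (1 : R[i])) polyC1 opprK.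
  rewrite big_map big_seq [RHS]big_seq; apply: eq_bigr => y /IH[x _ ->].
  by [].
rewrite derivZ rootZ ?pnatr_eq0 -?lt0n ?fact_gt0//.
apply: roots_deriv_in_itv => // x; rewrite inE => /orP[/eqP ->|].
  by rewrite in_itv/= lexx lerN10.
by move=> /mapP[y /IH[x' x'I ->] ->].
Qed.

Definition fubini_zeros n : seq R :=
  map (@complex.Re R) (zeros (fubini_poly R[i] n)).

Lemma fubini_zeros_itv n x : x \in fubini_zeros n -> x \in `[-1, 0].
Proof. by move=> /mapP[y /zeros_fubini_real[x' x'I ->] ->]. Qed.

Lemma size_fubini_zeros n : size (fubini_zeros n) = n.
Proof. by rewrite size_map size_zeros ?fubini_poly_neq0// size_fubini_poly. Qed.

Lemma zeros_fubiniE n :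
  zeros (fubini_poly R[i] n) = [seq x%:C | x <- fubini_zeros n].
Proof.
rewrite /fubini_zeros -map_comp -[LHS]map_id; apply/eq_in_map => z.
by move=> /zeros_fubini_real[x _ ->].
Qed.

(** With real zeros, the factorisation already holds over the reals, where the
    generating functions below live. *)
Lemma fubini_polyE n :
  fubini_poly R n = n`!%:R *: \prod_(x <- fubini_zeros n) ('X - x%:P).
Proof.
apply: (map_poly_inj (real_complex R)).
rewrite map_polyZ rmorph_nat rmorph_prod/=.
under eq_bigr do rewrite map_polyXsubC.
transitivity (fubini_poly R[i] n).
  by apply/polyP => k; rewrite coef_map !coef_fubini_poly; exact: rmorph_nat.
by rewrite [LHS]zerosE lead_coef_fubini_poly zeros_fubiniE big_map.
Qed.

End zeros_of_fubini.

(** * Power sums and reciprocal polynomials *)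

Section reciprocal_polynomial.
Variable K : numFieldType.
Implicit Types l : seq K.

(** The reversed polynomial: its logarithmic derivative generates the power sums. *)
Definition recip_prod l : {poly K} := \prod_(x <- l) (1 - x *: 'X).

Definition power_sum l k : K := \sum_(x <- l) x ^+ k.

Lemma size_recip_prod l : (size (recip_prod l) <= (size l).+1)%N.
Proof.
elim: l => [|x l IH]; first by rewrite /recip_prod big_nil size_poly1.
rewrite /recip_prod big_cons (leq_trans (size_polyMleq _ _))//.
rewrite -/(recip_prod l) -subn1 leq_subLR add1n /=.
have : (size (1 - x *: 'X : {poly K})%R <= 2)%N.
  rewrite (leq_trans (size_polyD _ _))// geq_max size_poly1 size_polyN /=.
  by rewrite (leq_trans (size_scale_leq _ _)) ?size_polyX.
by move=> /leq_add/(_ IH); rewrite !addSn add0n.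
Qed.

Lemma coef_recip_prod l i j : (i + j = size l)%N ->
  (recip_prod l)`_j = (\prod_(x <- l) ('X - x%:P))`_i.
Proof.
elim: l i j => [|x l IH] i j.
  case: i j => [|i] [|j]// _.
  by rewrite /recip_prod !big_nil.
move=> ij; rewrite /recip_prod !big_cons -/(recip_prod l).
rewrite !mulrBl mul1r !coefB coefXM coefCM -scalerAl coefZ coefXM.
case: i j ij => [|i] [|j]//= ij.
- move: ij; rewrite add0n => -[ij].
  by rewrite [X in X - _]nth_default ?ij ?size_recip_prod// (IH 0%N).
- move: ij; rewrite addn0 => -[ij].
  rewrite mulr0 !subr0 (IH i 0%N) ?addn0//.
  by rewrite [X in _ - x * X]nth_default ?mulr0 ?subr0// size_prod_XsubC ij.
- move: ij; rewrite addSn addnS => -[ij].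
  by rewrite (IH i j.+1) ?addnS// (IH i.+1 j) ?addSn.
Qed.

(** Newton's identities, packaged as a congruence of generating functions. *)
Lemma newton_identities l N : exists B,
  recip_prod l * (\poly_(k < N) power_sum l k) =
  (size l)%:R *: recip_prod l - 'X * (recip_prod l)^`() + 'X^N * B.
Proof.
elim: l => [|x l [B IH]].
  exists 0; rewrite /recip_prod !big_nil derivC mulr0 subr0 mulr0 addr0 scale0r.
  by rewrite mul1r; apply/polyP => k; rewrite coef_poly /power_sum big_nil coef0 if_same.
have geom : (1 - x *: 'X) * (\poly_(k < N) x ^+ k) = 1 - x ^+ N *: 'X^N.
  have -> : \poly_(k < N) x ^+ k = \sum_(k < N) (x *: 'X) ^+ k.
    by rewrite poly_def; apply: eq_bigr => i _; rewrite exprZn.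
  by rewrite -[LHS]opprK -mulNr opprB -subrX1 opprB exprZn.
exists ((1 - x *: 'X) * B - x ^+ N *: recip_prod l).
have -> : \poly_(k < N) power_sum (x :: l) k =
    \poly_(k < N) x ^+ k + \poly_(k < N) power_sum l k.
  by apply/polyP => k; rewrite coefD !coef_poly /power_sum big_cons; case: ifP;
    rewrite ?addr0.
have -> : recip_prod (x :: l) = (1 - x *: 'X) * recip_prod l.
  by rewrite /recip_prod big_cons.
rewrite derivM derivB derivC derivZ derivX.
transitivity ((1 - x *: 'X) * (\poly_(k < N) x ^+ k) * recip_prod l +
  (1 - x *: 'X) * (recip_prod l * \poly_(k < N) power_sum l k)); first by ring.
rewrite geom IH /= -[(size l).+1]addn1 natrD scalerDl scale1r -!mul_polyC.
by ring.
Qed.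

End reciprocal_polynomial.

Section fubini_reciprocal.
Variable R : realType.

Let G n : {poly R} := recip_prod (fubini_zeros R n).

Lemma coef_recip_fubini n i j : (i + j = n)%N ->
  (G n)`_j = (stirling2 n i * i`!)%:R / n`!%:R.
Proof.
move=> ij; rewrite /G (@coef_recip_prod _ _ i) ?size_fubini_zeros//.
rewrite -coef_fubini_poly fubini_polyE coefZ mulrC mulKf// pnatr_eq0 -lt0n fact_gt0.
Qed.

Lemma coef_recip_fubini_small n j : (n < j)%N -> (G n)`_j = 0.
Proof.
move=> nj; apply/nth_default/(leq_trans (size_recip_prod _)).
by rewrite size_fubini_zeros.
Qed.

(** The recurrence of the Fubini polynomials after the substitution of [1/X] for
    the variable. *)
Lemma recip_fubiniS n : n.+1%:R *: G n.+1 =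
  (n.+1%:R%:P + n%:R *: 'X) * G n - ('X * (1 + 'X)) * (G n)^`().
Proof.
pose G1 j : R := if j is i.+1 then (G n)`_i else 0.
have GE j : (n.+1%:R *: G n.+1)`_j =
    n.+1%:R * (G n)`_j + n%:R * G1 j - (j%:R * (G n)`_j + j.-1%:R * G1 j).
  rewrite coefZ.
  have n0 m : (m`!%:R : R) != 0 by rewrite pnatr_eq0 -lt0n fact_gt0.
  have nS0 : n.+1%:R != 0 :> R by rewrite pnatr_eq0.
  have [jn|jn] := leqP j n; last first.
    rewrite (coef_recip_fubini_small jn).
    case: j jn => [//|j] jn /=.
    move: jn; rewrite ltnS leq_eqVlt => /orP[/eqP <-|jn].
      by rewrite (@coef_recip_fubini n.+1 0 n.+1)// stirling2n0 mul0n; ring.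
    by rewrite (coef_recip_fubini_small jn) coef_recip_fubini_small//; ring.
  have ij : (n - j + j = n)%N by rewrite subnK.
  move: (n - j)%N ij => i ij.
  have G1E : G1 j = (stirling2 n i.+1 * i.+1`!)%:R / n`!%:R.
    case: j ij {jn} => [|j] ij; rewrite /G1.
      by rewrite stirling2_small ?mul0n ?mul0r// -ij addn0.
    by rewrite (@coef_recip_fubini n i.+1 j)// addSn -addnS.
  have -> : n.+1%:R * (G n.+1)`_j = (stirling2 n.+1 i.+1 * i.+1`!)%:R / n`!%:R.
    rewrite (@coef_recip_fubini n.+1 i.+1 j) ?addSn ?ij// (factS n) [in LHS]natrM.
    rewrite [in LHS](natrM _ n.+1) ; field.
    by rewrite n0 nat1r nS0.
  have G1D : n%:R * G1 j - j.-1%:R * G1 j = i.+1%:R * G1 j.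
    rewrite -mulrBl; case: j jn ij {G1E} => [|j] jn ij; first by rewrite !mulr0.
    by rewrite -natrB/= ?(ltnW jn)//; congr (_%:R * _); rewrite -ij addnS -addSn addnK.
  transitivity (i.+1%:R * (G n)`_j + i.+1%:R * G1 j).
    rewrite (@coef_recip_fubini n i j)// G1E stirling2S factS.
    by rewrite !(natrM, natrD); ring.
  have -> : n.+1%:R = i.+1%:R + j%:R :> R by rewrite -natrD addSn ij.
  by rewrite -G1D; ring.
apply/polyP => j; rewrite GE mulrDl mulrDr mulr1 mulrDl.
rewrite -mulrA -!scalerAl coefB !coefD coefCM coefZ !coefXM.
have dE k : (G n)^`()`_k = k.+1%:R * (G n)`_k.+1.
  by rewrite coef_deriv mulr_natl.
case: j => [|[|j]]; rewrite /G1/= ?dE.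
- by rewrite !mulr0 mul0r !addr0.
- by rewrite mul0r !addr0.
- by [].
Qed.

End fubini_reciprocal.

Section logarithm_congruence.
Variables (R : realType) (N : nat).

Let G n : {poly R} := recip_prod (fubini_zeros R n).

(** Truncation of the power series [log(1 + X) / X]. *)
Definition log_series : {poly R} := \poly_(k < N) ((-1) ^+ k / k.+1%:R).

(** The derivative of [log(1 + X)] times [1 + X] is [1], up to truncation. *)
Lemma log_series_ode : (1 + 'X) * ('X * log_series^`() + log_series) =
  1 - (-1) ^+ N *: 'X^N.
Proof.
have -> : 'X * log_series^`() + log_series = \sum_(k < N) (- 'X) ^+ k.
  apply/polyP => k; rewrite coefD coefXM coef_deriv coef_poly coef_sum.
  under eq_bigr => i _.
    rewrite (_ : (- 'X : {poly R}) ^+ i = (-1) ^+ i *: 'X^i); last first.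
      by rewrite -[- 'X]scaleN1r exprZn.
    rewrite coefZ coefXn; over.
  have -> : \sum_(i < N) ((-1) ^+ i * (k == i)%:R : R) =
      if (k < N)%N then (-1) ^+ k else 0.
    case: ltnP => kN; last first.
      by apply: big1 => i _; rewrite gtn_eqF ?mulr0// (leq_trans _ kN).
    rewrite (bigD1 (Ordinal kN))//= eqxx mulr1 big1 ?addr0// => i ik.
    rewrite eq_sym (_ : (i == k :> nat) = false) ?mulr0//.
    by apply/negbTE; rewrite -(inj_eq val_inj) in ik.
  rewrite [log_series`_k]coef_poly.
  case: k => [|k] /=; first by rewrite add0r divr1.
  case: ifP => _; last by rewrite mul0rn addr0.
  by rewrite -mulrSr -[_ *+ k.+2]mulr_natr divfK// pnatr_eq0.
have := subrX1 (- 'X : {poly R}) N.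
move=> /(congr1 (fun p => - p)); rewrite -mulNr !opprB opprK => <-.
by rewrite -[- 'X]scaleN1r exprZn.
Qed.

Lemma poly_split0 (p : {poly R}) : exists U, p = (p`_0)%:P + 'X * U.
Proof.
exists (\poly_(k < size p) p`_k.+1); apply/polyP => k.
rewrite coefD coefC coefXM coef_poly.
case: k => [|k]/=; first by rewrite addr0.
by rewrite add0r; case: ltnP => // pk; rewrite nth_default// (leq_trans pk).
Qed.

(** Leibniz rule applied to [g (1 + X) L^(n + 1)]: when [(1 + X) (X L)' = 1], the
    recurrence for [g] becomes, for this product, a recurrence solved by the
    constant [1]. *)
Lemma log_series_step (g1 g L : {poly R}) n :
  n.+1%:R *: g1 = (n.+1%:R%:P + n%:R *: 'X) * g - ('X * (1 + 'X)) * g^`() ->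
  n.+1%:R *: (g1 * (1 + 'X) * L ^+ n.+2) +
    L * 'X * (1 + 'X) * (g * (1 + 'X) * L ^+ n.+1)^`() =
  n.+1%:R *: (g * (1 + 'X) * L ^+ n.+1) * ((1 + 'X) * ('X * L^`() + L)).
Proof.
rewrite -!mul_polyC !polyC_natr => g1E.
rewrite [X in X + _](_ : _ = (n.+1%:R * g1) * (1 + 'X) * L ^+ n.+2); last by ring.
rewrite g1E !derivM derivD derivC derivX deriv_exp/=.
rewrite !exprS; ring.
Qed.

Let cancel_scalar n (W : {poly R}) d K :
  n.+1%:R%:P * W = n.+1%:R%:P + 'X^d * K -> exists V, W = 1 + 'X^d * V.
Proof.
move=> WK; exists (n.+1%:R^-1%:P * K); apply: (@mulfI _ n.+1%:R%:P).
  by rewrite polyC_eq0 pnatr_eq0.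
rewrite WK mulrDr mulr1; congr (_ + _); rewrite mulrCA [n.+1%:R%:P * _]mulrA.
by rewrite -polyCM divff ?mul1r// pnatr_eq0.
Qed.

Hypothesis N_gt0 : (0 < N)%N.

(** The precision is capped at [N], the truncation order of [log_series]. *)
Lemma recip_fubini_log n : exists V,
  G n * (1 + 'X) * log_series ^+ n.+1 = 1 + 'X^(minn n.+1 N) * V.
Proof.
have [U LU] : exists U, (1 + 'X) * log_series = 1 + 'X * U.
  have [U UE] := poly_split0 ((1 + 'X) * log_series); exists U.
  rewrite UE; congr (_ + _).
  by rewrite mulrDl mul1r coefD coefXM/= coef_poly N_gt0 divr1 expr0 addr0.
elim: n => [|n [V IH]].
  exists U; rewrite /G /recip_prod (size0nil (size_fubini_zeros R 0)) big_nil mul1r.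
  by rewrite expr1 LU (minn_idPl N_gt0) expr1.
have := log_series_step log_series (recip_fubiniS R n).
rewrite -!/(G _) IH log_series_ode.
move: (G n.+1 * _ * _) => W.
rewrite derivD derivC add0r derivM derivXn -!mul_polyC.
(* Below the truncation order, one power of ['X] is gained at each step: the
witnesses collect the terms of [log_series_step] divisible by the power. *)
have [nN|Nn] := ltnP n.+1 N.
  move=> H; rewrite (minn_idPl nN).
  refine (@cancel_scalar n W n.+2
    (- V^`() - U * (n.+1%:R%:P * V + 'X * V^`())
    - n.+1%:R%:P * ((-1) ^+ N)%:P * 'X^(N - n.+2) * (1 + 'X^(n.+1) * V)) _).
  rewrite -[LHS](addrK (log_series * 'X * (1 + 'X) *
    ('X^n *+ n.+1 * V + 'X^(n.+1) * V^`()))) H.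
  have XN : 'X^N = 'X^(n.+2) * 'X^(N - n.+2) :> {poly R} by rewrite -exprD subnKC.
  rewrite [in LHS]XN.
  rewrite [log_series * _ * _](_ : _ = 'X * (1 + 'X * U)); last by rewrite -LU; ring.
  rewrite !polyC_natr !exprS; ring.
move=> H; rewrite (minn_idPr (leqW Nn)); refine (@cancel_scalar n W N
  (n.+1%:R%:P * V - n.+1%:R%:P * ((-1) ^+ N)%:P * (1 + 'X^N * V)
    - log_series * (1 + 'X) * (N%:R%:P * V + 'X * V^`())) _).
rewrite -[LHS](addrK (log_series * 'X * (1 + 'X) *
  ('X^(N.-1) *+ N * V + 'X^N * V^`()))) H.
have XN : 'X * ('X^(N.-1) *+ N) = N%:R * 'X^N :> {poly R}.
  by rewrite mulrnAr -exprS prednK// mulr_natl.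
rewrite [X in _ - X](_ : _ = log_series * (1 + 'X) *
  ('X * ('X^(N.-1) *+ N) * V + 'X * 'X^N * V^`())); last by ring.
by rewrite XN !polyC_natr; move: 'X^N => XN'; ring.
Qed.

(** The logarithmic derivative of the congruence of [recip_fubini_log], combined
    with Newton's identities. *)
Lemma log_series_power_sums n : (N <= n)%N -> exists E,
  (1 + 'X) * log_series * (\poly_(k < N) power_sum (fubini_zeros R n) k) =
  n.+1%:R%:P - log_series + 'X^N * E.
Proof.
move=> Nn; have [V WE] := recip_fubini_log n.
have [B] := newton_identities (fubini_zeros R n) N.
rewrite size_fubini_zeros -/(G n) -mul_polyC polyC_natr.
move: (\poly_(k < N) _) => P GP.
have LE := log_series_ode; rewrite -mul_polyC in LE.
rewrite (minn_idPr (leqW Nn)) in WE.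
move: (G n) log_series GP LE WE => g L GP LE WE.
(* [E] is the defect of the announced identity. Up to multiples
of ['X^N], the product [W = g (1 + X) L^(n + 1)] is [1], so that [X W'] is [0],
while [L X (1 + X) W'] is [W E]. *)
pose E := n.+1%:R%:P - L - (1 + 'X) * L * P.
pose B1 := (1 + 'X) ^+ 2 * L ^+ n.+2 * B - n.+1%:R * ((-1) ^+ N)%:P * (1 + 'X^N * V).
have H : L * 'X * (1 + 'X) * (g * (1 + 'X) * L ^+ n.+1)^`() =
    (g * (1 + 'X) * L ^+ n.+1) * E + 'X^N * B1.
  have -> : L * 'X * (1 + 'X) * (g * (1 + 'X) * L ^+ n.+1)^`() =
    (1 + 'X) ^+ 2 * L ^+ n.+2 * ('X * g^`()) + 'X * L * (g * (1 + 'X) * L ^+ n.+1)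
    + n.+1%:R * (g * (1 + 'X) * L ^+ n.+1) * ((1 + 'X) * ('X * L^`() + L) - (1 + 'X) * L).
    rewrite !derivM derivD derivC derivX deriv_exp/= !exprS; ring.
  have -> : 'X * g^`() = n%:R * g + 'X^N * B - g * P by rewrite GP; ring.
  rewrite LE /E /B1 -WE polyC_natr -[n.+1%:R]natr1 !exprS.
  by move: 'X^N (L ^+ n) => XN Ln; ring.
have XW : 'X * (g * (1 + 'X) * L ^+ n.+1)^`() = 'X^N * (N%:R * V + 'X * V^`()).
  have XN : 'X * ('X^(N.-1) *+ N) = N%:R * 'X^N :> {poly R}.
    by rewrite mulrnAr -exprS prednK// mulr_natl.
  rewrite WE derivD derivC add0r derivM derivXn mulrDr mulrA XN; ring.
exists (B1 + V * E - L * (1 + 'X) * (N%:R * V + 'X * V^`())).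
move: H; rewrite [_ * 'X * _](_ : _ = L * (1 + 'X) * 'X); last by ring.
rewrite -mulrA XW WE => H.
have -> : (1 + 'X) * L * P = n.+1%:R%:P - L - E by rewrite /E; ring.
have {1}-> : E = L * (1 + 'X) * ('X^N * (N%:R * V + 'X * V^`()))
    - 'X^N * B1 - 'X^N * V * E by rewrite H; ring.
ring.
Qed.

End logarithm_congruence.

(** * Cauchy numbers and the limits of the moments *)

Section cauchy_numbers.
Variable R : realType.
Local Notation leb := (@lebesgue_measure R).

(** The binomial coefficient of [- 'X] over [k], as a polynomial. *)
Definition neg_binomial k : {poly R} :=
  ((-1) ^+ k / k`!%:R) *: \prod_(j < k) ('X + j%:R%:P).

Lemma neg_binomial0 : neg_binomial 0 = 1.
Proof. by rewrite /neg_binomial big_ord0 fact0 divr1 expr0 scale1r. Qed.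

Lemma neg_binomialS k : k.+1%:R *: neg_binomial k.+1 =
  - (('X + k%:R%:P) * neg_binomial k).
Proof.
have e : k.+1%:R * ((-1) ^+ k.+1 / k.+1`!%:R) = - ((-1) ^+ k / k`!%:R) :> R.
  rewrite exprS factS natrM; field.
  by rewrite nat1r !pnatr_eq0/= -lt0n fact_gt0.
rewrite /neg_binomial scalerA e scaleNr big_ord_recr/=.
by rewrite [in RHS]mulrC -scalerAl.
Qed.

Let lam j : R := (-1) ^+ j / j.+1%:R.

(** The generating function of the binomials is [exp (- s log (1 + X))], and
    differentiating it in [s] multiplies it by [- log (1 + X)]; the identity is
    proved by induction from [neg_binomialS]. *)
Lemma deriv_neg_binomial k : (neg_binomial k)^`() =
  - \sum_(j < k) lam j *: neg_binomial (k.-1 - j).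
Proof.
pose D k : {poly R} := \sum_(j < k) lam j *: neg_binomial (k.-1 - j).
rewrite -/(D k).
have DS m : m.+1%:R *: D m.+1 = neg_binomial m - ('X + m%:R%:P) * D m.
  have bS i : i.+1%:R *: neg_binomial i.+1 + i%:R *: neg_binomial i =
      - ('X * neg_binomial i).
    by rewrite neg_binomialS -mul_polyC; ring.
  have lS j : j.+1%:R * lam j = (-1) ^+ j.
    by rewrite /lam mulrC divfK// pnatr_eq0.
  have split1 l (j : nat) : (j < l)%N -> l%:R *: (lam j *: neg_binomial (l.-1 - j)) =
      (-1) ^+ j *: neg_binomial (l.-1 - j) +
      lam j *: ((l.-1 - j)%:R *: neg_binomial (l.-1 - j)).
    move=> jl; move: (neg_binomial (l.-1 - j)) => b; rewrite -lS !scalerA -scalerDl; congr (_ *: _).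
    by rewrite [lam j * _]mulrC -mulrDl -natrD; congr (_%:R * _); lia.
  have sum1 l : l%:R *: D l = \sum_(j < l) (-1) ^+ j *: neg_binomial (l.-1 - j) +
      \sum_(j < l) lam j *: ((l.-1 - j)%:R *: neg_binomial (l.-1 - j)).
    by rewrite /D scaler_sumr -big_split; apply: eq_bigr => j _; exact: split1.
  apply/eqP; rewrite mulrDl opprD addrA -subr_eq opprK addrC; apply/eqP.
  rewrite mul_polyC !sum1 big_ord_recl big_ord_recr/= subnn scale0r scaler0 addr0.
  rewrite expr0 scale1r subn0.
  have -> : \sum_(i < m) (-1) ^+ bump 0 i *: neg_binomial (m - bump 0 i) =
      - \sum_(j < m) (-1) ^+ j *: neg_binomial (m.-1 - j).
    rewrite -sumrN; apply: eq_bigr => i _.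
    by rewrite /bump leq0n add1n exprS mulN1r scaleNr; congr (- (_ *: neg_binomial _)); lia.
  have XD : - ('X * D m) = \sum_(i < m) lam i *: ((m - i)%:R *: neg_binomial (m - i)) +
      \sum_(j < m) lam j *: ((m.-1 - j)%:R *: neg_binomial (m.-1 - j)).
    rewrite -big_split /D mulr_sumr -sumrN; apply: eq_bigr => i _.
    rewrite /= -scalerDr -scalerAr -scalerN -bS.
    by have -> : (m - i = (m.-1 - i).+1)%N by (have := ltn_ord i; lia).
  rewrite XD; ring.
elim: k => [|k IH].
  by rewrite neg_binomial0 derivC /D big_ord0 oppr0.
apply: (@scalerI _ _ k.+1%:R); first by rewrite pnatr_eq0.
rewrite -derivZ neg_binomialS derivN derivM IH derivD derivX derivC.
rewrite scalerN DS addr0 mul1r; ring.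
Qed.

Lemma horner_neg_binomial k x :
  (neg_binomial k).[x] = (-1) ^+ k / k`!%:R * \prod_(j < k) (x + j%:R).
Proof.
rewrite hornerZ horner_prod; congr (_ * _).
by apply: eq_bigr => j _; rewrite hornerD hornerX hornerC.
Qed.

Let integrable_horner (p : {poly R}) : leb.-integrable `[0, 1] (EFin \o horner p).
Proof.
apply: continuous_compact_integrable; first exact: segment_compact.
by apply: continuous_subspaceT; exact: continuous_horner.
Qed.

Definition poly_integral (p : {poly R}) : R := \int[leb]_(x in `[0, 1]) p.[x].

Lemma poly_integralD p q :
  poly_integral (p + q) = poly_integral p + poly_integral q.
Proof.
rewrite /poly_integral; under eq_Rintegral do rewrite hornerD.
by rewrite RintegralD.
Qed.

Lemma poly_integralZ c p : poly_integral (c *: p) = c * poly_integral p.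
Proof.
rewrite /poly_integral; under eq_Rintegral do rewrite hornerZ.
by rewrite RintegralZl.
Qed.

Lemma poly_integral_deriv p : poly_integral p^`() = p.[1] - p.[0].
Proof.
rewrite /poly_integral /Rintegral.
rewrite (@continuous_FTC2 _ _ (horner p) 0 1 ltr01)//=.
- by apply: continuous_subspaceT; exact: continuous_horner.
- split => //.
  + apply: cvg_at_right_filter; exact: continuous_horner.
  + apply: cvg_at_left_filter; exact: continuous_horner.
- by move=> x _; rewrite derivE.
Qed.

Definition fubini_moment k : R := (-1) ^+ k * (cauchy_number R k / k`!%:R).

Lemma poly_integral_neg_binomial k :
  poly_integral (neg_binomial k) = fubini_moment k.
Proof.
rewrite /fubini_moment mulrA mulrAC /neg_binomial poly_integralZ; congr (_ * _).
rewrite /poly_integral /cauchy_number; apply: eq_Rintegral => x _.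
by rewrite horner_prod; apply: eq_bigr => j _; rewrite hornerD hornerX hornerC.
Qed.

(** Integrating [deriv_neg_binomial] over [[0, 1]]: the moments are the
    coefficients of the inverse of [(1 + X) log(1 + X) / X]. *)
Lemma fubini_moment_convolution k :
  \sum_(j < k.+1) lam j * fubini_moment (k - j) = (-1) ^+ k.
Proof.
have b1 : (neg_binomial k.+1).[1] = (-1) ^+ k.+1.
  rewrite horner_neg_binomial.
  have -> : \prod_(j < k.+1) (1 + j%:R) = k.+1`!%:R :> R.
    rewrite fact_prod natr_prod big_add1 big_mkord.
    by apply: eq_bigr => j _; rewrite nat1r.
  by rewrite divfK// pnatr_eq0 -lt0n fact_gt0.
have b0 : (neg_binomial k.+1).[0] = 0.
  by rewrite horner_neg_binomial big_ord_recl addr0 mul0r mulr0.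
have := poly_integral_deriv (neg_binomial k.+1).
rewrite b1 b0 subr0 exprS mulN1r deriv_neg_binomial /= -scaleN1r poly_integralZ mulN1r.
move=> /oppr_inj <-.
pose I := poly_integral; rewrite -/I.
rewrite (big_morph I poly_integralD (id1 := 0)); last first.
  by rewrite /I -(scale0r 0) poly_integralZ mul0r.
by apply: eq_bigr => j _; rewrite /I poly_integralZ poly_integral_neg_binomial.
Qed.

Lemma poly_congr (p q : {poly R}) N : (forall k, (k < N)%N -> p`_k = q`_k) ->
  exists E, p = q + 'X^N * E.
Proof.
move=> pq; exists (drop_poly N (p - q)).
rewrite -[LHS](subrK q) addrC; congr (_ + _).
rewrite -{1}(poly_take_drop N (p - q)).
rewrite (_ : take_poly N (p - q) = 0) ?add0r 1?mulrC//.
by apply/polyP => k; rewrite coef_take_poly coef0 coefB; case: ifP => // kN;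
  rewrite pq// subrr.
Qed.

(** From the order [N = k + 1] on, the power sum depends on [n] only through an
    affine function, whose slope is the limiting moment. *)
Lemma fubini_power_sum k : exists c, forall n, (k < n)%N ->
  power_sum (fubini_zeros R n) k = n.+1%:R * fubini_moment k - c.
Proof.
set N := k.+1; pose a : {poly R} := \poly_(i < N) fubini_moment i.
pose L := log_series R N.
have [C aL] : exists C, a * L = \poly_(i < N) (-1) ^+ i + 'X^N * C.
  apply: poly_congr => i iN; rewrite coef_poly iN mulrC coefM.
  rewrite -[RHS]fubini_moment_convolution; apply: eq_bigr => j _.
  rewrite !coef_poly (leq_ltn_trans _ iN) ?leq_ord// (leq_ltn_trans _ iN) ?leq_subr//.
have geom : (1 + 'X) * \poly_(i < N) (-1) ^+ i = 1 - (-1) ^+ N *: 'X^N :> {poly R}.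
  have -> : \poly_(i < N) (-1) ^+ i = \sum_(i < N) (- 'X) ^+ i :> {poly R}.
    by rewrite poly_def; apply: eq_bigr => i _; rewrite -[- 'X]scaleN1r exprZn.
  have := subrX1 (- 'X : {poly R}) N.
  move=> /(congr1 (fun p => - p)); rewrite -mulNr !opprB opprK => <-.
  by rewrite -[- 'X]scaleN1r exprZn.
(* [a] is the inverse of [(1 + X) L]: multiplying by it isolates the power sums. *)
exists (a * L)`_k => n kn.
have [E] := @log_series_power_sums R N isT n kn.
rewrite -/L; set P := \poly_(i < N) _ => HP.
have {}HP : P = n.+1%:R *: a - a * L + 'X^N * (a * E + ((-1) ^+ N)%:P * P - (1 + 'X) * C * P).
  have : a * ((1 + 'X) * L * P) = a * (n.+1%:R%:P - L + 'X^N * E) by rewrite HP.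
  rewrite [LHS](_ : _ = (1 + 'X) * (a * L) * P); last by ring.
  rewrite aL mulrDr geom -!mul_polyC => H.
  rewrite [LHS](_ : _ = (1 - ((-1) ^+ N)%:P * 'X^N + (1 + 'X) * ('X^N * C)) * P +
     'X^N * (((-1) ^+ N)%:P * P - (1 + 'X) * C * P)); last by ring.
  rewrite H -aL; ring.
have := congr1 (fun p : {poly R} => p`_k) HP.
rewrite coef_poly ltnSn => ->.
by rewrite !coefD coefZ coefN coefXnM ltnSn addr0 coef_poly ltnSn.
Qed.

Lemma fubini_moment_cvg k :
  n%:R^-1 * power_sum (fubini_zeros R n) k @[n --> \oo] --> fubini_moment k.
Proof.
have [c cE] := fubini_power_sum k.
have : fubini_moment k + n%:R^-1 * (fubini_moment k - c) @[n --> \oo] -->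
    fubini_moment k + 0 * (fubini_moment k - c).
  apply: cvgD; first exact: cvg_cst.
  apply: cvgM; last exact: cvg_cst.
  by rewrite -cvg_shiftS; exact: cvg_harmonic.
rewrite mul0r addr0; apply: cvg_trans; apply: near_eq_cvg; near=> n.
have kn : (k < n)%N by near: n; exact: nbhs_infty_gt.
rewrite cE// -natr1; field.
by rewrite pnatr_eq0 -lt0n (leq_trans _ kn).
Unshelve. all: by end_near. Qed.

End cauchy_numbers.

(** * Convergence of moments and of continuous averages *)

Section bernstein.
Variable R : realType.
Implicit Types h : nat -> R.

(** The Bernstein polynomial of the values [h 0, .., h n], built by conditioning
    on the first of [n] coin tosses; this makes its moments one-line inductions. *)
Fixpoint bernstein n h : {poly R} :=
  if n is m.+1 then
    (1 - 'X) * bernstein m h + 'X * bernstein m (fun k => h k.+1)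
  else (h 0%N)%:P.

Lemma bernstein_le n h h' x : 0 <= x <= 1 ->
  (forall k, (k <= n)%N -> h k <= h' k) -> (bernstein n h).[x] <= (bernstein n h').[x].
Proof.
move=> /andP[x0 x1]; elim: n h h' => [|n IH] h h' hh' /=.
  by rewrite !hornerC hh'.
rewrite !hornerE lerD// ler_wpM2l// ?subr_ge0// IH// => k kn.
  by rewrite hh'// (leq_trans kn).
by rewrite hh'.
Qed.

Lemma bernstein_affine n h h' (a b : R) x :
  (bernstein n (fun k => a * h k + b * h' k)).[x] =
  a * (bernstein n h).[x] + b * (bernstein n h').[x].
Proof.
elim: n h h' => [|n IH] h h' /=; first by rewrite !hornerC.
by rewrite !hornerE (IH h h') (IH (h \o S) (h' \o S)) /comp; ring.
Qed.

Lemma bernstein_cst n c x : (bernstein n (fun=> c)).[x] = c.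
Proof.
elim: n => [|n IH] /=; first by rewrite hornerC.
by rewrite !hornerE IH; ring.
Qed.

(** The second moment about [c] of the number of successes in [n] coin tosses. *)
Lemma bernstein_variance n c x :
  (bernstein n (fun k => (k%:R - c) ^+ 2)).[x] =
  n%:R * x * (1 - x) + (n%:R * x - c) ^+ 2.
Proof.
elim: n c => [|n IH] c /=; first by rewrite hornerC; ring.
rewrite !hornerE IH.
have -> : (fun k : nat => (k.+1%:R - c) ^+ 2) = (fun k : nat => (k%:R - (c - 1)) ^+ 2).
  by apply/funext => k; rewrite -natr1; ring.
by rewrite IH -natr1; ring.
Qed.

End bernstein.

Lemma cvg_sumr (R : realType) (I T : Type) (F : set_system T) {FF : Filter F}
    (r : seq I) (f : I -> T -> R) (a : I -> R) :
  (forall i, f i x @[x --> F] --> a i) ->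
  \sum_(i <- r) f i x @[x --> F] --> \sum_(i <- r) a i.
Proof.
move=> fa; elim: r => [|i r IH].
  rewrite big_nil; under eq_fun do rewrite big_nil.
  exact: cvg_cst.
rewrite big_cons; under eq_fun do rewrite big_cons.
by apply: cvgD.
Qed.

Section weierstrass.
Variable R : realType.

Lemma continuous_segment_uniform (f : R -> R) (a b e : R) :
  continuous f -> 0 < e ->
  exists2 d : R, 0 < d & forall x y : R, x \in `[a, b] -> `|x - y| < d -> `|f x - f y| < e.
Proof.
move=> cf e0; have /compact_near_coveringP := @segment_compact R a b.
move=> /(_ _ (0^'+) (fun d x => forall y, `|x - y| < d -> `|f x - f y| < e) _).
case.
  move=> x xab; have e2 : 0 < e / 2 by rewrite divr_gt0.
  move/cvgrPdist_lt : (cf x) => /(_ _ e2) /nbhs_ballP[r /= r0 xr].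
  have r2 : 0 < r / 2 by rewrite divr_gt0.
  exists (ball x (r / 2), [set d | d < r / 2]) => /=.
    split; first exact: nbhsx_ballx.
    exact: nbhs_right_lt.
  move=> [x' d] /= [xx' dr] y x'y.
  have fx' : `|f x - f x'| < e / 2.
    apply: xr => /=; rewrite /ball/= (lt_le_trans xx')// ler_pdivrMr// mulr_natr mulr2n.
    by rewrite lerDl ltW.
  have fy : `|f x - f y| < e / 2.
    apply: xr => /=; rewrite /ball/= (splitr r) -(subrKA x').
    by rewrite (le_lt_trans (ler_normD _ _))// ltrD// (lt_trans x'y).
  rewrite [e]splitr -(subrKA (f x)) (le_lt_trans (ler_normD _ _))// ltrD//.
  by rewrite distrC.
move=> d /= d0 H.
exists (d / 2); first by rewrite divr_gt0.
move=> x y xab; apply: (H (d / 2)) => //=; last by rewrite divr_gt0.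
rewrite sub0r normrN gtr0_norm ?divr_gt0// ltr_pdivrMr// mulr_natr mulr2n.
by rewrite ltrDl.
Qed.

(** Chebyshev's argument for Bernstein polynomials: away from [x] the oscillation
    of [f] is dominated by the normalised squared deviation, whose mean is the
    variance. *)
Lemma weierstrass01 (f : R -> R) (e : R) : continuous f -> 0 < e ->
  exists p : {poly R}, forall x : R, 0 <= x <= 1 -> `|f x - p.[x]| <= e.
Proof.
move=> cf e0.
have [d d0 fd] := continuous_segment_uniform 0 1 cf (divr_gt0 e0 (ltr0n _ 2)).
have [M [M0 fM]] : exists M : R, 0 < M /\ forall x : R, 0 <= x <= 1 -> `|f x| <= M.
  have [|c _ cM] := @EVT_max R (fun x => `|f x|) 0 1 ler01.
    by apply: continuous_subspaceT => x; apply: (cvg_norm (cf x)).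
  exists (`|f c| + 1); split; first by rewrite ltr_wpDl.
  by move=> x x01; rewrite (le_trans (cM _ _)) ?in_itv// lerDl.
have [n n0 nM] : exists2 n : nat, (0 < n)%N & 2 * M / (d ^+ 2 * n%:R) <= e / 2.
  exists (Num.truncn (4 * M / (e * d ^+ 2))).+1 => //.
  have : 4 * M / (e * d ^+ 2) < (Num.truncn (4 * M / (e * d ^+ 2))).+1%:R.
    exact: truncnS_gt.
  move: (Num.truncn _).+1%:R => n.
  rewrite ltr_pdivrMr ?mulr_gt0 ?exprn_gt0// => H.
  have n0 : 0 < n.
    rewrite -(pmulr_lgt0 _ (mulr_gt0 e0 (exprn_gt0 2 d0))).
    by rewrite (lt_trans _ H)// mulr_gt0.
  rewrite ler_pdivrMr ?mulr_gt0 ?exprn_gt0// -subr_ge0.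
  rewrite (_ : _ - _ = (n * (e * d ^+ 2) - 4 * M) / 2); last by field.
  by rewrite divr_ge0// subr_ge0 ltW.
exists (bernstein n (fun k => f (k%:R / n%:R))) => x x01.
have n0' : (0 : R) < n%:R by rewrite ltr0n.
(* Uniform continuity when [k / n] is close to [x], and otherwise the crude bound
[2 M], multiplied by a quotient that is at least [1]. *)
have key k : (k <= n)%N -> `|f x - f (k%:R / n%:R)| <=
    e / 2 * 1 + 2 * M / (d * n%:R) ^+ 2 * (k%:R - n%:R * x) ^+ 2.
  move=> kn; have [xk|xk] := ltP `|x - k%:R / n%:R| d.
    rewrite mulr1 (le_trans (ltW (fd _ _ _ xk)))//.
    by rewrite lerDl mulr_ge0 ?sqr_ge0// divr_ge0 ?sqr_ge0// mulr_ge0// ltW.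
  rewrite (@le_trans _ _ (2 * M))//.
    rewrite (_ : 2 * M = M + M); last by ring.
    rewrite (le_trans (ler_normB _ _))// lerD// fM//.
    by rewrite divr_ge0//= ler_pdivrMr// mul1r ler_nat.
  rewrite ler_wpDl ?mulr1 ?divr_ge0 ?(ltW e0)//.
  rewrite -mulrA ler_peMr ?mulr_ge0 ?(ltW M0)//.
  rewrite mulrC ler_pdivlMr ?exprn_gt0 ?mulr_gt0// mul1r.
  rewrite -[leRHS]real_normK ?num_real// ler_pXn2r ?nnegrE ?mulr_ge0 ?(ltW d0)//.
  rewrite (_ : k%:R - n%:R * x = (k%:R / n%:R - x) * n%:R); last first.
    by field; rewrite gt_eqF.
  by rewrite normrM (gtr0_norm n0') ler_pM2r// distrC.
have := @bernstein_affine R n (fun=> 1) (fun k => (k%:R - n%:R * x) ^+ 2)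
  (e / 2) (2 * M / (d * n%:R) ^+ 2) x.
rewrite bernstein_cst bernstein_variance subrr expr0n addr0 => bound.
have := @bernstein_affine R n (fun=> f x) (fun k => f (k%:R / n%:R)) 1 (-1) x.
rewrite bernstein_cst mul1r mulN1r => <-.
apply: (@le_trans _ _ (e / 2 * 1 + 2 * M / (d * n%:R) ^+ 2 * (n%:R * x * (1 - x)))).
  rewrite ler_norml -bound; apply/andP; split; last first.
    apply: bernstein_le => // k /key; rewrite mulN1r ler_norml => /andP[_].
    exact.
  set h := (X in bernstein n X).
  have -> : - (bernstein n h).[x] = (bernstein n (fun k => -1 * h k + 0 * 0)).[x].
    by rewrite (bernstein_affine n h (fun=> 0)); ring.
  apply: bernstein_le => // k /key; rewrite /h !mulN1r mul0r addr0 ler_norml.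
  by case/andP.
rewrite mulr1 [leRHS](splitr e) lerD2l (le_trans _ nM)//.
have /andP[x0 x1] := x01.
rewrite exprMn [n%:R ^+ 2]expr2 [X in X <= _](_ : _ =
  2 * M / (d ^+ 2 * n%:R) * (x * (1 - x))); last first.
  by field; rewrite !gt_eqF.
rewrite ler_piMr// ?divr_ge0 ?mulr_ge0 ?sqr_ge0 ?(ltW M0) ?(ltW d0)//.
by rewrite mulr_ile1// ?subr_ge0// lerBlDr lerDl.
Qed.

Lemma weierstrass (f : R -> R) (a b e : R) : a < b -> continuous f -> 0 < e ->
  exists p : {poly R}, forall x : R, x \in `[a, b] -> `|f x - p.[x]| <= e.
Proof.
move=> ab cf e0.
have [|p pf] := @weierstrass01 (fun x => f (a + (b - a) * x)) e _ e0.
  move=> x; apply: (@continuous_comp _ _ _ (fun x => a + (b - a) * x) f); last exact: cf.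
  by apply: cvgD; [exact: cvg_cst|apply: cvgM; [exact: cvg_cst|exact: cvg_id]].
exists (p \Po ((b - a)^-1%:P * ('X - a%:P))) => x; rewrite in_itv/= => /andP[ax xb].
have ba : 0 < b - a by rewrite subr_gt0.
rewrite horner_comp !hornerE; have := pf ((b - a)^-1 * (x - a)).
rewrite mulVKf ?gt_eqF// subrKC; apply.
rewrite mulr_ge0 ?invr_ge0 ?(ltW ba) ?subr_ge0//=.
by rewrite mulrC ler_pdivrMr// mul1r lerD2r.
Qed.

End weierstrass.

Section moments_convergence.
Variable R : realType.
Variable mu : {measure set (measurableTypeR R) -> \bar R}.
Hypothesis mu1 : mu `]-1, 0[%classic = 1%E.
Variable l : nat -> seq R.
Hypothesis size_l : forall n, size (l n) = n.
Hypothesis l_itv : forall n, {in l n, forall x : R, x \in `[-1, 0]}.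

Let I : set (measurableTypeR R) := `]-1, 0[%classic.

Let mI : measurable I. Proof. exact: measurable_itv. Qed.

Lemma continuous_integrable_itv (g : R -> R) : continuous g ->
  mu.-integrable I (EFin \o g).
Proof.
move=> cg; apply: measurable_bounded_integrable => //.
- by rewrite mu1 ltry.
- by apply: measurable_funTS; exact: measurable_realfun.continuous_measurable_fun.
have [|c _ cM] := @EVT_max R (fun x => `|g x|) (-1) 0 (lerN10 _).
  by apply: continuous_subspaceT => x; apply: (cvg_norm (cg x)).
exists `|g c|; split; first exact: num_real.
move=> M cM' x; rewrite /I/= in_itv/= => /andP[/ltW x0 /ltW x1].
by rewrite (le_trans (cM _ _)) ?in_itv/= ?x0// ltW.
Qed.

Let mean n (g : R -> R) := n%:R^-1 * \sum_(x <- l n) g x.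

(** Averages of polynomials converge because the moments do; Weierstrass
    approximation extends this to continuous functions. *)
Lemma continuous_mean_cvg (g : R -> R) (m : nat -> R) : continuous g ->
  (forall k, mean n (fun x => x ^+ k) @[n --> \oo] --> m k) ->
  (forall k, \int[mu]_(x in I) (x ^+ k) = m k) ->
  mean n g @[n --> \oo] --> \int[mu]_(x in I) g x.
Proof.
move=> cg m_cvg mE.
have poly_cvg (p : {poly R}) :
    mean n (horner p) @[n --> \oo] --> \int[mu]_(x in I) p.[x].
  have -> : \int[mu]_(x in I) p.[x] = \sum_(k < size p) p`_k * m k.
    under eq_Rintegral do rewrite horner_coef.
    have intX k c : mu.-integrable I (EFin \o (fun x : R => c * x ^+ k)).
      apply: continuous_integrable_itv => x.
      by apply: cvgM; [exact: cvg_cst|exact: exprn_continuous].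
    elim: (size p) => [|N IH].
      by under eq_Rintegral do rewrite big_ord0; rewrite Rintegral_cst// mul0r big_ord0.
    under eq_Rintegral do rewrite big_ord_recr/=.
    rewrite RintegralD//; last first.
      apply: continuous_integrable_itv => x.
      apply: (cvg_sumr (f := fun (i : 'I_N) (y : R) => p`_i * y ^+ i)) => i.
      by apply: cvgM; [exact: cvg_cst|exact: exprn_continuous].
    rewrite IH big_ord_recr/= RintegralZl ?mE//.
    by have := intX N 1; under eq_fun do rewrite mul1r.
  have -> : (fun n => mean n (horner p)) =
      (fun n => \sum_(k < size p) p`_k * mean n (fun x => x ^+ k)).
    apply/funext => n; rewrite /mean.
    under eq_bigr do rewrite horner_coef.
    rewrite exchange_big mulr_sumr; apply: eq_bigr => k _ /=.
    by rewrite -mulr_sumr mulrCA.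
  apply: (cvg_sumr (f := fun (k : 'I_(size p)) n => p`_k * mean n (fun x => x ^+ k))) => k.
  by apply: cvgM; [exact: cvg_cst|exact: m_cvg].
(* One third of [e] for each of: the integral, the convergence for [p], the mean. *)
apply/cvgrPdist_le => e e0; have e3 : 0 < e / 3 by rewrite divr_gt0.
have [p gp] := weierstrass (ltrN10 R) cg e3.
move/cvgrPdist_le : (poly_cvg p) => /(_ _ e3); apply: filterS => n np.
have cp := @continuous_horner R p.
have d1 : `|\int[mu]_(x in I) g x - \int[mu]_(x in I) p.[x]| <= e / 3.
  rewrite -RintegralB//; [|exact: continuous_integrable_itv..].
  have cgp : continuous (fun x => g x - p.[x]).
    by move=> x; apply: cvgB; [exact: cg|exact: cp].
  rewrite (le_trans (le_normr_Rintegral _ _))//.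
    exact: continuous_integrable_itv.
  rewrite (@le_trans _ _ (\int[mu]_(x in I) (e / 3)))//.
    apply: le_Rintegral => //.
    - by apply: continuous_integrable_itv => x; apply: cvg_norm; exact: cgp.
    - by apply: continuous_integrable_itv => x; exact: cvg_cst.
    - by move=> x /subset_itv_oo_cc xI; exact: gp.
  by rewrite Rintegral_cst// mu1 mulr1.
have d2 : `|mean n (horner p) - mean n g| <= e / 3.
  rewrite /mean -mulrBr -sumrB normrM ger0_norm ?invr_ge0//.
  have [->|n0] := eqVneq n 0%N; first by rewrite invr0 mul0r ltW.
  rewrite mulrC ler_pdivrMr ?ltr0n ?lt0n//.
  rewrite (le_trans (ler_norm_sum _ _ _))//.
  rewrite (@le_trans _ _ (\sum_(x <- l n) (e / 3)))//.
    by rewrite big_seq [leRHS]big_seq; apply: ler_sum => x /l_itv xI; rewrite distrC gp.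
  by rewrite big_const_seq count_predT iter_addr_0 size_l mulr_natr.
rewrite (_ : _ - _ = (\int[mu]_(x in I) g x - \int[mu]_(x in I) p.[x])
  + (\int[mu]_(x in I) p.[x] - mean n (horner p)) + (mean n (horner p) - mean n g)); last by ring.
rewrite (le_trans (ler_normD _ _))// (_ : e = e / 3 + e / 3 + e / 3); last by field.
by rewrite lerD// (le_trans (ler_normD _ _))// lerD.
Qed.

End moments_convergence.

(** * The fundamental theorem of calculus on an open interval *)

Lemma measurable_continuous_itv (R : realType) (a b : R) (g : R -> R) :
  {in `]a, b[, continuous g} -> measurable_fun `]a, b[ g.
Proof.
move=> cg; apply: measurable_realfun.open_continuous_measurable_fun => // x.
by rewrite inE; exact: cg.
Qed.

Section ftc_open_interval.
Variable R : realType.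
Local Notation leb := (@lebesgue_measure R).
Variables (f F : R -> R) (a b A B : R).
Hypothesis ab : a < b.
Hypothesis cf : {in `]a, b[, continuous f}.
Hypothesis dF : {in `]a, b[, forall x : R, is_derive x 1 F (f x)}.
Hypothesis Fa : F x @[x --> a^'+] --> A.
Hypothesis Fb : F x @[x --> b^'-] --> B.

Lemma FTC2_inside x y : a < x -> x < y -> y < b ->
  (\int[leb]_(t in `[x, y]) (f t)%:E = (F y - F x)%:E)%E.
Proof.
move=> ax xy yb.
have sub t : t \in `[x, y] -> t \in `]a, b[.
  rewrite !in_itv/= => /andP[xt ty].
  by rewrite (lt_le_trans ax)// (le_lt_trans ty).
have cF t : t \in `[x, y] -> {for t, continuous F}.
  by move=> /sub/dF dFt; exact/differentiable_continuous/derivable1_diffP.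
rewrite (@continuous_FTC2 _ f F x y xy) ?EFinB//.
- by apply: continuous_in_subspaceT => t /set_mem/sub; exact: cf.
- split.
  + by move=> t /subset_itv_oo_cc/sub/dF.
  + by apply: cvg_at_right_filter; apply: cF; rewrite in_itv/= lexx ltW.
  + by apply: cvg_at_left_filter; apply: cF; rewrite in_itv/= lexx ltW.
- by move=> t /subset_itv_oo_cc/sub/dF ?; rewrite derive1E derive_val.
Qed.

(** The primitive only needs limits at the endpoints, where the integrand may be
    unbounded; the parameterised integral of [f] is continuous up to the
    endpoints and differs from [F] by a constant. *)
Lemma FTC2_open : leb.-integrable `]a, b[ (EFin \o f) ->
  \int[leb]_(x in `]a, b[) f x = B - A.
Proof.
move=> intf.
have intf' : leb.-integrable `[a, b] (EFin \o f).
  move/integrableP : intf => [/measurable_EFinP mf intf].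
  have mf' : measurable_fun `[a, b] f.
    by apply/measurable_fun_itv_obnd_cbndP/measurable_fun_itv_bndo_bndcP.
  apply/integrableP; split; first exact/measurable_EFinP.
  have mnf i : measurable_fun [set` i] f -> measurable_fun [set` i] (fun x => `|(EFin \o f) x|%E).
    by move=> mfi; apply: measurableT_comp => //; exact/measurable_EFinP.
  rewrite -integral_itv_obnd_cbnd; last first.
    by apply: mnf; apply/measurable_fun_itv_bndo_bndcP.
  by rewrite -integral_itv_bndo_bndc//; exact: mnf.
pose P x := \int[leb]_(t in `[a, x]) f t.
have [c cab] : exists c : R, c \in `]a, b[.
  by exists ((a + b) / 2); rewrite in_itv/= !(midf_lt ab).
(* The reference point [c] avoids the endpoint [a], where the value of [F] need
not be its limit. *)
have PF x : x \in `]a, b[ -> P x = F x + (P c - F c).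
  have PB y z : y \in `]a, b[ -> z \in `]a, b[ -> y < z -> P z - P y = F z - F y.
    rewrite !in_itv/= => /andP[ay yb] /andP[az zb] yz.
    have sub : `[a, z] `<=` `[a, b] by apply: subset_itvl; rewrite bnd_simp ltW.
    have intz : leb.-integrable `[a, z] (EFin \o f) by exact: integrableS intf'.
    rewrite /P Rintegral_itvB ?bnd_simp ?ltW//.
    rewrite Rintegral_itv_obnd_cbnd.
      by rewrite /Rintegral (FTC2_inside ay yz zb).
    apply: integrableS intz => //; apply: subset_itvr; rewrite bnd_simp ltW//.
  move=> xab; have [xc|cx|->] := ltgtP x c; last by rewrite subrKC.
    by have := PB _ _ xab cab xc; lra.
  by have := PB _ _ cab xab cx; lra.
have Pb : P x @[x --> b^'-] --> P b.
  exact: parameterized_integral_cvg_at_left.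
have Pa : P x @[x --> a^'+] --> 0.
  by apply: cvg_at_right_filter; exact: (parameterized_integral_cvg_left ab).
have Pb' : P x @[x --> b^'-] --> B + (P c - F c).
  have : F x + (P c - F c) @[x --> b^'-] --> B + (P c - F c).
    by apply: cvgD => //; exact: cvg_cst.
  apply: cvg_trans; apply: near_eq_cvg; near=> x; apply/esym/PF.
  by rewrite in_itv/=; apply/andP; split; near: x; [exact: nbhs_left_gt|exact: nbhs_left_lt].
have Pa' : P x @[x --> a^'+] --> A + (P c - F c).
  have : F x + (P c - F c) @[x --> a^'+] --> A + (P c - F c).
    by apply: cvgD => //; exact: cvg_cst.
  apply: cvg_trans; apply: near_eq_cvg; near=> x; apply/esym/PF.
  by rewrite in_itv/=; apply/andP; split; near: x; [exact: nbhs_right_gt|exact: nbhs_right_lt].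
have PbE : P b = B + (P c - F c) by apply: cvg_unique Pb Pb'; exact: Rhausdorff.
have PaE : 0 = A + (P c - F c) by apply: cvg_unique Pa Pa'; exact: Rhausdorff.
have intf'' : leb.-integrable `[a, b[ (EFin \o f).
  by apply: integrableS intf' => //; apply: subset_itvl; rewrite bnd_simp.
rewrite Rintegral_itv_obnd_cbnd// Rintegral_itv_bndo_bndc//.
by rewrite -/(P b) PbE; lra.
Unshelve. all: by end_near. Qed.

(** For nonnegative [f] integrability is part of the conclusion. *)
Lemma ge0_FTC2_open : {in `]a, b[, forall x : R, 0 <= f x} ->
  (\int[leb]_(x in `]a, b[) (f x)%:E = (B - A)%:E)%E.
Proof.
move=> f0.
have [d d0 bE] : exists2 d : R, 0 < d & b = a + d + d.
  by exists ((b - a) / 2); [rewrite divr_gt0// subr_gt0|field].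
pose J n := `[a + d / n.+2%:R, b - d / n.+2%:R]%classic : set R.
have J0 n : 0 < d / n.+2%:R by rewrite divr_gt0.
have Jd n : d / n.+2%:R < d by rewrite ltr_pdivrMr// ltr_pMr// ltr1n.
have Jlt n : a + d / n.+2%:R < b - d / n.+2%:R.
  by rewrite bE; move: (Jd n) => {J J0 Jd}; move: (d / _) => y; lra.
have UJ : \bigcup_n J n = `]a, b[%classic.
  apply/seteqP; split => t /=.
    move=> [n _]; rewrite /J/= !in_itv/= => /andP[at' tb].
    by move: (J0 n) at' tb => {J J0 Jd Jlt}; move: (d / _) => y; lra.
  rewrite in_itv/= => /andP[at' tb].
  pose m := Num.min (t - a) (b - t).
  have m0 : 0 < m by rewrite lt_min !subr_gt0 at' tb.
  exists (Num.truncn (d / m)) => //; rewrite /J/= in_itv/=.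
  have : d / (Num.truncn (d / m)).+2%:R < m.
    rewrite ltr_pdivrMr// -ltr_pdivrMl// mulrC.
    by rewrite (lt_trans (truncnS_gt _))// ltr_nat.
  by rewrite /m lt_min => /andP[]; move: (d / _) => y; lra.
have dcvg : d / n.+2%:R @[n --> \oo] --> (0 : R).
  rewrite -[X in _ --> X](mulr0 d); apply: cvgM; first exact: cvg_cst.
  by rewrite (cvg_shiftS (@harmonic R)); exact: cvg_harmonic.
have H1 : (\int[leb]_(x in J n) (f x)%:E)%E @[n --> \oo] -->
    (\int[leb]_(x in \bigcup_n J n) (f x)%:E)%E.
  apply: ge0_nondecreasing_set_cvg_integral.
  - apply/nondecreasing_seqP => n; rewrite subsetEset; apply: subset_itvScc.
      by rewrite bnd_simp lerD2l ler_pM2l// lef_pV2 ?posrE// ler_nat.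
    by rewrite bnd_simp lerD2l lerN2 ler_pM2l// lef_pV2 ?posrE// ler_nat.
  - by move=> n; exact: measurable_itv.
  - move=> n; apply/measurable_EFinP; apply: measurable_funS (measurable_continuous_itv cf) => //.
    by rewrite -UJ; exact: bigcup_sup.
  - move=> n x Jx; rewrite lee_fin; apply: f0.
    by have : `]a, b[%classic x by rewrite -UJ; exists n.
rewrite -UJ; apply: (cvg_unique _ H1) => //.
have -> : (fun n => \int[leb]_(x in J n) (f x)%:E)%E =
    (fun n => (F (b - d / n.+2%:R) - F (a + d / n.+2%:R))%:E).
  by apply/funext => n; rewrite FTC2_inside// ?ltrDl// ltrBlDr ltrDl.
apply: cvg_EFin; first exact: nearW.
apply: cvgB.
  move/cvg_at_leftP : Fb; apply; split; first by move=> n; rewrite ltrBlDr ltrDl.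
  by rewrite -[X in _ --> X](subr0 b); apply: cvgB => //; exact: cvg_cst.
move/cvg_at_rightP : Fa; apply; split; first by move=> n; rewrite ltrDl.
by rewrite -[X in _ --> X](addr0 a); apply: cvgD => //; exact: cvg_cst.
Qed.

End ftc_open_interval.

(** * Beta weights *)

Section pointwise_derivatives.
Variable R : realType.
Implicit Types (f g : R -> R) (x a b c : R).

Lemma der_eq f x a b : is_derive x 1 f a -> a = b -> is_derive x 1 f b.
Proof. by move=> ? <-. Qed.

Lemma der_cst c x : is_derive x 1 (fun=> c) 0.
Proof. exact: is_derive_cst. Qed.

Lemma der_id x : is_derive x 1 (fun y : R => y) 1.
Proof. exact: is_derive_id. Qed.

Lemma derN f x a : is_derive x 1 f a -> is_derive x 1 (fun y => - f y) (- a).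
Proof. by move=> fa; exact: is_deriveN. Qed.

Lemma derD f g x a b : is_derive x 1 f a -> is_derive x 1 g b ->
  is_derive x 1 (fun y => f y + g y) (a + b).
Proof. by move=> fa gb; exact: is_deriveD. Qed.

Lemma derM f g x a b : is_derive x 1 f a -> is_derive x 1 g b ->
  is_derive x 1 (fun y => f y * g y) (a * g x + f x * b).
Proof.
move=> fa gb; have := is_deriveM fa gb.
by rewrite /GRing.scale/= addrC [g x * a]mulrC.
Qed.

Lemma der_comp f g x a b : is_derive (g x) 1 f a -> is_derive x 1 g b ->
  is_derive x 1 (fun y => f (g y)) (a * b).
Proof. by move=> fa gb; exact: is_derive1_comp. Qed.

Lemma derX f n x a : is_derive x 1 f a ->
  is_derive x 1 (fun y => f y ^+ n) (n%:R * f x ^+ n.-1 * a).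
Proof.
by move=> fa; have := is_deriveX n fa; rewrite exprfctE.
Qed.

Lemma derV f x a : f x != 0 -> is_derive x 1 f a ->
  is_derive x 1 (fun y => (f y)^-1) (- a / f x ^+ 2).
Proof.
move=> fx0 fa; have := is_deriveV fx0 fa.
by rewrite /GRing.scale/= mulNr mulrC -mulNr.
Qed.

Lemma der_expR f x a : is_derive x 1 f a ->
  is_derive x 1 (fun y => expR (f y)) (expR (f x) * a).
Proof. by move=> fa; apply: der_comp; exact: is_derive_expR. Qed.

Lemma der_ln f x a : 0 < f x -> is_derive x 1 f a ->
  is_derive x 1 (fun y => ln (f y)) ((f x)^-1 * a).
Proof. by move=> f0 fa; apply: der_comp; exact: is_derive1_ln. Qed.

Lemma der_sin f x a : is_derive x 1 f a ->
  is_derive x 1 (fun y => sin (f y)) (cos (f x) * a).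
Proof. by move=> fa; apply: der_comp; exact: is_derive_sin. Qed.

Lemma der_cos f x a : is_derive x 1 f a ->
  is_derive x 1 (fun y => cos (f y)) (- sin (f x) * a).
Proof. by move=> fa; apply: der_comp; exact: is_derive_cos. Qed.

Lemma der_atan f x a : is_derive x 1 f a ->
  is_derive x 1 (fun y => atan (f y)) ((1 + f x ^+ 2)^-1 * a).
Proof. by move=> fa; apply: der_comp; exact: is_derive1_atan. Qed.

Lemma der_continuous f x a : is_derive x 1 f a -> {for x, continuous f}.
Proof. by move=> ?; exact/differentiable_continuous/derivable1_diffP. Qed.

End pointwise_derivatives.

(** Syntax-directed differentiation; the conditions for [ln] and the inverse are
    left as the first goals. *)
Ltac der :=
  try lazymatch goal with
  | |- is_derive ?x ?v ?f ?a =>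
      let f' := eval cbv beta in (fun y => f y) in change (is_derive x v f' a)
  end;
  lazymatch goal with
  | |- is_derive _ _ (fun y => y) _ => eapply der_id
  | |- is_derive _ _ (fun=> ?c) _ => eapply der_cst
  | |- is_derive _ _ (fun y => expR _) _ => eapply der_expR; der
  | |- is_derive _ _ (fun y => ln _) _ => eapply der_ln; [|der]
  | |- is_derive _ _ (fun y => sin _) _ => eapply der_sin; der
  | |- is_derive _ _ (fun y => cos _) _ => eapply der_cos; der
  | |- is_derive _ _ (fun y => atan _) _ => eapply der_atan; der
  | |- is_derive _ _ (fun y => - _) _ => eapply derN; der
  | |- is_derive _ _ (fun y => _ + _) _ => eapply derD; der
  | |- is_derive _ _ (fun y => _ * _) _ => eapply derM; der
  | |- is_derive _ _ (fun y => _ ^+ _) _ => eapply derX; der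
  | |- is_derive _ _ (fun y => _^-1) _ => eapply derV; [|der]
  | |- _ => first [eassumption | idtac]
  end.

Section beta_weight.
Variable R : realType.
Local Notation leb := (@lebesgue_measure R).
Local Notation D := (`]-1, 0[%classic : set R).
Implicit Types (s x : R).

Lemma integrable_weightM (w g : R -> R) (C : R) :
  leb.-integrable D (EFin \o w) ->
  measurable_fun D g -> {in `]-1, 0[, forall x, `|g x| <= C} ->
  leb.-integrable D (EFin \o (fun x => w x * g x)).
Proof.
move=> int_w mg gC; have mw : measurable_fun D w.
  by case/integrableP : int_w => /measurable_EFinP.
have mD : measurable (D : set (measurableTypeR R)).
  exact: measurable_itv.
have C0 : 0 <= C.
  apply: le_trans (gC (- 2^-1) _) => //; rewrite in_itv/=; apply/andP; split; lra.
have iC : leb.-integrable D (EFin \o (fun x => C * w x)).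
  by have := @integrableZl _ _ _ leb _ mD C _ int_w; exact.
apply: le_integrable iC => //.
- by apply/measurable_EFinP/measurable_funM.
- move=> x xD; rewrite lee_fin !normrM mulrC.
  rewrite (ger0_norm C0) ler_wpM2r//; exact: gC.
Qed.

(** This is [(-x)^(s - 1) (1 + x)^(-s)]. In the exponential form, differentiation
    in [x] and in [s] is the chain rule. *)
Definition beta_weight s x := expR ((s - 1) * ln (- x) - s * ln (1 + x)).

(** The weight times [- x (1 + x)]: the factor that cancels the boundary terms in
    the integrations by parts. *)
Definition beta_prim s x := expR (s * ln (- x) + (1 - s) * ln (1 + x)).

Lemma beta_primE s x : x \in `]-1, 0[ ->
  beta_prim s x = beta_weight s x * (- x) * (1 + x).
Proof.
rewrite in_itv/= => /andP[x1 x0].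
have y0 : 0 < - x by rewrite oppr_gt0.
have y1 : 0 < 1 + x by lra.
rewrite /beta_weight -{2}(@lnK _ (- x)) ?posrE// -{2}(@lnK _ (1 + x)) ?posrE//.
by rewrite -!expRD; congr expR; ring.
Qed.

Lemma is_derive_beta_prim s x : x \in `]-1, 0[ ->
  is_derive x 1 (beta_prim s) (- (beta_weight s x * (s + x))).
Proof.
move=> xD; have := xD; rewrite in_itv/= => /andP[x1 x0].
have y0 : 0 < - x by rewrite oppr_gt0.
have y1 : 0 < 1 + x by lra.
eapply der_eq; first by rewrite /beta_prim; der.
rewrite /= -/(beta_prim s x) beta_primE//.
by field; lra.
Qed.

Lemma continuous_beta_weight s x : x \in `]-1, 0[ ->
  {for x, continuous (beta_weight s)}.
Proof.
rewrite in_itv/= => /andP[x1 x0].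
have y0 : 0 < - x by rewrite oppr_gt0.
have y1 : 0 < 1 + x by lra.
eapply der_continuous; rewrite /beta_weight; der => //.
Qed.

Lemma cvg_expR_ln0 (r : R) : 0 < r -> expR (r * ln y) @[y --> 0^'+] --> 0.
Proof.
move=> r0; have := powR_cvg0 r0; apply: cvg_trans; apply: near_eq_cvg.
near=> y; rewrite /powR gt_eqF//.
Unshelve. all: by end_near. Qed.

Lemma cvg_expR_ln_left (r : R) : 0 < r -> expR (r * ln (- x)) @[x --> 0^'-] --> 0.
Proof.
move=> /cvg_expR_ln0/cvg_at_rightP H; apply/cvg_at_leftP => u [u0 ucvg].
apply: (H (fun n => - u n)); split; first by move=> n; rewrite oppr_gt0.
by rewrite -oppr0; exact: cvgN.
Qed.

Lemma cvg_expR_ln_right (r : R) : 0 < r ->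
  expR (r * ln (1 + x)) @[x --> (-1)^'+] --> 0.
Proof.
move=> /cvg_expR_ln0/cvg_at_rightP H; apply/cvg_at_rightP => u [u0 ucvg].
apply: (H (fun n => 1 + u n)); split; first by move=> n; have := u0 n; lra.
by rewrite -(subrr 1); apply: cvgD => //; exact: cvg_cst.
Qed.

Lemma near_left_itv : \forall x \near (0 : R)^'-, x \in `]-1, 0[.
Proof.
near=> x; rewrite in_itv/=; apply/andP; split; last by near: x; exact: nbhs_left_lt.
by near: x; apply: nbhs_left_gt; exact: ltrN10.
Unshelve. all: by end_near. Qed.

Lemma near_right_itv : \forall x \near (-1 : R)^'+, x \in `]-1, 0[.
Proof.
near=> x; rewrite in_itv/=; apply/andP; split; first by near: x; exact: nbhs_right_gt.
by near: x; apply: nbhs_right_lt; exact: ltrN10.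
Unshelve. all: by end_near. Qed.

Lemma ln_itv x : x \in `]-1, 0[ -> (ln (- x) <= 0) && (ln (1 + x) <= 0).
Proof.
rewrite in_itv/= => /andP[xN1 x0].
by apply/andP; split; apply: ln_le0; lra.
Qed.

Lemma bounded_cvg0 (p g : R -> R) (C : R) (F : set_system R) {FF : Filter F} :
  (\forall x \near F, x \in `]-1, 0[) ->
  {in `]-1, 0[, forall x, `|g x| <= C} ->
  p x @[x --> F] --> 0 -> p x * g x @[x --> F] --> 0.
Proof.
move=> FD gC p0; apply/cvgr0Pnorm_le => e e0.
have C0 : 0 <= C.
  apply: le_trans (gC (- 2^-1) _) => //; rewrite in_itv/=; apply/andP; split; lra.
have e1 : 0 < e / (C + 1) by rewrite divr_gt0// ltr_wpDl.
move/cvgr0Pnorm_le : p0 => /(_ _ e1); apply: filterS2 FD => x xD px.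
rewrite normrM (le_trans (ler_pM _ _ px (gC _ xD)))//.
by rewrite -mulrA ler_piMr ?(ltW e0)// mulrC ler_pdivrMr; lra.
Qed.

Section parameter.
Variable s : R.
Hypothesis s0 : 0 < s.
Hypothesis s1 : s < 1.

Lemma beta_weight_gt0 x : 0 < beta_weight s x.
Proof. exact: expR_gt0. Qed.

Lemma cvg_beta_prim0 : beta_prim s x @[x --> 0^'-] --> 0.
Proof.
apply: (@squeeze_cvgr _ _ _ _ (cst 0) (fun x => expR (s * ln (- x)))).
- near=> x; rewrite expR_ge0/= ler_expR gerDl.
  have /ln_itv/andP[_ l1] : x \in `]-1, 0[ by near: x; exact: near_left_itv.
  by rewrite mulr_ge0_le0// subr_ge0 ltW.
- exact: cvg_cst.
- exact: cvg_expR_ln_left.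
Unshelve. all: by end_near. Qed.

Lemma cvg_beta_primN1 : beta_prim s x @[x --> (-1)^'+] --> 0.
Proof.
apply: (@squeeze_cvgr _ _ _ _ (cst 0) (fun x => expR ((1 - s) * ln (1 + x)))).
- near=> x; rewrite expR_ge0/= ler_expR gerDr.
  have /ln_itv/andP[l0 _] : x \in `]-1, 0[ by near: x; exact: near_right_itv.
  by rewrite mulr_ge0_le0// ltW.
- exact: cvg_cst.
- by apply: cvg_expR_ln_right; rewrite subr_gt0.
Unshelve. all: by end_near. Qed.

(** The weight is dominated by a sum of two pure powers, each singular at one
    endpoint only. *)
Lemma integrable_beta_weight : leb.-integrable D (EFin \o beta_weight s).
Proof.
pose f x := 2 * expR ((s - 1) * ln (- x)) + 2 * expR (- s * ln (1 + x)).
pose F x := - (2 / s) * expR (s * ln (- x)) + 2 / (1 - s) * expR ((1 - s) * ln (1 + x)).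
have s10 : 0 < 1 - s by rewrite subr_gt0.
have f0 x : 0 <= f x by rewrite addr_ge0 ?mulr_ge0 ?expR_ge0.
have cf : {in `]-1, 0[, continuous f}.
  move=> x; rewrite in_itv/= => /andP[xN1 x0].
  have y0 : 0 < - x by rewrite oppr_gt0.
  have y1 : 0 < 1 + x by lra.
  by eapply der_continuous; rewrite /f; der => //.
have intf : leb.-integrable D (EFin \o f).
  apply/integrableP; split.
    by apply/measurable_EFinP; exact: measurable_continuous_itv.
  under eq_integral do rewrite /= ger0_norm ?f0//.
  suff -> : (\int[leb]_(x in D) (f x)%:E =
      (- (2 / s) * 0 + 2 / (1 - s) * expR ((1 - s) * ln (1 + 0)) -
      (- (2 / s) * expR (s * ln (- -1)) + 2 / (1 - s) * 0))%:E)%E by rewrite ltry.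
  apply: (@ge0_FTC2_open _ f F); [exact: ltrN10|exact: cf| | | |by move=> x _; exact: f0].
  - move=> x; rewrite in_itv/= => /andP[xN1 x0].
    have y0 : 0 < - x by rewrite oppr_gt0.
    have y1 : 0 < 1 + x by lra.
    eapply der_eq; first by rewrite /F; der.
    have e0 : expR (s * ln (- x)) = expR ((s - 1) * ln (- x)) * (- x).
      by rewrite -{3}(@lnK _ (- x)) ?posrE// -expRD; congr expR; ring.
    have e1 : expR ((1 - s) * ln (1 + x)) = expR (- s * ln (1 + x)) * (1 + x).
      by rewrite -{3}(@lnK _ (1 + x)) ?posrE// -expRD; congr expR; ring.
    rewrite /f /= e0 e1; field.
    by rewrite !(gt_eqF y1, gt_eqF s10, lt_eqF x0, gt_eqF s0).
  - rewrite /F; apply: cvgD; apply: cvgM; [exact: cvg_cst| |exact: cvg_cst|].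
      apply: cvg_at_right_filter.
      have y : 0 < - (-1) :> R by rewrite opprK.
      suff : {for (-1 : R), continuous (fun x => expR (s * ln (- x)))} by [].
      by eapply der_continuous; der.
    by apply: cvg_expR_ln_right.
  - rewrite /F; apply: cvgD; apply: cvgM; [exact: cvg_cst| |exact: cvg_cst|].
      exact: cvg_expR_ln_left.
    apply: cvg_at_left_filter.
    have y : 0 < 1 + 0 :> R by rewrite addr0.
    suff : {for (0 : R), continuous (fun x => expR ((1 - s) * ln (1 + x)))} by [].
    by eapply der_continuous; der.
apply: le_integrable intf => //.
  apply/measurable_EFinP; apply: measurable_continuous_itv => x.
  exact: continuous_beta_weight.
move=> x xD; rewrite lee_fin !ger0_norm ?f0 ?(ltW (beta_weight_gt0 _))//.
have := xD; rewrite /= in_itv/= => /andP[xN1 x0].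
rewrite /beta_weight expRD -mulNr.
have hl : - ln 2 <= ln (2^-1 : R) by rewrite lnV ?posrE.
have e2 : expR (ln 2) = 2 :> R by rewrite lnK ?posrE.
have /andP[l0 l1] : (ln (- x) <= 0) && (ln (1 + x) <= 0) by apply: ln_itv; rewrite in_itv/= xN1.
(* On either half, the factor that is regular there is at most [2]. *)
have [xh|xh] := leP (- 2^-1) x.
  rewrite /f ler_wpDr ?mulr_ge0 ?expR_ge0// mulrC ler_wpM2r ?expR_ge0//.
  rewrite -[leRHS]e2 ler_expR.
  have : - ln 2 <= ln (1 + x).
    by apply: (le_trans hl); rewrite ler_ln ?posrE; lra.
  nra.
rewrite /f ler_wpDl ?mulr_ge0 ?expR_ge0// ler_wpM2r ?expR_ge0//.
rewrite -[leRHS]e2 ler_expR.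
have : - ln 2 <= ln (- x).
  by apply: (le_trans hl); rewrite ler_ln ?posrE; lra.
have : s * ln (- x) <= 0 by rewrite mulr_ge0_le0 // ltW.
by rewrite mulrBl mul1r; lra.
Qed.

(** The boundary terms vanish since [beta_prim] tends to [0] at both ends. *)
Lemma beta_weight_by_parts (g g' : R -> R) (C C' : R) :
  {in `]-1, 0[, forall x, is_derive x 1 g (g' x)} ->
  {in `]-1, 0[, continuous g'} ->
  {in `]-1, 0[, forall x, `|g x| <= C} -> {in `]-1, 0[, forall x, `|g' x| <= C'} ->
  \int[leb]_(x in D) (beta_weight s x * (- x * (1 + x) * g' x - (s + x) * g x)) = 0.
Proof.
move=> dg cg' gC g'C.
rewrite -[RHS](subrr (0 : R)).
have cg : {in `]-1, 0[, continuous g}.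
  by move=> x xD; exact: der_continuous (dg x xD).
apply: (@FTC2_open _ _ (fun x => beta_prim s x * g x)).
- exact: ltrN10.
- move=> x xD; have pxN : {for x, continuous (fun x : R => - x * (1 + x))}.
    by eapply der_continuous; der.
  apply: cvgM; first exact: continuous_beta_weight.
  apply: cvgB; apply: cvgM; [exact: pxN|exact: cg'| |exact: cg].
  by apply: cvgD; [exact: cvg_cst|exact: cvg_id].
- move=> x xD; have := is_derive_beta_prim s xD; have := dg x xD.
  move=> dgx dpx; eapply der_eq; first exact: derM dpx dgx.
  rewrite beta_primE//; ring.
- apply: bounded_cvg0 (near_right_itv) gC cvg_beta_primN1.
- apply: bounded_cvg0 (near_left_itv) gC cvg_beta_prim0.
- apply: (integrable_weightM (C := C' + 2 * C) integrable_beta_weight).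
    apply: measurable_continuous_itv => x xD.
    have pxN : {for x, continuous (fun x : R => - x * (1 + x))}.
      by eapply der_continuous; der.
    apply: cvgB; apply: cvgM; [exact: pxN|exact: cg'| |exact: cg].
    by apply: cvgD; [exact: cvg_cst|exact: cvg_id].
  move=> x xD; have := g'C x xD; have := gC x xD.
  move: xD; rewrite in_itv/= => /andP[xN1 x0] gx g'x.
  rewrite (le_trans (ler_normB _ _))// !normrM; apply: lerD.
    rewrite (le_trans _ g'x)// ler_piMl//.
    by rewrite mulr_ile1// ler_norml; lra.
  by apply: ler_pM => //; rewrite ler_norml; move: s0 s1 xN1 x0 => ? ? ? ?; lra.
Qed.

End parameter.

End beta_weight.

(** * Complex-valued functions of a real variable *)

Section complex_derivatives.
Variable R : realType.
Local Notation Re := (@complex.Re R).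
Local Notation Im := (@complex.Im R).
Local Notation nc := (@Normc.normc R).
Implicit Types (f g : R -> R[i]) (x : R) (a b : R[i]).

Lemma ReM a b : Re (a * b) = Re a * Re b - Im a * Im b.
Proof. by case: a b => ? ? [? ?]. Qed.

Lemma ImM a b : Im (a * b) = Re a * Im b + Im a * Re b.
Proof. by case: a b => ? ? [? ?]. Qed.

Lemma ReD a b : Re (a + b) = Re a + Re b.
Proof. by case: a b => ? ? []. Qed.

Lemma ImD a b : Im (a + b) = Im a + Im b.
Proof. by case: a b => ? ? []. Qed.

Lemma ReN a : Re (- a) = - Re a.
Proof. by case: a. Qed.

Lemma ImN a : Im (- a) = - Im a.
Proof. by case: a. Qed.

Lemma normc_sqr a : nc a ^+ 2 = Re a ^+ 2 + Im a ^+ 2.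
Proof. by case: a => u v /=; rewrite sqr_sqrtr// addr_ge0 ?sqr_ge0. Qed.

Lemma normc_ge0 a : 0 <= nc a.
Proof. by case: a => u v /=; exact: sqrtr_ge0. Qed.

Lemma normc_gt0 a : a != 0 -> 0 < nc a.
Proof.
move=> a0; rewrite lt_neqAle normc_ge0 andbT eq_sym.
by apply: contra a0 => /eqP/Normc.eq0_normc ->.
Qed.

Lemma normc_eq0 a : (nc a == 0) = (a == 0).
Proof.
have [->|/normc_gt0/gt_eqF//] := eqVneq a 0.
by rewrite Normc.normc0 eqxx.
Qed.

Lemma Re_le_normc a : `|Re a| <= nc a.
Proof.
rewrite -ler_sqr ?nnegrE ?normc_ge0// normc_sqr real_normK ?num_real//.
by rewrite lerDl sqr_ge0.
Qed.

Lemma Im_le_normc a : `|Im a| <= nc a.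
Proof.
rewrite -ler_sqr ?nnegrE ?normc_ge0// normc_sqr real_normK ?num_real//.
by rewrite lerDr sqr_ge0.
Qed.

Lemma normc_real x : nc x%:C = `|x|.
Proof. by rewrite /= expr0n/= addr0 sqrtr_sqr. Qed.

Lemma ReV a : Re a^-1 = Re a / nc a ^+ 2.
Proof. by rewrite normc_sqr; case: a => u v; rewrite complex_invE. Qed.

Lemma ImV a : Im a^-1 = - Im a / nc a ^+ 2.
Proof. by rewrite normc_sqr; case: a => u v; rewrite complex_invE. Qed.

(** Componentwise, so that only derivatives of real functions are involved. *)
Definition cderive f x a :=
  is_derive x 1 (fun y => Re (f y)) (Re a) /\
  is_derive x 1 (fun y => Im (f y)) (Im a).

Lemma cder_eq f x a b : cderive f x a -> a = b -> cderive f x b.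
Proof. by move=> ? <-. Qed.

Lemma cder_cst a x : cderive (fun=> a) x 0.
Proof. by split; exact: der_cst. Qed.

Lemma cder_id x : cderive (fun y => y%:C) x 1.
Proof. by split; [exact: der_id|exact: der_cst]. Qed.

Lemma cderD f g x a b : cderive f x a -> cderive g x b ->
  cderive (fun y => f y + g y) x (a + b).
Proof.
move=> [fr fi] [gr gi]; split.
  under eq_fun do rewrite ReD.
  by rewrite ReD; exact: derD.
under eq_fun do rewrite ImD.
by rewrite ImD; exact: derD.
Qed.

Lemma cderN f x a : cderive f x a -> cderive (fun y => - f y) x (- a).
Proof.
move=> [fr fi]; split.
  by under eq_fun do rewrite ReN; rewrite ReN; exact: derN.
by under eq_fun do rewrite ImN; rewrite ImN; exact: derN.
Qed.

Lemma cderM f g x a b : cderive f x a -> cderive g x b ->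
  cderive (fun y => f y * g y) x (a * g x + f x * b).
Proof.
move=> [fr fi] [gr gi]; split.
  under eq_fun do rewrite ReM.
  eapply der_eq; first exact: derD (derM fr gr) (derN (derM fi gi)).
  by rewrite /= ReD !ReM; ring.
under eq_fun do rewrite ImM.
eapply der_eq; first exact: derD (derM fr gi) (derM fi gr).
by rewrite /= ImD !ImM; ring.
Qed.

Lemma der_normc_sqr f x a : cderive f x a ->
  is_derive x 1 (fun y => nc (f y) ^+ 2) (2 * (Re (f x) * Re a + Im (f x) * Im a)).
Proof.
move=> [fr fi]; under eq_fun do rewrite normc_sqr.
by eapply der_eq; [exact: derD (derX 2 fr) (derX 2 fi)|rewrite /=; ring].
Qed.

Lemma cderV f x a : f x != 0 -> cderive f x a ->
  cderive (fun y => (f y)^-1) x (- a / f x ^+ 2).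
Proof.
move=> fx0 fa; have [fr fi] := fa; have nd := der_normc_sqr fa.
have n0 : nc (f x) ^+ 2 != 0 by rewrite expf_eq0/= normc_eq0.
split.
  under eq_fun do rewrite ReV.
  eapply der_eq; first exact: derM fr (derV (f := fun y => nc (f y) ^+ 2) n0 nd).
  rewrite ReM ReV ImV ReN ImN (expr2 (f x)) ReM ImM Normc.normcM exprMn.
  by move: n0; rewrite !normc_sqr => n0; field.
under eq_fun do rewrite ImV.
eapply der_eq; first exact: derM (derN fi) (derV (f := fun y => nc (f y) ^+ 2) n0 nd).
rewrite ImM ReV ImV ReN ImN (expr2 (f x)) ReM ImM Normc.normcM exprMn.
by move: n0; rewrite !normc_sqr => n0; field.
Qed.

(** Differentiating [ln |f|] by halving [ln |f|^2], which is smooth in the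
    components of [f]. *)
Lemma der_ln_normc f x a : f x != 0 -> cderive f x a ->
  is_derive x 1 (fun y => ln (nc (f y))) (Re (a / f x)).
Proof.
move=> fx0 fa; have nd := der_normc_sqr fa.
have n0 : 0 < nc (f x) ^+ 2 by rewrite exprn_gt0// normc_gt0.
have lnE y : ln (nc (f y)) = 2^-1 * ln (nc (f y) ^+ 2).
  have [->|fy0] := eqVneq (f y) 0.
    by rewrite Normc.normc0 expr0n/= ln0// mulr0.
  by rewrite lnXn ?normc_gt0// mulr2n; field.
under eq_fun do rewrite lnE.
eapply der_eq; first exact: derM (der_cst 2^-1 x) (der_ln (f := fun y => nc (f y) ^+ 2) n0 nd).
rewrite /= ReM ReV ImV; field.
by rewrite normc_eq0.
Qed.

Lemma der0_cst (h : R -> R) (u v x y : R) :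
  {in `]u, v[, forall z : R, is_derive z 1 h 0} ->
  x \in `]u, v[ -> y \in `]u, v[ -> h x = h y.
Proof.
move=> h0; wlog xy : x y / x < y.
  move=> H xI yI; have [xy|yx|->//] := ltgtP x y; first exact: H.
  by apply/esym/H.
move=> xI yI; have sub z : z \in `[x, y] -> z \in `]u, v[.
  move: xI yI; rewrite !in_itv/= => /andP[ux _] /andP[_ yv] /andP[xz zy].
  by rewrite (lt_le_trans ux)//= (le_lt_trans zy).
have [|z _] := @MVT R h (fun=> 0) x y xy (fun z zI => h0 z (sub z (subset_itv_oo_cc zI))).
  apply: continuous_in_subspaceT => z /set_mem/sub/h0.
  exact: der_continuous.
by rewrite mul0r => /eqP; rewrite subr_eq0 => /eqP ->.
Qed.

Lemma cderive0_cst f (u v x y : R) : {in `]u, v[, forall z, cderive f z 0} ->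
  x \in `]u, v[ -> y \in `]u, v[ -> f x = f y.
Proof.
move=> f0 xI yI.
have er := der0_cst (fun z zI => (f0 z zI).1) xI yI.
have ei := der0_cst (fun z zI => (f0 z zI).2) xI yI.
by move: er ei; case: (f x) (f y) => ? ? [? ?] /= -> ->.
Qed.

End complex_derivatives.

Section weighted_integrals.
Variable R : realType.
Local Notation leb := (@lebesgue_measure R).
Local Notation D := (`]-1, 0[%classic : set R).
Variable w : R -> R.
Hypothesis w_ge0 : forall x, 0 <= w x.
Hypothesis int_w : leb.-integrable D (EFin \o w).

Let mD : measurable (D : set (measurableTypeR R)).
Proof. exact: measurable_itv. Qed.

Lemma der_weighted_integral (f f' : R -> R -> R) (u v C C' : R) :
  (forall y, y \in `]u, v[ -> measurable_fun D (f y)) ->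
  (forall y x, y \in `]u, v[ -> x \in `]-1, 0[ -> `|f y x| <= C) ->
  (forall y x, y \in `]u, v[ -> x \in `]-1, 0[ -> is_derive y 1 (f ^~ x) (f' y x)) ->
  (forall y x, y \in `]u, v[ -> x \in `]-1, 0[ -> `|f' y x| <= C') ->
  forall y, y \in `]u, v[ ->
  is_derive y 1 (fun y => \int[leb]_(x in D) (w x * f y x))
    (\int[leb]_(x in D) (w x * f' y x)).
Proof.
move=> mf fC df f'C y yI.
have intf z : z \in `]u, v[ -> leb.-integrable D (EFin \o (fun x => w x * f z x)).
  by move=> zI; exact: integrable_weightM int_w (mf _ zI) (fC _ ^~ zI).
have C'0 : 0 <= C'.
  apply: le_trans (f'C y (- 2^-1) yI _) => //; rewrite in_itv/=; apply/andP; split; lra.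
have dwf z x : z \in `]u, v[ -> x \in `]-1, 0[ ->
    is_derive z 1 (fun z => w x * f z x) (w x * f' z x).
  move=> zI xI; eapply der_eq; first exact: derM (der_cst (w x) z) (df z x zI xI).
  by rewrite mul0r add0r.
have intC' : leb.-integrable D (EFin \o (fun x => w x * C')).
  by apply: (@integrable_weightM R w (fun=> C') C') => // x _; rewrite ger0_norm.
pose F z x := w x * f z x.
have d1E z x : z \in `]u, v[ -> x \in `]-1, 0[ -> partial1of2 F z x = w x * f' z x.
  by move=> zI xI; have ? := dwf z x zI xI; rewrite partial1of2E derive_val.
have derF z x : (`]u, v[%classic : set R) z -> D x -> derivable (F ^~ x) z 1.
  by move=> zI xI; have := dwf z x zI xI; case.
have F_ub z x : (`]u, v[%classic : set R) z -> D x -> `|partial1of2 F z x| <= w x * C'.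
  by move=> zI xI; rewrite d1E// normrM ger0_norm// ler_wpM2l// f'C.
have C'w x : 0 <= w x * C' by rewrite mulr_ge0.
have dF := derivable_under_integral mD yI intf derF C'w intC' F_ub.
have := differentiation_under_integral mD yI intf derF C'w intC' F_ub.
rewrite derive1E => dE; apply: DeriveDef => //.
by rewrite dE; apply: eq_Rintegral => x /set_mem xI; rewrite d1E.
Qed.

End weighted_integrals.

(** * The segment from 1 to exp L *)

Section complex_exponential.
Variable R : realType.
Local Notation Re := (@complex.Re R).
Local Notation Im := (@complex.Im R).
Local Notation nc := (@Normc.normc R).
Implicit Types (x y : R) (z w L : R[i]).

Definition cexp z : R[i] :=
  (expR (Re z) * cos (Im z)) +i* (expR (Re z) * sin (Im z)).

Lemma Re_cexp z : Re (cexp z) = expR (Re z) * cos (Im z). Proof. by []. Qed.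

Lemma Im_cexp z : Im (cexp z) = expR (Re z) * sin (Im z). Proof. by []. Qed.

Lemma cexp0 : cexp 0 = 1.
Proof. by rewrite /cexp/= expR0 cos0 sin0 mulr1 mulr0. Qed.

Lemma cexpD z w : cexp (z + w) = cexp z * cexp w.
Proof.
rewrite /cexp ReD ImD expRD cosD sinD.
by apply/eqP; rewrite eq_complex ReM ImM /=; apply/andP; split; apply/eqP; ring.
Qed.

Lemma normc_cexp z : nc (cexp z) = expR (Re z).
Proof.
rewrite /cexp /= !exprMn -mulrDr cos2Dsin2 mulr1 sqrtr_sqr ger0_norm// expR_ge0.
Qed.

Lemma cexp_neq0 z : cexp z != 0.
Proof. by rewrite -normc_eq0 normc_cexp gt_eqF// expR_gt0. Qed.

Lemma Re_realM x z : Re (x%:C * z) = x * Re z.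
Proof. by rewrite ReM /= mul0r subr0. Qed.

Lemma Im_realM x z : Im (x%:C * z) = x * Im z.
Proof. by rewrite ImM /= mul0r addr0. Qed.

Lemma cder_cexp L x : cderive (fun y => cexp (y%:C * L)) x (L * cexp (x%:C * L)).
Proof.
split.
  rewrite (_ : (fun y => _) = (fun y => expR (y * Re L) * cos (y * Im L))).
    eapply der_eq; first by der.
    by rewrite ReM /cexp /= Re_realM Im_realM; ring.
  by apply/funext => y; rewrite /cexp/= -Re_realM -Im_realM.
rewrite (_ : (fun y => _) = (fun y => expR (y * Re L) * sin (y * Im L))).
  eapply der_eq; first by der.
  by rewrite ImM /cexp /= Re_realM Im_realM; ring.
by apply/funext => y; rewrite /cexp/= -Re_realM -Im_realM.
Qed.

(** For [L = log (1 + 1/t)] this is [1 - x / t] with [1/t = cexp L - 1]. *)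
Definition segment_pt L x : R[i] := (1 + x)%:C - x%:C * cexp L.

(** The segment from [1] to [cexp L] stays away from [0], uniformly when the
    imaginary part of [L] is confined to a compact part of the strip. *)
Lemma segment_pt_lower (A B : R) L x : `|Re L| <= A -> `|Im L| <= B -> B < pi ->
  x \in `[-1, 0] -> (1 + cos B) / 2 * expR (- A) ^+ 2 <= nc (segment_pt L x) ^+ 2.
Proof.
move=> LA LB Bpi; rewrite normc_sqr /segment_pt ReD ImD ReN ImN Re_realM Im_realM in_itv.
move=> /andP[/= x1 x0].
set e := expR (Re L); set c := cos (Im L).
have B0 : 0 <= B by rewrite (le_trans _ LB).
have cB : cos B <= c.
  rewrite /c -(cos_norm (Im L)); move: LB; rewrite le_eqVlt => /predU1P[->//|LB].
  by rewrite ltW// ltr_cos// in_itv/= ?normr_ge0 ?B0 ltW// (lt_trans LB).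
have cN1 : -1 <= cos B by exact: cos_geN1.
have c1 : c <= 1 by exact: cos_le1.
have m1 : expR (- A) <= 1 by rewrite -[leRHS]expR0 ler_expR oppr_le0 (le_trans _ LA).
have me : expR (- A) <= e.
  by rewrite ler_expR; move: LA; rewrite ler_norml => /andP[].
have m0 : 0 < expR (- A) by exact: expR_gt0.
have sE : sin (Im L) ^+ 2 = 1 - c ^+ 2 by rewrite /c sin2cos2.
rewrite /= -/e -/c.
rewrite [X in _ <= X](_ : _ = (1 + x) ^+ 2 - 2 * x * (1 + x) * e * c +
    (x * e) ^+ 2 * (c ^+ 2 + sin (Im L) ^+ 2)); last by ring.
rewrite sE subrKC mulr1.
move: e c (expR (- A)) (cos B) cB c1 m1 me m0 cN1 {sE} => e c m k kc c1 m1 me m0 kN1.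
have z0 : 0 <= 1 + x by lra.
have y0 : 0 <= - x by lra.
have H : m <= (1 + x) + (- x) * e by nra.
have H2 : m ^+ 2 <= ((1 + x) + (- x) * e) ^+ 2.
  by rewrite ler_pXn2r ?nnegrE ?(ltW m0)// (le_trans (ltW m0)).
have H3 : (1 + c) / 2 * ((1 + x) + (- x) * e) ^+ 2 <=
    (1 + x) ^+ 2 - 2 * x * (1 + x) * e * c + (x * e) ^+ 2.
  rewrite -subr_ge0 (_ : _ - _ = (1 - c) / 2 * ((1 + x) - (- x) * e) ^+ 2); last by field.
  by rewrite mulr_ge0 ?sqr_ge0//; lra.
apply: le_trans H3; apply: ler_pM; rewrite ?sqr_ge0//; lra.
Qed.

Lemma cos_gtN1 x : 0 <= x < pi -> -1 < cos x.
Proof.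
move=> /andP[x0 xpi].
by rewrite -cospi ltr_cos// in_itv/= ?x0 ?pi_ge0 ?lexx ?(ltW xpi).
Qed.

Lemma segment_pt_neq0 L x : `|Im L| < pi -> x \in `[-1, 0] -> segment_pt L x != 0.
Proof.
move=> Lpi xI; rewrite -normc_eq0; apply/eqP => n0.
have := segment_pt_lower (lexx `|Re L|) (lexx `|Im L|) Lpi xI.
rewrite n0 expr0n/= leNgt mulr_gt0 ?exprn_gt0 ?expR_gt0//.
suff : -1 < cos `|Im L| by lra.
by apply: cos_gtN1; rewrite normr_ge0.
Qed.

Lemma segment_ptV_bounded (A B : R) : 0 <= B < pi -> exists2 C, 0 <= C &
  forall L x, `|Re L| <= A -> `|Im L| <= B -> x \in `[-1, 0] ->
  nc (segment_pt L x)^-1 <= C.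
Proof.
move=> /andP[B0 Bpi].
set d := (1 + cos B) / 2 * expR (- A) ^+ 2.
have d0 : 0 < d.
  rewrite mulr_gt0 ?exprn_gt0 ?expR_gt0//.
  suff : -1 < cos B by lra.
  by apply: cos_gtN1; rewrite B0.
exists (Num.sqrt d)^-1; first by rewrite invr_ge0 sqrtr_ge0.
move=> L x LA LB xI; have n0 : 0 < nc (segment_pt L x).
  by rewrite normc_gt0// segment_pt_neq0// (le_lt_trans LB).
have := segment_pt_lower LA LB Bpi xI; rewrite -/d Normc.normcV.
move: (nc _) n0 => r r0 dr; rewrite lef_pV2 ?posrE ?sqrtr_gt0//.
by rewrite -ler_sqr ?nnegrE ?sqrtr_ge0 ?(ltW r0)// sqr_sqrtr ?(ltW d0).
Qed.

Lemma cder_segment_pt_x L x : cderive (segment_pt L) x (1 - cexp L).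
Proof.
rewrite (_ : segment_pt L = (fun y => 1 + y%:C * (1 - cexp L))).
  eapply cder_eq; first exact: cderD (cder_cst 1 x) (cderM (cder_id x) (cder_cst _ x)).
  by rewrite mulr0 addr0 mul1r add0r.
by apply/funext => y; rewrite /segment_pt rmorphD rmorph1; ring.
Qed.

(** Derivative along the ray of [L], whereas [cder_segment_pt_x] is the one
    along the segment. *)
Lemma cder_segment_pt L x y : cderive (fun y => segment_pt (y%:C * L) x) y
  (- (x%:C * (L * cexp (y%:C * L)))).
Proof.
rewrite /segment_pt.
eapply cder_eq.
  exact: cderD (cder_cst _ y) (cderN (cderM (cder_cst x%:C y) (cder_cexp L y))).
by rewrite mul0r !add0r.
Qed.

End complex_exponential.

Arguments cexp : simpl never.
Arguments segment_pt : simpl never.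

(** * Cauchy transform of a beta weight *)

Section complex_integrals.
Variable R : realType.
Local Notation leb := (@lebesgue_measure R).
Local Notation D := (`]-1, 0[%classic : set R).
Local Notation Re := (@complex.Re R).
Local Notation Im := (@complex.Im R).
Local Notation nc := (@Normc.normc R).
Implicit Types (f g : R -> R[i]) (w : R -> R).

(** The hypothesis under which an integrable weight may be multiplied by [f]. *)
Definition cbounded f := [/\ measurable_fun D (Re \o f), measurable_fun D (Im \o f)
  & exists C : R, {in `]-1, 0[, forall x : R, nc (f x) <= C}].

Lemma cder_cbounded f f' C : {in `]-1, 0[, forall x : R, cderive f x (f' x)} ->
  {in `]-1, 0[, forall x : R, nc (f x) <= C} -> cbounded f.
Proof.
move=> df fC; split; last by exists C.
  by apply: measurable_continuous_itv => x /df[fr _]; exact: der_continuous fr.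
by apply: measurable_continuous_itv => x /df[_ fi]; exact: der_continuous fi.
Qed.

Definition weighted_integral w f : R[i] :=
  (\int[leb]_(x in D) (w x * Re (f x))) +i* (\int[leb]_(x in D) (w x * Im (f x))).

Lemma eq_weighted_integral w f g : {in `]-1, 0[, f =1 g} ->
  weighted_integral w f = weighted_integral w g.
Proof.
by move=> fg; congr (_ +i* _); apply: eq_Rintegral => x /set_mem xD; rewrite fg.
Qed.

Lemma weighted_integral_lin w a b f g : leb.-integrable D (EFin \o w) -> cbounded f -> cbounded g ->
  weighted_integral w (fun x => a * f x + b * g x) =
  a * weighted_integral w f + b * weighted_integral w g.
Proof.
move=> iw [mfr mfi [C fC]] [mgr mgi [C' gC]].
have iM (h : R -> R) (c : R) : measurable_fun D h -> {in `]-1, 0[, forall x, `|h x| <= c} ->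
    leb.-integrable D (EFin \o (fun x => w x * h x)).
  by move=> mh hc; have := integrable_weightM iw mh hc; exact.
have ifr : leb.-integrable D (EFin \o (fun x => w x * Re (f x))).
  by apply: (iM _ C) => // x /fC; apply: le_trans (Re_le_normc _).
have ifi : leb.-integrable D (EFin \o (fun x => w x * Im (f x))).
  by apply: (iM _ C) => // x /fC; apply: le_trans (Im_le_normc _).
have igr : leb.-integrable D (EFin \o (fun x => w x * Re (g x))).
  by apply: (iM _ C') => // x /gC; apply: le_trans (Re_le_normc _).
have igi : leb.-integrable D (EFin \o (fun x => w x * Im (g x))).
  by apply: (iM _ C') => // x /gC; apply: le_trans (Im_le_normc _).
have mD : measurable (D : set (measurableTypeR R)) by exact: measurable_itv.
have lin (p q r t : R) : \int[leb]_(x in D) (p * (w x * Re (f x)) + q * (w x * Im (f x))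
      + (r * (w x * Re (g x)) + t * (w x * Im (g x)))) =
    p * Re (weighted_integral w f) + q * Im (weighted_integral w f) +
    (r * Re (weighted_integral w g) + t * Im (weighted_integral w g)).
  have iZ (c : R) (h : R -> R) : leb.-integrable D (EFin \o h) ->
    leb.-integrable D (EFin \o (fun x : R => c * h x)).
    by move=> ih; have := @integrableZl _ _ _ leb _ mD c _ ih; exact.
  have iD (h k : R -> R) : leb.-integrable D (EFin \o h) -> leb.-integrable D (EFin \o k) ->
    leb.-integrable D (EFin \o (fun x : R => h x + k x)).
    by move=> ih ik; have := @integrableD _ _ _ leb _ mD _ _ ih ik; exact.
  rewrite RintegralD//; [|by apply: iD; apply: iZ..].
  by rewrite !RintegralD ?RintegralZl//; apply: iZ.
rewrite [LHS]/weighted_integral.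
apply/eqP; rewrite eq_complex ReD ImD !ReM !ImM /=; apply/andP; split; apply/eqP.
  transitivity (Re a * Re (weighted_integral w f) + - Im a * Im (weighted_integral w f)
    + (Re b * Re (weighted_integral w g) + - Im b * Im (weighted_integral w g))).
    by rewrite -lin; apply: eq_Rintegral => x _; rewrite ReD !ReM; ring.
  by rewrite /=; ring.
transitivity (Im a * Re (weighted_integral w f) + Re a * Im (weighted_integral w f)
  + (Im b * Re (weighted_integral w g) + Re b * Im (weighted_integral w g))).
  by rewrite -lin; apply: eq_Rintegral => x _; rewrite ImD !ImM; ring.
by rewrite /=; ring.
Qed.

Lemma cder_weighted_integral w (f f' : R -> R -> R[i]) (u v C C' : R) :
  (forall x, 0 <= w x) -> leb.-integrable D (EFin \o w) ->
  (forall y, y \in `]u, v[ -> cbounded (f y)) ->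
  (forall y x, y \in `]u, v[ -> x \in `]-1, 0[ -> nc (f y x) <= C) ->
  (forall y x, y \in `]u, v[ -> x \in `]-1, 0[ -> cderive (f ^~ x) y (f' y x)) ->
  (forall y x, y \in `]u, v[ -> x \in `]-1, 0[ -> nc (f' y x) <= C') ->
  forall y, y \in `]u, v[ ->
  cderive (fun y => weighted_integral w (f y)) y (weighted_integral w (f' y)).
Proof.
move=> w0 iw bf fC df f'C y yI; split => /=.
  apply: (@der_weighted_integral _ w w0 iw (fun y x => Re (f y x)) (fun y x => Re (f' y x)) u v C C') => //.
  - by move=> z /bf[].
  - by move=> z x zI xI; rewrite (le_trans (Re_le_normc _))// fC.
  - by move=> z x zI xI; have [] := df z x zI xI.
  - by move=> z x zI xI; rewrite (le_trans (Re_le_normc _))// f'C.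
apply: (@der_weighted_integral _ w w0 iw (fun y x => Im (f y x)) (fun y x => Im (f' y x)) u v C C') => //.
- by move=> z /bf[].
- by move=> z x zI xI; rewrite (le_trans (Im_le_normc _))// fC.
- by move=> z x zI xI; have [] := df z x zI xI.
- by move=> z x zI xI; rewrite (le_trans (Im_le_normc _))// f'C.
Qed.

End complex_integrals.

(** Room for differentiating along the ray of [L] on an open interval around
    [[0, 1]] without leaving the strip. *)
Lemma dilation_lt_pi (R : realType) (b : R) : `|b| < pi ->
  exists2 T : R, 1 < T & T * `|b| < pi.
Proof.
move=> bpi; exists (1 + (pi - `|b|) / (2 * pi)).
  by rewrite ltrDl divr_gt0 ?subr_gt0// mulr_gt0 ?pi_gt0.
have p0 : (0 : R) < pi by exact: pi_gt0.
rewrite -subr_gt0 (_ : _ - _ = (pi - `|b|) * (2 * pi - `|b|) / (2 * pi)).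
  by rewrite divr_gt0 ?mulr_gt0 ?subr_gt0//; lra.
move: `|b| (pi : R) p0 {bpi} => y p p0; field.
by rewrite gt_eqF.
Qed.

Section beta_cauchy_transform.
Variable R : realType.
Local Notation leb := (@lebesgue_measure R).
Local Notation D := (`]-1, 0[%classic : set R).
Local Notation Re := (@complex.Re R).
Local Notation Im := (@complex.Im R).
Local Notation nc := (@Normc.normc R).
Variable s : R.
Hypothesis s0 : 0 < s.
Hypothesis s1 : s < 1.
Local Notation W := (weighted_integral (beta_weight s)).

Let normc_opp (a : R[i]) : nc (- a) = nc a.
Proof. by case: a => u v /=; rewrite !sqrrN. Qed.

(** Integration by parts against [1 / segment_pt L x]. *)
Lemma beta_cauchy_by_parts (L : R[i]) : `|Im L| < pi ->
  W (fun x => x%:C * cexp L * (segment_pt L x)^-1 ^+ 2) =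
  - s%:C * W (fun x => (segment_pt L x)^-1).
Proof.
move=> Lpi.
have [C C0 VC] : exists2 C, 0 <= C & forall x, x \in `]-1, 0[ -> nc (segment_pt L x)^-1 <= C.
  have [|C C0 VC] := @segment_ptV_bounded R `|Re L| `|Im L|; first by rewrite normr_ge0.
  by exists C => // x xD; apply: VC => //; exact: subset_itv_oo_cc.
have n0 x : x \in `]-1, 0[ -> segment_pt L x != 0.
  by move=> xD; apply: segment_pt_neq0 => //; exact: subset_itv_oo_cc.
pose V x := (segment_pt L x)^-1; rewrite -/(V _).
pose V' x := (cexp L - 1) * (V x * V x).
pose K x := x%:C * cexp L * (V x * V x).
have dV x : x \in `]-1, 0[ -> cderive V x (V' x).
  move=> xD; eapply cder_eq; first exact: cderV (n0 _ xD) (cder_segment_pt_x L x).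
  by rewrite opprB /V' /V -expr2 exprVn.
have dVV x : x \in `]-1, 0[ -> cderive (fun x => V x * V x) x (V' x * V x + V x * V' x).
  by move=> xD; exact: cderM (dV x xD) (dV x xD).
have VVC x : x \in `]-1, 0[ -> nc (V x * V x) <= C * C.
  by move=> xD; rewrite Normc.normcM ler_pM ?normc_ge0 ?VC.
have bV : cbounded V by apply: cder_cbounded dV VC.
have bK : cbounded K.
  apply: (@cder_cbounded _ _ _ (nc (cexp L) * (C * C))).
    move=> x xD; rewrite /K.
    exact: cderM (cderM (cder_id x) (cder_cst (cexp L) x)) (dVV x xD).
  move=> x xD; rewrite /K !Normc.normcM -[leRHS]mul1r -!mulrA.
  apply: ler_pM; rewrite ?normc_ge0 ?mulr_ge0 ?normc_ge0//.
    by rewrite normc_real; move: xD; rewrite in_itv/= ler_norml; lra.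
  by rewrite ler_wpM2l ?normc_ge0// -Normc.normcM VVC.
have iw := integrable_beta_weight s0 s1.
have w0 x : 0 <= beta_weight s x by exact/ltW/beta_weight_gt0.
have key x : x \in `]-1, 0[ ->
    (- x * (1 + x))%:C * - V' x - (s + x)%:C * - V x = 1 * K x + s%:C * V x.
  move=> /n0 nz; rewrite /V' /K /V; move: nz; rewrite /segment_pt.
  rewrite !(rmorphD, rmorphM, rmorphN, rmorph1)/= => nz.
  by field.
have H : W (fun x => 1 * K x + s%:C * V x) = 0.
  have dNV x : x \in `]-1, 0[ -> cderive (fun x => - V x) x (- V' x).
    by move=> xD; exact: cderN (dV x xD).
  have dNV' x : x \in `]-1, 0[ -> cderive (fun x => - V' x) x
      (- (0 * (V x * V x) + (cexp L - 1) * (V' x * V x + V x * V' x))).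
    by move=> xD; exact: cderN (cderM (cder_cst (cexp L - 1) x) (dVV x xD)).
  have NVC x : x \in `]-1, 0[ -> nc (- V x) <= C by move=> xD; rewrite normc_opp VC.
  have NVC' x : x \in `]-1, 0[ -> nc (- V' x) <= nc (cexp L - 1) * (C * C).
    by move=> xD; rewrite normc_opp Normc.normcM ler_wpM2l ?normc_ge0// VVC.
  have Hr : \int[leb]_(x in D) (beta_weight s x * Re (1 * K x + s%:C * V x)) = 0.
    rewrite -[RHS](@beta_weight_by_parts _ s s0 s1 (fun x => Re (- V x)) (fun x => Re (- V' x))
      C (nc (cexp L - 1) * (C * C))).
    - apply: eq_Rintegral => x /set_mem xD; rewrite -key//; congr (_ * _).
      by rewrite ReD (ReN (_ * _)) !Re_realM.
    - by move=> x /dNV[].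
    - by move=> x /dNV'[H _]; exact: der_continuous H.
    - by move=> x /NVC; apply: le_trans (Re_le_normc _).
    - by move=> x /NVC'; apply: le_trans (Re_le_normc _).
  have Hi : \int[leb]_(x in D) (beta_weight s x * Im (1 * K x + s%:C * V x)) = 0.
    rewrite -[RHS](@beta_weight_by_parts _ s s0 s1 (fun x => Im (- V x)) (fun x => Im (- V' x))
      C (nc (cexp L - 1) * (C * C))).
    - apply: eq_Rintegral => x /set_mem xD; rewrite -key//; congr (_ * _).
      by rewrite ImD (ImN (_ * _)) !Im_realM.
    - by move=> x /dNV[].
    - by move=> x /dNV'[_ H]; exact: der_continuous H.
    - by move=> x /NVC; apply: le_trans (Im_le_normc _).
    - by move=> x /NVC'; apply: le_trans (Im_le_normc _).
  by rewrite /weighted_integral Hr Hi.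
rewrite (weighted_integral_lin 1 s%:C iw bK bV) mul1r in H.
move/eqP: H; rewrite addr_eq0 -mulNr => /eqP <-.
by apply: eq_weighted_integral => x _; rewrite /K expr2.
Qed.

(** Along the ray [y L], the integral [N y] satisfies [N' = - s L N] by
    [beta_cauchy_by_parts], and at [y = 0] it is the mass. *)
Lemma beta_cauchy (L : R[i]) : `|Im L| < pi ->
  W (fun x => (segment_pt L x)^-1) * cexp (s%:C * L) = W (fun=> 1).
Proof.
move=> Lpi.
have [T T1 TL] := dilation_lt_pi Lpi.
have T0 : 0 < T by rewrite (lt_trans _ T1).
have yT y : y \in `]-T, T[ -> `|y| <= T by rewrite in_itv/= ler_norml => /andP[/ltW -> /ltW].
have [|C C0 VC] := @segment_ptV_bounded R (T * `|Re L|) (T * `|Im L|).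
  by rewrite mulr_ge0 ?(ltW T0).
pose V (y x : R) := (segment_pt (y%:C * L) x)^-1.
have {}VC y x : y \in `]-T, T[ -> x \in `]-1, 0[ -> nc (V y x) <= C.
  move=> /yT yI xD; apply: VC; last exact: subset_itv_oo_cc.
    by rewrite Re_realM normrM ler_wpM2r.
  by rewrite Im_realM normrM ler_wpM2r.
have yL y : y \in `]-T, T[ -> `|Im (y%:C * L)| < pi.
  by move=> /yT yI; rewrite Im_realM normrM (le_lt_trans _ TL)// ler_wpM2r.
have n0 y x : y \in `]-T, T[ -> x \in `]-1, 0[ -> segment_pt (y%:C * L) x != 0.
  by move=> /yL yI xD; apply: segment_pt_neq0 => //; exact: subset_itv_oo_cc.
pose K y x := x%:C * cexp (y%:C * L) * V y x ^+ 2.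
have bV y : y \in `]-T, T[ -> cbounded (V y).
  move=> yI; apply: (cder_cbounded _ (VC y ^~ yI)) => x xD.
  exact: cderV (n0 y x yI xD) (cder_segment_pt_x (y%:C * L) x).
have KC y x : y \in `]-T, T[ -> x \in `]-1, 0[ ->
    nc (K y x) <= expR (T * `|Re L|) * (C * C).
  move=> yI xD; rewrite /K expr2 !Normc.normcM normc_cexp -[leRHS]mul1r -!mulrA.
  apply: ler_pM; rewrite ?normc_ge0 ?mulr_ge0 ?normc_ge0 ?expR_ge0//.
    by rewrite normc_real; move: xD; rewrite in_itv/= ler_norml; lra.
  apply: ler_pM; rewrite ?mulr_ge0 ?normc_ge0 ?expR_ge0//.
    rewrite ler_expR Re_realM (le_trans (ler_norm _))// normrM ler_wpM2r// yT//.
  by rewrite ler_pM ?normc_ge0 ?VC.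
have bK y : y \in `]-T, T[ -> cbounded (K y).
  move=> yI; apply: (@cder_cbounded _ _ _ _ _ (KC y ^~ yI)).
    move=> x xD; rewrite /K.
    have dV := cderV (n0 y x yI xD) (cder_segment_pt_x (y%:C * L) x).
    exact: cderM (cderM (cder_id x) (cder_cst (cexp _) x)) (cderM dV dV).
pose N y := W (V y).
have dN y : y \in `]-T, T[ -> cderive N y (- (s%:C * L) * N y).
  move=> yI; have iw := integrable_beta_weight s0 s1.
  have w0 x : 0 <= beta_weight s x by exact/ltW/beta_weight_gt0.
  have LK z x : z \in `]-T, T[ -> x \in `]-1, 0[ ->
      nc (L * K z x + 0 * K z x) <= nc L * (expR (T * `|Re L|) * (C * C)).
    by move=> zI xD; rewrite mul0r addr0 Normc.normcM ler_wpM2l ?normc_ge0// KC.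
  have dV z x : z \in `]-T, T[ -> x \in `]-1, 0[ ->
      cderive (V ^~ x) z (L * K z x + 0 * K z x).
    move=> zI xD; eapply cder_eq.
      exact: (cderV (f := fun y => segment_pt (y%:C * L) x) (n0 z x zI xD) (cder_segment_pt L x z)).
    by rewrite opprK /K /V exprVn; ring.
  eapply cder_eq; first exact: (cder_weighted_integral w0 iw bV VC dV LK yI).
  rewrite (weighted_integral_lin L 0 iw (bK y yI) (bK y yI)) mul0r addr0.
  rewrite [W _](beta_cauchy_by_parts (yL y yI)) /N -/(V y); ring.
(* The integrating factor of the linear equation. *)
pose M y := N y * cexp (y%:C * (s%:C * L)).
have dM : {in `]-T, T[, forall y, cderive M y 0}.
  move=> y yI; eapply cder_eq; first exact: cderM (dN y yI) (cder_cexp (s%:C * L) y).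
  by cbv beta; ring.
have := cderive0_cst dM (x := 1) (y := 0).
rewrite !in_itv/= T1 oppr_lt0 T0 (lt_trans _ ltr01) ?oppr_lt0// => /(_ isT isT).
rewrite /M !mul1r mul0r cexp0 mulr1 /N /V => H.
transitivity (W (fun x => (segment_pt (0%:C * L) x)^-1)).
  by rewrite -H; congr (_ * _); apply: eq_weighted_integral => x _; rewrite mul1r.
apply: eq_weighted_integral => x _.
rewrite mul0r /segment_pt cexp0 mulr1 rmorphD rmorph1 addrK invr1//.
Qed.

End beta_cauchy_transform.

(** * Moments and mass of a beta weight *)

Section atan_kernel.
Variable R : realType.
Local Notation Re := (@complex.Re R).
Implicit Types T x : R.

(** The integral of the real part of [1 / segment_pt L x], where [L] is [i] times an
    angle running from [0] to [2 atan T]: multiplied by [1 + x], it is that angle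
    minus the argument of the point of the segment. The parameter [T], the tangent
    of the half-angle, sends the singular angle [pi] to infinity. *)
Definition atan_kernel T x : R := (atan T + atan ((1 + 2 * x) * T)) / (1 + x).

(** The derivative of [atan_kernel] in closed form, for which a bound is visible. *)
Definition atan_kernel_der T x : R :=
  2 * (1 + (1 + 2 * x) * T ^+ 2) / ((1 + T ^+ 2) * (1 + (1 + 2 * x) ^+ 2 * T ^+ 2)).

Let den1 T : 0 < 1 + T ^+ 2.
Proof. by rewrite ltr_wpDr// sqr_ge0. Qed.

Let den2 T x : 0 < 1 + (1 + 2 * x) ^+ 2 * T ^+ 2.
Proof. by rewrite ltr_wpDr// mulr_ge0 ?sqr_ge0. Qed.

Lemma der_atan_kernel x T : x \in `]-1, 0[ ->
  is_derive T 1 (atan_kernel ^~ x) (atan_kernel_der T x).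
Proof.
rewrite in_itv/= => /andP[x1 x0].
eapply der_eq; first by rewrite /atan_kernel; der.
rewrite /atan_kernel_der exprMn; have := den2 T x; have := den1 T => d1 d2; field.
by rewrite !gt_eqF//; lra.
Qed.

Lemma atan_kernel_derE T x : atan_kernel_der T x =
  2 / (1 + T ^+ 2) * Re (segment_pt (0 +i* (2 * atan T)) x)^-1.
Proof.
have cT : cos (atan T) ^+ 2 = (1 + T ^+ 2)^-1.
  by rewrite cos_atan exprVn sqr_sqrtr// ltW.
have cn0 : cos (atan T) != 0.
  by apply/eqP => c0; move: cT; rewrite c0 expr0n/= => /esym/eqP; rewrite invr_eq0 gt_eqF.
have c2 : cos (2 * atan T) = (1 - T ^+ 2) / (1 + T ^+ 2).
  rewrite mulrDl mul1r cosD -!expr2 sin2cos2 cT; field.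
  by rewrite gt_eqF.
have s2 : sin (2 * atan T) = 2 * T / (1 + T ^+ 2).
  have sE : sin (atan T) = T * cos (atan T).
    by rewrite -[X in X * cos _]atanK /tan mulfVK.
  rewrite mulrDl mul1r sinD sE -cT; ring.
rewrite ReV normc_sqr /segment_pt ReD ImD ReN ImN Re_realM Im_realM /cexp/= c2 s2 expR0.
rewrite [X in _ * (_ / X)](_ : _ = (1 + (1 + 2 * x) ^+ 2 * T ^+ 2) / (1 + T ^+ 2)); last first.
  by field; rewrite gt_eqF.
rewrite /atan_kernel_der; have := den2 T x; have := den1 T => d1 d2; field.
by rewrite !gt_eqF//; lra.
Qed.

Lemma atan_kernel_der_le T x : x \in `]-1, 0[ -> `|atan_kernel_der T x| <= 2.
Proof.
rewrite in_itv/= => /andP[x1 x0].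
have := den2 T x; have := den1 T => d1 d2.
rewrite /atan_kernel_der normrM normfV (gtr0_norm (mulr_gt0 d1 d2)) ler_pdivrMr ?mulr_gt0//.
rewrite normrM ger0_norm// ler_wpM2l//.
have T0 : 0 <= T ^+ 2 by exact: sqr_ge0.
apply: (@le_trans _ _ (1 + T ^+ 2)); last first.
  by rewrite ler_peMr ?(ltW d1)// lerDl mulr_ge0 ?sqr_ge0.
by rewrite ler_norml; apply/andP; split; nra.
Qed.

(** Near [x = -1] the two arctangents nearly cancel: as a function of
    [q = 1 + 2 x] the numerator vanishes at [q = -1] and has slope at most [1],
    uniformly in [T], for [q <= - 1/2]. *)
Lemma atan_kernel_le T x : x \in `]-1, 0[ -> `|atan_kernel T x| <= 4 * pi.
Proof.
rewrite in_itv/= => /andP[x1 x0]; have p2 := pi_ge2 R.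
have y0 : 0 < 1 + x by lra.
rewrite /atan_kernel normrM normfV (gtr0_norm y0) ler_pdivrMr//.
have [x34|x34] := leP (- (3 / 4)) x.
  have aT (y : R) : `|atan y| <= pi / 2.
    by rewrite ler_norml (ltW (atan_gtNpi2 _)) ltW// atan_ltpi2.
  apply: (le_trans (ler_normD _ _)).
  have := aT T; have := aT ((1 + 2 * x) * T); move: `|_| `|_| => a b; nra.
pose phi q := atan T + atan (q * T).
have dphi (q : R) : is_derive q 1 phi (T / (1 + q ^+ 2 * T ^+ 2)).
  eapply der_eq; first by rewrite /phi; der.
  by rewrite exprMn; ring.
have [||q] := @MVT R phi (fun q => T / (1 + q ^+ 2 * T ^+ 2)) (-1) (1 + 2 * x) _ (fun q _ => dphi q).
- by lra.
- by apply: continuous_subspaceT => q; exact: der_continuous (dphi q).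
rewrite in_itv/= => /andP[q1 q2].
rewrite {2}/phi mulN1r atanN subrr subr0 /phi => ->.
have dq : 0 < 1 + q ^+ 2 * T ^+ 2 by rewrite ltr_wpDr// mulr_ge0 ?sqr_ge0.
have qT : `|T / (1 + q ^+ 2 * T ^+ 2)| <= 1.
  rewrite normrM normfV (gtr0_norm dq) ler_pdivrMr// mul1r ler_norml.
  have q4 : 1 / 4 <= q ^+ 2 by nra.
  have qT : 1 / 4 * T ^+ 2 <= q ^+ 2 * T ^+ 2 by rewrite ler_wpM2r ?sqr_ge0.
  by have := sqr_ge0 (T / 2 - 1); have := sqr_ge0 (T / 2 + 1); nra.
rewrite normrM (_ : 1 + 2 * x - -1 = 2 * (1 + x)); last by ring.
rewrite (@ger0_norm _ (2 * (1 + x))); last by lra.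
move: `|_| qT => a; nra.
Qed.

End atan_kernel.
Section beta_moments.
Variable R : realType.
Local Notation leb := (@lebesgue_measure R).
Local Notation D := (`]-1, 0[%classic : set R).
Local Notation Re := (@complex.Re R).
Local Notation Im := (@complex.Im R).
Variable s : R.
Hypothesis s0 : 0 < s.
Hypothesis s1 : s < 1.

Definition beta_mass := \int[leb]_(x in D) beta_weight s x.

Let w0 x : 0 <= beta_weight s x. Proof. exact/ltW/beta_weight_gt0. Qed.

Let iw := integrable_beta_weight s0 s1.

Lemma pow_itv_le1 (x : R) k : x \in `]-1, 0[ -> `|x ^+ k| <= 1.
Proof.
rewrite in_itv/= => /andP[x1 x0]; rewrite normrX exprn_ile1// ler_norml.
by apply/andP; split; lra.
Qed.

Let integrable_beta_pow k : leb.-integrable D (EFin \o (fun x => beta_weight s x * x ^+ k)).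
Proof.
have H := @integrable_weightM R _ (fun x => x ^+ k) 1 iw.
apply: H => [|x]; last exact: pow_itv_le1.
by apply: measurable_realfun.measurable_funX.
Qed.

(** Integration by parts with [g = x^k] gives the recurrence of the binomials. *)
Lemma beta_moment k : \int[leb]_(x in D) (beta_weight s x * x ^+ k) =
  beta_mass * (neg_binomial R k).[s].
Proof.
elim: k => [|k IH].
  by rewrite neg_binomial0 hornerC mulr1; apply: eq_Rintegral => x _; rewrite mulr1.
have mD : measurable (D : set (measurableTypeR R)) by exact: measurable_itv.
have iZ (c : R) j : leb.-integrable D (EFin \o (fun x : R => c * (beta_weight s x * x ^+ j))).
  by have := @integrableZl _ _ _ leb _ mD c _ (integrable_beta_pow j); exact.
have H : \int[leb]_(x in D) (- (s + k%:R) * (beta_weight s x * x ^+ k)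
    + - k.+1%:R * (beta_weight s x * x ^+ k.+1)) = 0.
  rewrite -[RHS](@beta_weight_by_parts R s s0 s1 (fun x => x ^+ k) (fun x => k%:R * x ^+ k.-1) 1 k%:R).
  - apply: eq_Rintegral => x _; case: k {IH} => [|k] /=.
      by rewrite expr0 expr1; ring.
    by rewrite !exprS -!natr1; ring.
  - by move=> x _; have := derX k (der_id x); rewrite mulr1.
  - move=> x _; apply: cvgM; first exact: cvg_cst.
    exact: exprn_continuous.
  - by move=> x; exact: pow_itv_le1.
  - move=> x xD; rewrite normrM normr_nat -[leRHS]mulr1 ler_wpM2l//.
    exact: pow_itv_le1.
rewrite RintegralD// !RintegralZl// in H.
have := congr1 (horner^~ s) (neg_binomialS R k).
rewrite hornerZ hornerN hornerM hornerD hornerX hornerC.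
rewrite IH in H; move: (neg_binomial R k).[s] (neg_binomial R k.+1).[s] H => a b H E.
have k0 : (k.+1%:R : R) != 0 by rewrite pnatr_eq0.
apply: (mulfI k0); rewrite mulrCA E.
move: H; rewrite mulNr => /eqP; rewrite mulNr -opprD oppr_eq0 addrC addr_eq0 => /eqP ->.
by ring.
Qed.

Lemma beta_cauchyE (L : R[i]) : `|Im L| < pi ->
  weighted_integral (beta_weight s) (fun x => (segment_pt L x)^-1) =
  beta_mass%:C * cexp (- (s%:C * L)).
Proof.
move=> Lpi; have H := beta_cauchy s0 s1 Lpi.
have -> : beta_mass%:C = weighted_integral (beta_weight s) (fun=> 1).
  congr (_ +i* _); first by apply: eq_Rintegral => x _; rewrite mulr1.
  by under eq_Rintegral do rewrite mulr0; rewrite /Rintegral integral0.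
by rewrite -H -mulrA -cexpD subrr cexp0 mulr1.
Qed.

Let mkern T : measurable_fun D (atan_kernel T).
Proof.
apply: measurable_continuous_itv => x; rewrite in_itv/= => /andP[x1 x0].
eapply der_continuous; rewrite /atan_kernel; der.
by rewrite gt_eqF//; lra.
Qed.

Let mkern_der T : measurable_fun D (atan_kernel_der T).
Proof.
apply: measurable_continuous_itv => x _.
eapply der_continuous; rewrite /atan_kernel_der; der.
rewrite -exprMn; apply/lt0r_neq0/mulr_gt0; exact: ltr_wpDr (sqr_ge0 _) ltr01.
Qed.

Lemma beta_atan_kernel_der T :
  \int[leb]_(x in D) (beta_weight s x * atan_kernel_der T x) =
  beta_mass * (2 / (1 + T ^+ 2) * cos (s * (2 * atan T))).
Proof.
have T1 : 0 < 1 + T ^+ 2 by rewrite ltr_wpDr// sqr_ge0.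
set L : R[i] := 0 +i* (2 * atan T).
have Lpi : `|Im L| < pi.
  have := atan_gtNpi2 T; have := atan_ltpi2 T; rewrite /= ltr_norml.
  by move=> ? ?; apply/andP; split; lra.
have := congr1 Re (beta_cauchyE Lpi).
rewrite Re_realM (_ : Re (cexp _) = cos (s * (2 * atan T))); last first.
  by rewrite Re_cexp ReN ImN Re_realM Im_realM /= mulr0 oppr0 expR0 mul1r cosN.
move=> H; have {}H : \int[leb]_(x in D) (beta_weight s x * Re (segment_pt L x)^-1) =
  beta_mass * cos (s * (2 * atan T)) := H.
rewrite mulrCA -H.
have mD : measurable (D : set (measurableTypeR R)) by exact: measurable_itv.
have c0 : 2 / (1 + T ^+ 2) != 0 by rewrite gt_eqF// divr_gt0.
apply: (mulfI (invr_neq0 c0)); rewrite mulKf// -RintegralZl//.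
  by apply: eq_Rintegral => x _; rewrite atan_kernel_derE -/L mulrCA mulKf.
by have := integrable_weightM iw (mkern_der T) (@atan_kernel_der_le R T); exact.
Qed.

(** Integrating the real part of [beta_cauchyE] along the imaginary axis. *)
Lemma beta_atan_kernel T :
  \int[leb]_(x in D) (beta_weight s x * atan_kernel T x) =
  beta_mass * (sin (s * (2 * atan T)) / s).
Proof.
have sn0 : s != 0 by rewrite gt_eqF.
pose H T := \int[leb]_(x in D) (beta_weight s x * atan_kernel T x) -
  beta_mass * (sin (s * (2 * atan T)) / s).
suff : H T = H 0.
  rewrite /H atan0 !mulr0 sin0 mul0r mulr0 subr0.
  under [in RHS]eq_Rintegral do rewrite /atan_kernel mulr0 atan0 addr0 mul0r mulr0.
  by rewrite [X in _ = X]/Rintegral integral0 => /eqP; rewrite subr_eq0 => /eqP.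
have dH : {in `](- (`|T| + 1)), (`|T| + 1)[, forall y : R, is_derive y 1 H 0}.
  move=> y yI; have d1 := @der_weighted_integral R _ w0 iw (fun y x => atan_kernel y x)
    (fun y x => atan_kernel_der y x) _ _ (4 * pi) 2 (fun y _ => mkern y)
    (fun y x _ => @atan_kernel_le R y x) (fun y x _ => @der_atan_kernel R x y)
    (fun y x _ => @atan_kernel_der_le R y x) y yI.
  have d2 : is_derive y 1 (fun y => beta_mass * (sin (s * (2 * atan y)) / s))
      (beta_mass * (2 / (1 + y ^+ 2) * cos (s * (2 * atan y)))).
    eapply der_eq; first by der.
    by cbv beta; field; rewrite sn0 gt_eqF//= ltr_wpDr// sqr_ge0.
  eapply der_eq; first exact: derD d1 (derN d2).
  by rewrite beta_atan_kernel_der subrr.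
apply: (der0_cst dH); rewrite in_itv/=.
  by rewrite -ltr_norml ltrDl.
by rewrite oppr_lt0 andbb ltr_wpDl.
Qed.
End beta_moments.
Lemma cvg_atan_nat (R : realType) (q : R) : 0 < q ->
  atan (q * n%:R) @[n --> \oo] --> pi / 2.
Proof.
move=> q0; apply: (@cvg_comp _ _ _ (fun n : nat => q * n%:R) (@atan R)) (@cvgy_atan R).
apply/cvgryPgt => A; have /cvgryPgt/(_ (q^-1 * A)) := @cvgr_idn R.
by apply: filterS => n; rewrite ltr_pdivrMl.
Qed.

Lemma EFin_Rintegral d (T : measurableType d) (R : realType)
    (mu : {measure set T -> \bar R}) (D : set T) (f : T -> R) :
  measurable D -> mu.-integrable D (EFin \o f) ->
  (\int[mu]_(x in D) (f x)%:E = (\int[mu]_(x in D) f x)%:E)%E.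
Proof. by move=> mD intf; rewrite /Rintegral fineK// integrable_fin_num. Qed.

Section beta_mass.
Variables (R : realType) (s : R).
Hypothesis s0 : 0 < s.
Hypothesis s1 : s < 1.
Local Notation leb := (@lebesgue_measure R).
Local Notation D := (`]-1, 0[%classic : set R).
Local Notation E := (`]- (1 / 2), 0[%classic : set R).

(** The limit of [atan_kernel T x] as [T] grows is [pi / (1 + x)] for
    [x > - 1/2] and [0] for [x < - 1/2]. *)
Lemma integral_beta_right_half :
  (\int[leb]_(x in E) (beta_weight s x * (pi / (1 + x)))%:E = (pi / s)%:E)%E.
Proof.
have sE x : x \in `](- (1 / 2) : R), 0[ -> 0 < - x /\ 0 < 1 + x.
  by rewrite in_itv/= => /andP[? ?]; split; lra.
pose F (x : R) : R := - (pi / s) * expR (s * (ln (- x) - ln (1 + x))).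
have dF x : x \in `](- (1 / 2) : R), 0[ ->
    is_derive x 1 F (beta_weight s x * (pi / (1 + x))).
  move=> /sE[y0 y1]; eapply der_eq; first by rewrite /F; der.
  cbv beta; rewrite (_ : s * (ln (- x) - ln (1 + x)) = ln (- x) + ((s - 1) * ln (- x) - s * ln (1 + x))); last by ring.
  rewrite expRD lnK ?posrE// -/(beta_weight s x); field.
  by rewrite (gt_eqF y1) (gt_eqF s0) andbT -oppr_eq0 (gt_eqF y0).
rewrite (@ge0_FTC2_open R _ F _ _ (- (pi / s)) 0).
- by rewrite sub0r opprK.
- lra.
- move=> x /[dup] /sE[y0 y1] xE.
  by eapply der_continuous; rewrite /beta_weight; der; lra.
- exact: dF.
- have cF : {for (- (1 / 2)), continuous F}.
    by eapply der_continuous; rewrite /F; der; lra.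
  have -> : - (pi / s) = F (- (1 / 2)).
    rewrite /F opprK (_ : 1 + - (1 / 2) = 1 / 2); last by field.
    by rewrite subrr mulr0 expR0 mulr1.
  exact: cvg_at_right_filter.
- have e2 : expR (- (s * ln (1 + x))) @[x --> (0 : R)^'-] --> expR (- (s * ln (1 + 0))).
    apply: cvg_at_left_filter.
    suff : {for (0 : R), continuous (fun x : R => expR (- (s * ln (1 + x))))} by [].
    by eapply der_continuous; der; lra.
  have : - (pi / s) * (expR (s * ln (- x)) * expR (- (s * ln (1 + x)))) @[x --> (0 : R)^'-] -->
      - (pi / s) * (0 * expR (- (s * ln (1 + 0)))).
    by apply: cvgM; [exact: cvg_cst|apply: cvgM => //; exact: cvg_expR_ln_left].
  rewrite mul0r mulr0; apply: cvg_trans; apply: near_eq_cvg; near=> x.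
  by rewrite /F /= -expRD; congr (_ * expR _); ring.
- move=> x /sE[y0 y1]; rewrite mulr_ge0 ?(ltW (beta_weight_gt0 _ _))//.
  by rewrite divr_ge0 ?pi_ge0 ?ltW.
Unshelve. all: by end_near. Qed.

(** Euler's reflection formula: let [T] tend to infinity in [beta_atan_kernel];
    the right-hand side tends to [sin (pi s) / s] times the mass. *)
Lemma beta_massE : beta_mass s * sin (pi * s) = pi.
Proof.
have iw := integrable_beta_weight s0 s1.
have mD : measurable (D : set (measurableTypeR R)) by exact: measurable_itv.
have mE : measurable (E : set (measurableTypeR R)) by exact: measurable_itv.
have w0 x : 0 <= beta_weight s x by exact/ltW/beta_weight_gt0.
pose f (n : nat) x := (beta_weight s x * atan_kernel n%:R x)%:E.
pose h x := (beta_weight s x * (pi / (1 + x)))%:E.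
pose g x := (beta_weight s x * (4 * pi))%:E.
have mk T : measurable_fun D (atan_kernel T).
  apply: measurable_continuous_itv => x; rewrite in_itv/= => /andP[x1 x0].
  by eapply der_continuous; rewrite /atan_kernel; der; lra.
have ik T : leb.-integrable D (EFin \o (fun x => beta_weight s x * atan_kernel T x)).
  by have := integrable_weightM iw (mk T) (@atan_kernel_le R T); exact.
have ig : leb.-integrable D g.
  have := @integrable_weightM R _ (fun=> 4 * pi) (4 * pi) iw (measurable_cst _).
  by apply=> x _; rewrite ger0_norm// mulr_ge0// pi_ge0.
have mf n : measurable_fun D (f n) by case/integrableP : (ik n%:R).
have mh : measurable_fun D (h \_ E).
  apply/measurable_restrict => //; apply: (@measurable_funS _ _ _ _ D) => //.
  apply/measurable_EFinP; apply: measurable_continuous_itv => x.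
  rewrite in_itv/= => /andP[x1 x0].
  by eapply der_continuous; rewrite /beta_weight; der; lra.
have fh : {ae leb, forall x, D x -> f ^~ x @ \oo --> (h \_ E) x}.
  (* At the midpoint [x = - 1/2] the limit has an intermediate value. *)
  exists [set - (1 / 2)]; split; first exact: measurable_set1.
    exact: lebesgue_measure_set1.
  move=> x /= H; apply: contrapT => /eqP xn; apply: H => xD.
  have := xD; rewrite /= in_itv/= => /andP[x1 x0].
  have aN : atan (n%:R : R) @[n --> \oo] --> pi / 2.
    by have := @cvg_atan_nat R 1 ltr01; under eq_fun do rewrite mul1r.
  rewrite /f /h patchE /=.
  case: ifPn => [/set_mem|/negP xE].
    rewrite /= in_itv/= => /andP[x2 _]; apply: cvg_EFin; first exact: nearW.
    apply: cvgM; first exact: cvg_cst.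
    apply: cvgM; last exact: cvg_cst.
    rewrite [X in _ --> X](splitr pi); apply: cvgD => //.
    by apply: cvg_atan_nat; lra.
  have x2 : x < - (1 / 2).
    rewrite lt_neqAle xn/= leNgt; apply/negP => x2; apply: xE; rewrite inE/= in_itv/=.
    by rewrite x2.
  apply: cvg_EFin; first exact: nearW.
  rewrite -(mulr0 (beta_weight s x)); apply: cvgM; first exact: cvg_cst.
  rewrite -(mul0r (1 + x)^-1); apply: cvgM; last exact: cvg_cst.
  rewrite -(subrr (pi / 2)); apply: cvgD => //.
  under eq_fun do rewrite -[(1 + 2 * x)]opprK mulNr atanN.
  by apply: cvgN; apply: cvg_atan_nat; lra.
have fg : {ae leb, forall x n, D x -> `|f n x| <= g x}%E.
  apply: aeW => x n xD; rewrite /f /g lee_fin normrM ger0_norm// ler_wpM2l//.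
  exact: atan_kernel_le.
have [_ _ ] := dominated_convergence mD mf mh fh ig fg.
rewrite -integral_mkcondr (_ : _ `&` _ = E); last first.
  apply/seteqP; split => x /=; first by case.
  by rewrite !in_itv/= => /andP[? ->]; split; rewrite ?andbT//; lra.
rewrite integral_beta_right_half.
under eq_fun do rewrite (EFin_Rintegral mD (ik _)) (beta_atan_kernel s0 s1).
move=> /fine_cvg H.
have aN : atan (n%:R : R) @[n --> \oo] --> pi / 2.
  by have := @cvg_atan_nat R 1 ltr01; under eq_fun do rewrite mul1r.
have H2 : beta_mass s * (sin (s * (2 * atan (n%:R : R))) / s) @[n --> \oo] -->
    beta_mass s * (sin (s * (2 * (pi / 2))) / s).
  apply: cvgM; first exact: cvg_cst.
  apply: cvgM; last exact: cvg_cst.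
  apply: (@cvg_comp _ _ _ (fun n : nat => s * (2 * atan (n%:R : R))) (@sin R)); last first.
    exact: continuous_sin.
  by apply: cvgM; [exact: cvg_cst|apply: cvgM => //; exact: cvg_cst].
have {H2 H}E : _ = pi / s := cvg_unique (@Rhausdorff R) H2 H.
rewrite (_ : s * _ = pi * s) in E; last by field.
have sn0 : s != 0 by rewrite gt_eqF.
by apply: (mulIf (invr_neq0 sn0)); rewrite -mulrA E.
Qed.

End beta_mass.

(** * The density as a mixture of beta weights *)

Section fubini_density.
Variable R : realType.
Local Notation leb := (@lebesgue_measure R).
Local Notation D := (`]-1, 0[%classic : set R).
Local Notation I := (`]0, 1[%classic : set R).
Local Notation p := (@fubini_density R).
Implicit Types (x s : R) (g h : R -> R).

Let mD : measurable (D : set (measurableTypeR R)).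
Proof. exact: measurable_itv. Qed.

Let mI : measurable (I : set (measurableTypeR R)).
Proof. exact: measurable_itv. Qed.

Let w0 s x : 0 <= beta_weight s x.
Proof. exact/ltW/beta_weight_gt0. Qed.

Lemma sinpi_gt0 s : s \in `]0, 1[ -> 0 < sin (pi * s).
Proof.
rewrite in_itv/= => /andP[s0 s1]; apply: sin_gt0_pi; rewrite mulr_gt0 ?pi_gt0//=.
by rewrite gtr_pMr ?pi_gt0.
Qed.

Lemma fubini_densityE x : x \in `]-1, 0[ -> p x =
  (- x * (1 + x) * (pi ^+ 2 + (ln (- x) - ln (1 + x)) ^+ 2))^-1.
Proof.
rewrite in_itv/= => /andP[x1 x0].
have y0 : 0 < - x by rewrite oppr_gt0.
have y1 : 0 < 1 + x by lra.
rewrite /fubini_density ltr0_norm// (addrC x 1).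
have -> : `|1 + x^-1| = (1 + x) / (- x).
  rewrite (_ : 1 + x^-1 = - ((1 + x) / (- x))).
    by rewrite normrN gtr0_norm// divr_gt0.
  by field; rewrite lt_eqF.
by rewrite ln_div ?posrE// -(sqrrN (_ - _)) opprB.
Qed.

Lemma fubini_density_gt0 x : x \in `]-1, 0[ -> 0 < p x.
Proof.
move=> xD; rewrite fubini_densityE//; move: xD; rewrite in_itv/= => /andP[x1 x0].
rewrite invr_gt0 mulr_gt0 ?mulr_gt0 ?oppr_gt0//; first lra.
by rewrite ltr_pwDl ?sqr_ge0// exprn_gt0// pi_gt0.
Qed.

Lemma measurable_fubini_density : measurable_fun D p.
Proof.
apply: (@eq_measurable_fun _ _ _ _ _ (fun x : R => (- x * (1 + x) *
    (pi ^+ 2 + (ln (- x) - ln (1 + x)) ^+ 2))^-1)).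
  by move=> x; rewrite inE => /fubini_densityE ->.
apply: measurable_continuous_itv => x xD; have := fubini_density_gt0 xD.
rewrite fubini_densityE// invr_gt0 => n0.
move: xD; rewrite in_itv/= => /andP[x1 x0].
by eapply der_continuous; der; rewrite ?gt_eqF//; lra.
Qed.

Lemma integral_indic_mul (A : set R) h :
  (\int[leb]_x (\1_A x * h x)%:E = \int[leb]_(x in A) (h x)%:E)%E.
Proof.
rewrite [RHS]integral_mkcond; apply: eq_integral => x _.
by rewrite patchE indicE; case: (x \in A); rewrite ?mul1r ?mul0r.
Qed.

(** Since [beta_weight s x = exp (s l) / (- x)] with [l = ln (-x / (1 + x))], this
    is the integral of [exp (s l) sin (pi s)] over a half period of the sine. *)
Lemma fubini_density_mixture x : x \in `]-1, 0[ ->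
  (\int[leb]_(s in I) (sin (pi * s) / pi * beta_weight s x)%:E = (p x)%:E)%E.
Proof.
move=> xD; have := xD; rewrite in_itv/= => /andP[x1 x0].
have y0 : 0 < - x by rewrite oppr_gt0.
have y1 : 0 < 1 + x by lra.
have p0 : 0 < pi :> R := pi_gt0 R.
set l := ln (- x) - ln (1 + x).
have d0 : 0 < pi ^+ 2 + l ^+ 2 by rewrite ltr_pwDl ?sqr_ge0// exprn_gt0.
have wE s : beta_weight s x = expR (s * l) / (- x).
  rewrite -[X in _ / X]lnK ?posrE// -expRN -expRD /beta_weight.
  by congr expR; rewrite /l; ring.
pose F s := expR (s * l) * (l * sin (pi * s) - pi * cos (pi * s)) /
  ((pi ^+ 2 + l ^+ 2) * (pi * (- x))).
have dF s : is_derive s 1 F (sin (pi * s) / pi * beta_weight s x).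
  eapply der_eq; first by rewrite /F; der.
  rewrite wE; cbv beta; move: (pi : R) p0 d0 => q p0 d0; field.
  by rewrite -(oppr_eq0 x) !gt_eqF.
have cF s : {for s, continuous F} by exact: der_continuous (dF s).
rewrite (@ge0_FTC2_open R _ F 0 1 (F 0) (F 1)) ?ltr01//.
- congr EFin; rewrite /F mulr0 mulr1 mul0r mul1r sin0 cos0 sinpi cospi expR0.
  rewrite {1}/l expRD expRN !lnK ?posrE// fubini_densityE// -/l.
  move: (pi : R) p0 d0 => q p0 d0; field.
  by rewrite -(oppr_eq0 x) !gt_eqF.
- by move=> s _; eapply der_continuous; rewrite /beta_weight; der.
- exact: cvg_at_right_filter (cF 0).
- exact: cvg_at_left_filter (cF 1).
- by move=> s /sinpi_gt0 s0; rewrite mulr_ge0 ?divr_ge0 ?(ltW s0) ?(ltW p0).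
Qed.

(** Tonelli's theorem for the mixture; [beta_massE] cancels the normalisation. *)
Lemma ge0_integral_fubini_density g h (C : R) : measurable_fun D g ->
  {in `]-1, 0[, forall x, 0 <= g x <= C} ->
  (forall s, s \in `]0, 1[ ->
    \int[leb]_(x in D) (beta_weight s x * g x) = beta_mass s * h s) ->
  (\int[leb]_(x in D) (p x * g x)%:E = \int[leb]_(s in I) (h s)%:E)%E.
Proof.
move=> mg gC gh.
have p0 : 0 < pi :> R := pi_gt0 R.
pose G x := \1_D x * g x.
pose K s := \1_I s * (sin (pi * s) / pi).
have K0 s : 0 <= K s.
  rewrite /K indicE; case: (boolP (s \in I)) => [|_]; rewrite ?mul0r// mul1r inE => sI.
  by rewrite divr_ge0 ?(ltW p0)// ltW// sinpi_gt0.
have G0 x : 0 <= G x.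
  rewrite /G indicE; case: (boolP (x \in D)) => [|_]; rewrite ?mul0r// mul1r inE.
  by move=> /gC/andP[].
have mG : measurable_fun setT G.
  rewrite (_ : G = g \_ D); first by apply/(measurable_restrictT g mD).
  by apply/funext => x; rewrite /G patchE indicE; case: ifP; rewrite ?mul1r ?mul0r.
have mK : measurable_fun setT K.
  apply: measurable_funM; first exact: measurable_indic.
  apply: continuous_measurable_fun => s.
  by eapply der_continuous; der.
pose f (z : measurableTypeR R * measurableTypeR R) := (K z.2 * beta_weight z.2 z.1 * G z.1)%:E.
have mw : measurable_fun setT (fun z : measurableTypeR R * measurableTypeR R => beta_weight z.2 z.1).
  have mNx : measurable_fun setT (fun z : measurableTypeR R * measurableTypeR R => ln (- z.1)).
    apply: (measurableT_comp (@measurable_ln R)).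
    by apply: measurableT_comp; [exact: oppr_measurable|exact: measurable_fst].
  have m1x : measurable_fun setT (fun z : measurableTypeR R * measurableTypeR R => ln (1 + z.1)).
    apply: (measurableT_comp (@measurable_ln R)).
    by apply: measurable_funD => //; exact: measurable_fst.
  have mz2 : measurable_fun setT (fun z : measurableTypeR R * measurableTypeR R => z.2).
    exact: measurable_snd.
  have m2 : measurable_fun setT (fun z : measurableTypeR R * measurableTypeR R => z.2 - 1).
    by apply: measurable_funB.
  apply: (measurableT_comp (@measurable_expR R)).
  exact: measurable_funB (measurable_funM m2 mNx) (measurable_funM mz2 m1x).
have mf : measurable_fun setT f.
  apply/measurable_EFinP; apply: measurable_funM; last first.
    by apply: (measurableT_comp mG); exact: measurable_fst.
  by apply: measurable_funM => //; apply: (measurableT_comp mK); exact: measurable_snd.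
have f0 z : (0 <= f z)%E.
  by rewrite /f lee_fin; exact: mulr_ge0 (mulr_ge0 (K0 _) (w0 _ _)) (G0 _).
have := @fubini_tonelli _ _ _ _ R leb leb f mf f0.
have -> : (\int[leb]_x \int[leb]_s f (x, s) = \int[leb]_(x in D) (p x * g x)%:E)%E.
  rewrite -(integral_indic_mul D); apply: eq_integral => x _.
  rewrite /f /G /=.
  rewrite indicE; case: (boolP (x \in D)) => [|_]; last first.
    by rewrite !mul0r; under eq_integral do rewrite mulr0; rewrite integral0.
  rewrite inE => xD; have gx := gC x xD.
  under eq_integral do rewrite EFinM.
  rewrite ge0_integralZr//.
  - rewrite !mul1r EFinM -fubini_density_mixture// -(integral_indic_mul I).
    apply: (f_equal2 (fun a b : \bar R => (a * b)%E)) => //.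
    by apply: eq_integral => s _; rewrite /K -mulrA.
  - apply/measurable_EFinP; apply: measurable_funM => //.
    by have := measurable_fun_pair2 x mw.
  - by move=> s _; rewrite lee_fin; exact: mulr_ge0 (K0 _) (w0 _ _).
  - by rewrite mul1r lee_fin; case/andP : gx.
move=> ->; rewrite -(integral_indic_mul I); apply: eq_integral => s _.
rewrite /f /K /= indicE; case: (boolP (s \in I)) => [|_]; last first.
  by rewrite !mul0r; under eq_integral do rewrite !mul0r; rewrite integral0.
rewrite inE => sI; have := sI; rewrite /= in_itv/= => /andP[s0 s1].
(* It remains to integrate in [x] for fixed [s]. *)
transitivity (\int[leb]_x (\1_D x * (sin (pi * s) / pi * (beta_weight s x * g x)))%:E)%E.
  by apply: eq_integral => x _; congr EFin; rewrite /G; ring.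
have ig : leb.-integrable D (EFin \o (fun x => beta_weight s x * g x)).
  apply: (@integrable_weightM R _ g C (integrable_beta_weight s0 s1) mg) => x /gC.
  by move=> /andP[g0 gC']; rewrite ger0_norm.
rewrite (integral_indic_mul D).
under eq_integral do rewrite EFinM.
rewrite integralZl// EFin_Rintegral// gh// -EFinM; congr EFin.
transitivity (beta_mass s * sin (pi * s) / pi * h s); first by rewrite mulrCA mulrA (mulrA (beta_mass s)).
by rewrite beta_massE// mulfV ?gt_eqF.
Qed.

End fubini_density.

(** * Moments and Cauchy transform of the density *)

Section averages.
Variable R : realType.
Local Notation leb := (@lebesgue_measure R).
Local Notation D := (`]-1, 0[%classic : set R).
Local Notation I := (`]0, 1[%classic : set R).
Local Notation p := (@fubini_density R).
Local Notation Re := (@complex.Re R).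
Local Notation Im := (@complex.Im R).
Local Notation nc := (@Normc.normc R).
Implicit Types (x s : R) (g h : R -> R) (L : R[i]).

Let mD : measurable (D : set (measurableTypeR R)).
Proof. exact: measurable_itv. Qed.

Let mI : measurable (I : set (measurableTypeR R)).
Proof. exact: measurable_itv. Qed.

Lemma lebesgue_measure_unit_itv : leb I = 1%E.
Proof. by rewrite lebesgue_measure_itv/= lte_fin ltr01 oppr0 adde0. Qed.

Lemma integral_fubini_density : (\int[leb]_(x in D) (p x)%:E = 1)%E.
Proof.
have := @ge0_integral_fubini_density R (fun=> 1) (fun=> 1) 1 (measurable_cst _).
under eq_integral do rewrite mulr1; move=> ->.
- by rewrite integral_cst// mul1e; exact: lebesgue_measure_unit_itv.
- by move=> x _; rewrite ler01 lexx.
- by move=> s _; under eq_Rintegral do rewrite mulr1; rewrite mulr1.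
Qed.

Lemma integrable_fubini_density : leb.-integrable D (EFin \o p).
Proof.
apply/integrableP; split.
  by apply/measurable_EFinP; exact: measurable_fubini_density.
under eq_integral => x.
  rewrite inE => xD; rewrite /= ger0_norm; last exact/ltW/fubini_density_gt0.
  over.
by rewrite integral_fubini_density ltry.
Qed.

(** Reduction to a nonnegative function by adding a constant. *)
Lemma Rintegral_fubini_density g h (C : R) : measurable_fun D g ->
  {in `]-1, 0[, forall x, `|g x| <= C} -> leb.-integrable I (EFin \o h) ->
  (forall s, s \in `]0, 1[ ->
    \int[leb]_(x in D) (beta_weight s x * g x) = beta_mass s * h s) ->
  \int[leb]_(x in D) (p x * g x) = \int[leb]_(s in I) h s.
Proof.
move=> mg gC ih gh.
have iC : leb.-integrable I (EFin \o (fun=> C)).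
  apply/integrableP; split; first exact/measurable_EFinP.
  by rewrite integral_cst// [X in (_ * X)%E]lebesgue_measure_unit_itv mule1 ltry.
have iB (f : R -> R) : measurable_fun D f -> {in `]-1, 0[, forall x, `|f x| <= C} ->
    leb.-integrable D (EFin \o (fun x => p x * f x)).
  by move=> mf fC; exact: (integrable_weightM integrable_fubini_density mf fC).
have C0 : 0 <= C.
  apply: le_trans (gC (- 2^-1) _) => //; rewrite in_itv/=; apply/andP; split; lra.
have H : (\int[leb]_(x in D) (p x * (g x + C))%:E = \int[leb]_(s in I) (h s + C)%:E)%E.
  apply: (@ge0_integral_fubini_density R _ _ (C + C)).
  - exact: measurable_funD.
  - by move=> x /gC; rewrite ler_norml; lra.
  - move=> s sI; have := sI; rewrite in_itv/= => /andP[s0 s1].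
    have iw := integrable_beta_weight s0 s1.
    under eq_Rintegral do rewrite mulrDr.
    rewrite RintegralD//; first 1 last.
    + by have := integrable_weightM iw mg gC; exact.
    + by have := @integrable_weightM R _ (fun=> C) C iw; apply=> // x _; rewrite ger0_norm.
    rewrite gh// mulrDr; congr (_ + _).
    by rewrite RintegralZr.
have {}H := congr1 fine H.
have {}H : \int[leb]_(x in D) (p x * (g x + C)) = \int[leb]_(s in I) (h s + C) := H.
move: H; under eq_Rintegral do rewrite mulrDr.
rewrite !RintegralD//; [|exact: iB|by apply: iB => // x _; rewrite ger0_norm].
rewrite RintegralZr//; last exact: integrable_fubini_density.
rewrite [X in X * _]/Rintegral integral_fubini_density Rintegral_cst//.
by rewrite [X in C * fine X]lebesgue_measure_unit_itv /= mul1r mulr1 => /addIr.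
Qed.

Lemma fubini_density_moment k :
  \int[leb]_(x in D) (p x * x ^+ k) = fubini_moment R k.
Proof.
have iq : leb.-integrable `[0, 1] (EFin \o (fun s : R => (neg_binomial R k).[s])).
  apply: continuous_compact_integrable; first exact: segment_compact.
  by apply: continuous_subspaceT => s; exact: continuous_horner.
rewrite (@Rintegral_fubini_density (fun x => x ^+ k) (fun s => (neg_binomial R k).[s]) 1).
- rewrite -poly_integral_neg_binomial /poly_integral.
  rewrite -Rintegral_itv_bndo_bndc ?Rintegral_itv_obnd_cbnd//.
    by apply: integrableS iq => //; exact: subset_itv_oo_cc.
  apply: integrableS iq => //; move=> s /=.
  by rewrite !in_itv/= => /andP[-> /ltW ->].
- exact: measurable_realfun.measurable_funX.
- by move=> x; exact: pow_itv_le1.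
- by apply: integrableS iq => //; exact: subset_itv_oo_cc.
- by move=> s; rewrite in_itv/= => /andP[s0 s1]; exact: beta_moment.
Qed.


Lemma segment_ptV_cbounded L : `|Im L| < pi -> cbounded (fun x => (segment_pt L x)^-1).
Proof.
move=> Lpi.
have [|C C0 VC] := @segment_ptV_bounded R `|Re L| `|Im L|; first by rewrite normr_ge0.
apply: (@cder_cbounded R _ _ C) => x xD; last by apply: VC => //; exact: subset_itv_oo_cc.
have n0 : segment_pt L x != 0 by apply: segment_pt_neq0 => //; exact: subset_itv_oo_cc.
exact: cderV n0 (cder_segment_pt_x L x).
Qed.

(** Integrating the mixture: the transform of the law is an average of
    exponentials. *)
Lemma fubini_density_cauchy L : `|Im L| < pi -> L != 0 ->
  weighted_integral p (fun x => (segment_pt L x)^-1) = (1 - cexp (- L)) / L.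
Proof.
move=> Lpi L0; have [mVr mVi [C VC]] := segment_ptV_cbounded Lpi.
pose E s := cexp (s%:C * - L).
pose F s := - (E s / L).
have dF s : cderive F s (E s).
  eapply cder_eq; first exact: cderN (cderM (cder_cexp (- L) s) (cder_cst L^-1 s)).
  by rewrite mulr0 addr0 /E; field.
have iE (f : R -> R) : (forall s : R, {for s, continuous f}) -> leb.-integrable I (EFin \o f).
  move=> cf; have : leb.-integrable `[0, 1] (EFin \o f).
    apply: continuous_compact_integrable; first exact: segment_compact.
    by apply: continuous_subspaceT => s; exact: cf.
  by apply: integrableS => //; exact: subset_itv_oo_cc.
have cE s : {for s, continuous (fun s => Re (E s))} /\ {for s, continuous (fun s => Im (E s))}.
  by have [er ei] := cder_cexp (- L) s; split; [exact: der_continuous er|exact: der_continuous ei].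
have gh s : s \in `]0, 1[ -> weighted_integral (beta_weight s)
    (fun x => (segment_pt L x)^-1) = (beta_mass s)%:C * E s.
  by rewrite in_itv/= => /andP[s0 s1]; rewrite beta_cauchyE// /E mulrN.
have FE : F 1 - F 0 = (1 - cexp (- L)) / L.
  by rewrite /F /E mul0r mul1r cexp0; field.
have Fr s : {for s, continuous (fun s => Re (F s))} /\ {for s, continuous (fun s => Im (F s))}.
  by have [er ei] := dF s; split; [exact: der_continuous er|exact: der_continuous ei].
have hr : \int[leb]_(x in D) (p x * Re (segment_pt L x)^-1) = Re (F 1 - F 0).
  rewrite (@Rintegral_fubini_density (fun x => Re (segment_pt L x)^-1) (fun s => Re (E s)) C) //.
  - rewrite (@FTC2_open R _ (fun s => Re (F s)) 0 1 (Re (F 0)) (Re (F 1))) ?ltr01//.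
    + by rewrite ReD [Re (- F 0)]ReN.
    + by move=> s _; have [] := cE s.
    + by move=> s _; have [] := dF s.
    + by apply: cvg_at_right_filter; have [] := Fr 0.
    + by apply: cvg_at_left_filter; have [] := Fr 1.
    + by apply: iE => s; have [] := cE s.
  - by move=> x /VC; apply: le_trans (Re_le_normc _).
  - by apply: iE => s; have [] := cE s.
  - by move=> s /gh/(congr1 Re); rewrite Re_realM.
have hi : \int[leb]_(x in D) (p x * Im (segment_pt L x)^-1) = Im (F 1 - F 0).
  rewrite (@Rintegral_fubini_density (fun x => Im (segment_pt L x)^-1) (fun s => Im (E s)) C) //.
  - rewrite (@FTC2_open R _ (fun s => Im (F s)) 0 1 (Im (F 0)) (Im (F 1))) ?ltr01//.
    + by rewrite ImD [Im (- F 0)]ImN.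
    + by move=> s _; have [] := cE s.
    + by move=> s _; have [] := dF s.
    + by apply: cvg_at_right_filter; have [] := Fr 0.
    + by apply: cvg_at_left_filter; have [] := Fr 1.
    + by apply: iE => s; have [] := cE s.
  - by move=> x /VC; apply: le_trans (Im_le_normc _).
  - by apply: iE => s; have [] := cE s.
  - by move=> s /gh/(congr1 Im); rewrite Im_realM.
rewrite /weighted_integral hr hi FE; by case: (_ / _).
Qed.

End averages.

(** * Logarithmic potential of the density *)

Section log_potential.
Variable R : realType.
Local Notation leb := (@lebesgue_measure R).
Local Notation D := (`]-1, 0[%classic : set R).
Local Notation p := (@fubini_density R).
Local Notation Re := (@complex.Re R).
Local Notation Im := (@complex.Im R).
Local Notation nc := (@Normc.normc R).
Implicit Types (x s y : R) (g h : R -> R) (L z : R[i]).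

Lemma abs_ln_le y : 0 < y -> `|ln y| <= y + y^-1.
Proof.
move=> y0; have yV : 0 < y^-1 by rewrite invr_gt0.
have lnle (u : R) : 0 < u -> ln u <= u.
  by move=> u0; have := le_ln1Dx (x := u - 1); rewrite subrKC; lra.
have := lnle _ y0; have := lnle _ yV; rewrite lnV ?posrE// ler_norml.
by move=> ? ?; apply/andP; split; lra.
Qed.

Lemma cexp_eq1 z : `|Im z| < pi -> cexp z = 1 -> z = 0.
Proof.
move=> zpi z1; have := congr1 nc z1; rewrite normc_cexp.
have -> : nc 1 = 1 by rewrite -(normr1 R) -normc_real.
rewrite -expR0 => /expR_inj r0.
have := congr1 Re z1; rewrite Re_cexp r0 expR0 mul1r -cos_norm => c1.
suff i0 : `|Im z| = 0.
  by move/eqP: i0; rewrite normr_eq0 => /eqP i0; case: z r0 i0 {zpi z1 c1} => a b /= -> ->.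
apply: cos_inj; rewrite ?in_itv/= ?normr_ge0 ?(ltW zpi) ?lexx ?pi_ge0//.
by rewrite cos0.
Qed.

Lemma cexp_sub1_neq0 L y : `|Im (y%:C * L)| < pi -> L != 0 -> y != 0 ->
  cexp (y%:C * L) - 1 != 0.
Proof.
move=> yL L0 y0; apply/negP; rewrite subr_eq0 => /eqP/(cexp_eq1 yL)/eqP.
by rewrite mulf_eq0 (negPf L0) orbF eq_complex /= (negPf y0).
Qed.

(** The absolute value only serves to make the weight nonnegative outside the
    interval as well. *)
Definition log_potential L := \int[leb]_(x in D) (`|p x| * ln (nc (segment_pt L x))).

Lemma ln_segment_bounded (A B : R) : 0 <= B < pi -> exists C, forall L x,
  `|Re L| <= A -> `|Im L| <= B -> x \in `]-1, 0[ -> `|ln (nc (segment_pt L x))| <= C.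
Proof.
move=> /[dup] B0 /andP[_ Bpi]; have [C C0 VC] := segment_ptV_bounded A B0.
exists (1 + expR A + C) => L x LA LB xD.
have xI : x \in `[-1, 0] by exact: subset_itv_oo_cc.
have n0 : segment_pt L x != 0 by apply: segment_pt_neq0; rewrite ?(le_lt_trans LB).
apply: le_trans (abs_ln_le (normc_gt0 n0)) _; apply: lerD; last first.
  by rewrite -Normc.normcV; exact: VC.
rewrite /segment_pt; apply: le_trans (le_normcD _ _) _.
have -> : nc (- (x%:C * cexp L)) = nc (x%:C * cexp L) by exact: normcN.
rewrite Normc.normcM !normc_real normc_cexp.
move: xD; rewrite in_itv/= => /andP[x1 x0].
apply: lerD; first by rewrite ler_norml; apply/andP; split; lra.
rewrite -[leRHS]mul1r; apply: ler_pM; rewrite ?expR_ge0//.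
  by rewrite ler_norml; apply/andP; split; lra.
by rewrite ler_expR (le_trans (ler_norm _)).
Qed.

Lemma der_quotient_cvg (f : R -> R) (a : R) : is_derive (0 : R) 1 f a ->
  (f y - f 0) / y @[y --> 0^'+] --> a.
Proof.
move=> fa; apply: cvg_dnbhs_at_right.
have : h^-1 *: ((f \o shift (0 : R)) (h *: (1 : R)) - f 0) @[h --> (0 : R)^'] --> a.
  by rewrite -(derive_val (is_derive := fa)); exact: ex_derive.
apply: cvg_trans; apply: near_eq_cvg; near=> y.
by rewrite /= /shift /= addr0 /GRing.scale /= mulr1 mulrC.
Unshelve. all: by end_near. Qed.

(** Near [0], [cexp (y L) - 1] is equivalent to [y L]. *)
Lemma cvg_ln_cexp_sub1 L : L != 0 ->
  ln (nc (cexp (y%:C * L) - 1)) - ln y @[y --> (0 : R)^'+] --> ln (nc L).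
Proof.
move=> L0; have [dr di] := cder_cexp L 0.
rewrite mul0r cexp0 mulr1 in dr di.
have {dr}qr := der_quotient_cvg dr; have {di}qi := der_quotient_cvg di.
pose q y := ((Re (cexp (y%:C * L)) - Re (cexp (0%:C * L))) / y) ^+ 2 +
  ((Im (cexp (y%:C * L)) - Im (cexp (0%:C * L))) / y) ^+ 2.
have qL : q y @[y --> (0 : R)^'+] --> nc L ^+ 2.
  by rewrite normc_sqr; apply: cvgD; exact: cvgM.
have L1 : 0 < nc L ^+ 2 by rewrite exprn_gt0// normc_gt0.
have : 2^-1 * ln (q y) @[y --> (0 : R)^'+] --> 2^-1 * ln (nc L ^+ 2).
  apply: cvgM; first exact: cvg_cst.
  apply: (@cvg_comp _ _ _ q (@ln R)) qL _.
  exact: continuous_ln.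
have lnXE (u : R) : 0 < u -> 2^-1 * ln (u ^+ 2) = ln u.
  by move=> u0; rewrite lnXn// mulr2n; field.
rewrite lnXE ?normc_gt0//; apply: cvg_trans; apply: near_eq_cvg.
near=> y; have y0 : 0 < y by near: y; exact: nbhs_right_gt.
have -> : q y = (nc (cexp (y%:C * L) - 1) / y) ^+ 2.
  rewrite expr_div_n normc_sqr /q mul0r cexp0 !expr_div_n ReD ImD ReN ImN.
  by rewrite -mulrDl.
have Lpi : `|Im (y%:C * L)| < pi.
  rewrite Im_realM normrM (gtr0_norm y0).
  have L2 : 0 < 1 + `|Im L| by rewrite ltr_pwDl.
  have : y < pi / (1 + `|Im L|).
    by near: y; apply: nbhs_right_lt; rewrite divr_gt0// pi_gt0.
  rewrite ltr_pdivlMr//; apply: le_lt_trans; rewrite ler_wpM2l ?(ltW y0)//.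
  by rewrite lerDr.
have e0 : 0 < nc (cexp (y%:C * L) - 1).
  by apply: normc_gt0; apply: cexp_sub1_neq0 => //; rewrite gt_eqF.
by rewrite lnXE ?divr_gt0// ln_div.
Unshelve. all: by end_near. Qed.

Let ap0 x : 0 <= `|p x|. Proof. exact: normr_ge0. Qed.

Let ip : leb.-integrable D (EFin \o (fun x => `|p x|)).
Proof. exact: integrable_norm (integrable_fubini_density R). Qed.

Let normp x : x \in `]-1, 0[ -> `|p x| = p x.
Proof. by move=> xD; rewrite gtr0_norm// fubini_density_gt0. Qed.

(** With [e = cexp (y L)], a partial fraction expresses the derivative
    [- x L e / segment_pt] of the logarithm as an affine function of
    [1 / segment_pt]. *)
Lemma integral_der_log_segment L y : `|Im (y%:C * L)| < pi -> L != 0 -> y != 0 ->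
  \int[leb]_(x in D) (`|p x| * Re (- (x%:C * (L * cexp (y%:C * L))) / segment_pt (y%:C * L) x)) =
  Re (L * cexp (y%:C * L) / (cexp (y%:C * L) - 1)) - y^-1.
Proof.
move=> yL L0 y0; set e := cexp (y%:C * L).
have e1 : e - 1 != 0 by exact: cexp_sub1_neq0.
have e0 : e != 0 by exact: cexp_neq0.
have yC0 : y%:C != 0 by rewrite eq_complex /= (negPf y0).
set a := L * e / (e - 1).
transitivity (Re (weighted_integral (fun x => `|p x|)
    (fun x => a * 1 + - a * (segment_pt (y%:C * L) x)^-1))).
  apply: eq_Rintegral => x /set_mem xD; congr (_ * Re _).
  have : segment_pt (y%:C * L) x != 0.
    by apply: segment_pt_neq0 => //; exact: subset_itv_oo_cc.
  rewrite /segment_pt -/e rmorphD rmorph1 /a => n0; field.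
  by rewrite n0.
rewrite (weighted_integral_lin a (- a) ip); last exact: segment_ptV_cbounded.
- have -> : weighted_integral (fun x => `|p x|) (fun=> 1) = 1.
    congr (_ +i* _).
      transitivity (\int[leb]_(x in D) p x).
        by apply: eq_Rintegral => x /set_mem xD; rewrite mulr1 normp.
      by rewrite /Rintegral integral_fubini_density.
    by under eq_Rintegral do rewrite mulr0; rewrite /Rintegral integral0.
  have -> : weighted_integral (fun x => `|p x|) (fun x => (segment_pt (y%:C * L) x)^-1) =
      (1 - e^-1) / (y%:C * L).
    transitivity (weighted_integral p (fun x => (segment_pt (y%:C * L) x)^-1)).
      by congr (_ +i* _); apply: eq_Rintegral => x /set_mem xD; rewrite normp.
    rewrite fubini_density_cauchy ?mulf_neq0//; congr ((1 - _) / _).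
    by apply: (mulIf e0); rewrite mulVf// -cexpD addNr cexp0.
  rewrite (_ : _ + _ = a - (y^-1)%:C); first by rewrite ReD ReN.
  by rewrite rmorphV ?unitfE// /a; field; rewrite L0 yC0 e1.
- by apply: (@cder_cbounded R _ (fun=> 0) 1) => x _; [exact: cder_cst|rewrite Normc.normc1].
Qed.

(** The potential along the ray [y L] and [ln |cexp (y L) - 1| - ln y] have the
    same derivative; their difference is found by letting [y] tend to [0]. *)
Lemma log_potentialE L : `|Im L| < pi -> L != 0 ->
  log_potential L = ln (nc (cexp L - 1)) - ln (nc L).
Proof.
move=> Lpi L0; have [T T1 TL] := dilation_lt_pi Lpi.
have T0 : 0 < T by rewrite (lt_trans _ T1).
have yT y : y \in `]-T, T[ -> `|y| <= T.
  by rewrite in_itv/= ler_norml => /andP[/ltW -> /ltW].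
have TL0 : 0 <= T * `|Im L| < pi by rewrite mulr_ge0 ?(ltW T0).
have [C C0 VC] := @segment_ptV_bounded R (T * `|Re L|) (T * `|Im L|) TL0.
have [C' lnC] := @ln_segment_bounded (T * `|Re L|) (T * `|Im L|) TL0.
have rL y : y \in `]-T, T[ -> `|Re (y%:C * L)| <= T * `|Re L|.
  by move=> /yT yI; rewrite Re_realM normrM ler_wpM2r.
have iL y : y \in `]-T, T[ -> `|Im (y%:C * L)| <= T * `|Im L|.
  by move=> /yT yI; rewrite Im_realM normrM ler_wpM2r.
have yL y : y \in `]-T, T[ -> `|Im (y%:C * L)| < pi.
  by move=> /iL yI; rewrite (le_lt_trans yI).
have n0 y x : y \in `]-T, T[ -> x \in `]-1, 0[ -> segment_pt (y%:C * L) x != 0.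
  by move=> /yL yI xD; apply: segment_pt_neq0 => //; exact: subset_itv_oo_cc.
pose f y x := ln (nc (segment_pt (y%:C * L) x)).
pose f' y x := Re (- (x%:C * (L * cexp (y%:C * L))) / segment_pt (y%:C * L) x).
have mf y : y \in `]-T, T[ -> measurable_fun D (f y).
  move=> yI; apply: measurable_continuous_itv => x xD.
  exact: der_continuous (der_ln_normc (n0 y x yI xD) (cder_segment_pt_x (y%:C * L) x)).
have df y x : y \in `]-T, T[ -> x \in `]-1, 0[ -> is_derive y 1 (f ^~ x) (f' y x).
  move=> yI xD.
  exact: (der_ln_normc (f := fun y => segment_pt (y%:C * L) x) (n0 y x yI xD) (cder_segment_pt L x y)).
have f'C y x : y \in `]-T, T[ -> x \in `]-1, 0[ ->
    `|f' y x| <= nc L * expR (T * `|Re L|) * C.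
  move=> yI xD; apply: le_trans (Re_le_normc _) _; rewrite Normc.normcM.
  apply: ler_pM; rewrite ?normc_ge0//; last first.
    by apply: VC; [exact: rL|exact: iL|exact: subset_itv_oo_cc].
  have -> : nc (- (x%:C * (L * cexp (y%:C * L)))) = nc (x%:C * (L * cexp (y%:C * L))).
    exact: normcN.
  rewrite !Normc.normcM normc_cexp -[leRHS]mul1r; apply: ler_pM; rewrite ?mulr_ge0 ?normc_ge0 ?expR_ge0//.
    by rewrite normc_real; move: xD; rewrite in_itv/= ler_norml; lra.
  by rewrite ler_wpM2l ?normc_ge0// ler_expR (le_trans (ler_norm _))// rL.
pose V y := log_potential (y%:C * L).
have dV y : y \in `]-T, T[ ->
    is_derive y 1 V (\int[leb]_(x in D) (`|p x| * f' y x)).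
  apply: (der_weighted_integral ap0 ip mf _ df f'C).
  by move=> z x zI xD; apply: lnC => //; [exact: rL|exact: iL].
pose H y := V y - (ln (nc (cexp (y%:C * L) - 1)) - ln y).
have sub y : y \in `]0, T[ -> y \in `]-T, T[.
  by rewrite !in_itv/= => /andP[y0 ->]; rewrite andbT (lt_trans _ y0)// oppr_lt0.
have dH : {in `]0, T[, forall y : R, is_derive y 1 H 0}.
  move=> y /[dup] /sub yI; rewrite in_itv/= => /andP[y0 _].
  have yn0 : y != 0 by rewrite gt_eqF.
  have e1 := cexp_sub1_neq0 (yL y yI) L0 yn0.
  have de : cderive (fun y => cexp (y%:C * L) - 1) y (L * cexp (y%:C * L)).
    by eapply cder_eq; [exact: cderD (cder_cexp L y) (cder_cst (-1) y)|rewrite addr0].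
  eapply der_eq.
    exact: derD (dV y yI) (derN (derD (der_ln_normc e1 de) (derN (der_ln y0 (der_id y))))).
  by rewrite integral_der_log_segment ?yL//; cbv beta; ring.
have H1 y : y \in `]0, T[ -> H y = H 1.
  move=> yI; apply: (der0_cst dH) => //; rewrite in_itv/= ltr01 T1//.
have Hcst : H y @[y --> (0 : R)^'+] --> H 1.
  have : (cst (H 1) : R -> R) y @[y --> (0 : R)^'+] --> H 1 by exact: cvg_cst.
  apply: cvg_trans; apply: near_eq_cvg; near=> y; rewrite /= H1// in_itv/=.
  apply/andP; split; first by near: y; exact: nbhs_right_gt.
  by near: y; exact: nbhs_right_lt.
have V0 : V y @[y --> (0 : R)^'+] --> (0 : R).
  have V00 : V 0 = 0.
    rewrite /V /log_potential mul0r /segment_pt cexp0.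
    transitivity (\int[leb]_(x in D) (0 : R)); last by rewrite /Rintegral integral0.
    apply: eq_Rintegral => x _.
    by rewrite mulr1 rmorphD rmorph1 addrK Normc.normc1 ln1 mulr0.
  rewrite -[X in _ --> X]V00; apply: cvg_at_right_filter; apply: (der_continuous (dV 0 _)).
  by rewrite in_itv/= oppr_lt0 T0.
have HL : H y @[y --> (0 : R)^'+] --> 0 - ln (nc L).
  by apply: cvgB => //; exact: cvg_ln_cexp_sub1.
have E : H 1 = 0 - ln (nc L) := cvg_unique (@Rhausdorff R) Hcst HL.
have {}E : H 1 = 0 - ln (nc L) by exact: E.
move: E; rewrite /H /V mul1r ln1 subr0 => /eqP; rewrite subr_eq => /eqP ->.
by rewrite sub0r addrC.
Unshelve. all: by end_near. Qed.

End log_potential.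

(** * The principal logarithm off the slit *)

Section principal_log.
Variable R : realType.
Local Notation Re := (@complex.Re R).
Local Notation Im := (@complex.Im R).
Local Notation nc := (@Normc.normc R).
Implicit Types (x : R) (z t : R[i]).

Let ratio_itv z : z != 0 -> -1 <= Re z / nc z <= 1.
Proof.
move=> /normc_gt0 n0; rewrite -ler_norml normrM normfV (gtr0_norm n0).
by rewrite ler_pdivrMr// mul1r Re_le_normc.
Qed.

Let sin_acos_ratio z : z != 0 -> sin (acos (Re z / nc z)) = `|Im z| / nc z.
Proof.
move=> z0; have n0 := normc_gt0 z0; rewrite sin_acos; last exact: ratio_itv.
rewrite (_ : 1 - _ = (`|Im z| / nc z) ^+ 2).
  by rewrite sqrtr_sqr ger0_norm// divr_ge0// ltW.
rewrite !expr_div_n real_normK ?num_real//.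
have := normc_sqr z; have : nc z ^+ 2 != 0 by rewrite gt_eqF// exprn_gt0.
by move: (nc z ^+ 2) => N N0 NE; rewrite -(divff N0) -mulrBl NE addrAC subrr add0r.
Qed.

Lemma cexp_clog z : z != 0 -> cexp (clog z) = z.
Proof.
move=> z0; have n0 := normc_gt0 z0; have nn : nc z != 0 by rewrite gt_eqF.
apply/eqP; rewrite eq_complex Re_cexp Im_cexp [Re (clog z)]/= [Im (clog z)]/=.
rewrite lnK ?posrE//; apply/andP; split; apply/eqP.
  have -> : cos (carg z) = Re z / nc z.
    by rewrite /carg; case: ifP => _; rewrite ?cosN acosK// in_itv/= ratio_itv.
  by rewrite mulrC mulfVK.
have -> : sin (carg z) = Im z / nc z.
  rewrite /carg; case: leP => i0; rewrite ?sinN sin_acos_ratio//.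
    by rewrite ger0_norm.
  by rewrite ltr0_norm// mulNr opprK.
by rewrite mulrC mulfVK.
Qed.

Lemma Im_clog_lt_pi z : z != 0 -> ~ (exists2 x : R, x <= 0 & z = x%:C) ->
  `|Im (clog z)| < pi.
Proof.
move=> z0 zN; rewrite [Im _]/= /carg.
suff H : `|acos (Re z / nc z)| < pi by case: ifP => _; rewrite ?normrN.
rewrite ger0_norm ?acos_ge0 ?ratio_itv// lt_neqAle acos_lepi ?ratio_itv// andbT.
apply/eqP => api; apply: zN.
have n0 := normc_gt0 z0; have nn : nc z != 0 by rewrite gt_eqF.
have rz : Re z = - nc z.
  have := @acosK R (Re z / nc z); rewrite in_itv/= ratio_itv// api cospi => /(_ isT) E.
  by rewrite -[LHS](mulfVK nn) -E mulN1r.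
exists (Re z); first by rewrite rz oppr_le0 normc_ge0.
have i0 : Im z = 0.
  apply/eqP; rewrite -sqrf_eq0; apply/eqP.
  by have := normc_sqr z; rewrite rz sqrrN; move: (nc z ^+ 2) => N; lra.
by case: z i0 {z0 api n0 nn rz} => a b /= ->.
Qed.

Variable t : R[i].
Hypothesis t_itv : ~ (exists2 x : R, x \in `[-1, 0] & t = x%:C).

Lemma slit_neq0 : t != 0.
Proof.
apply/eqP => t0; apply: t_itv; exists 0 => //.
by rewrite in_itv/= lerN10 lexx.
Qed.

Lemma slit_add1_neq0 : t + 1 != 0.
Proof.
apply/eqP => t1; apply: t_itv; exists (-1); first by rewrite in_itv/= lerN10 lexx.
by rewrite rmorphN rmorph1; apply/eqP; rewrite -addr_eq0 t1.
Qed.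

Local Notation L := (clog (1 + t^-1)).

Let z0 : 1 + t^-1 != 0.
Proof.
have t0 := slit_neq0; have t1 := slit_add1_neq0.
by rewrite (_ : _ + _ = (t + 1) / t); [rewrite mulf_neq0// invr_neq0|field].
Qed.

Lemma cexp_slit_log : cexp L = 1 + t^-1.
Proof. exact: cexp_clog. Qed.

Lemma slit_log_neq0 : L != 0.
Proof.
apply/eqP => L0; have := cexp_slit_log; rewrite L0 cexp0 => /eqP.
by rewrite -subr_eq0 opprD addrA subrr add0r oppr_eq0 invr_eq0 (negPf slit_neq0).
Qed.

(** A point [1 + 1/t] of the cut would be a real number [x <= 0], and then
    [t = 1 / (x - 1)] would lie in [[-1, 0]]. *)
Lemma slit_log_strip : `|Im L| < pi.
Proof.
apply: Im_clog_lt_pi => //; case=> x x0 tx; apply: t_itv.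
have tV : t^-1 = (x - 1)%:C.
  by rewrite rmorphB rmorph1 /= -tx addrAC subrr add0r.
have tE : t = ((x - 1)^-1)%:C by rewrite -[LHS]invrK tV fmorphV.
exists (x - 1)^-1 => //; rewrite in_itv/= -(opprB 1 x) invrN lerN2 oppr_le0 invr_ge0.
by rewrite invf_le1; [apply/andP; split|]; lra.
Qed.

(** With [L = clog (1 + 1/t)], the segment from [1] to [cexp L] is the image of
    [x] under [1 - x/t]. *)
Lemma segment_pt_slit x : segment_pt L x = (t - x%:C) / t.
Proof.
have t0 := slit_neq0.
by rewrite /segment_pt cexp_slit_log rmorphD rmorph1; field.
Qed.

End principal_log.

Section slit_formulas.
Variable R : realType.
Local Notation leb := (@lebesgue_measure R).
Local Notation D := (`]-1, 0[%classic : set R).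
Local Notation p := (@fubini_density R).
Local Notation Re := (@complex.Re R).
Local Notation Im := (@complex.Im R).
Local Notation nc := (@Normc.normc R).
Variable t : R[i].
Hypothesis t_itv : ~ (exists2 x : R, x \in `[-1, 0] & t = x%:C).
Local Notation L := (clog (1 + t^-1)).

Let seg0 x : x \in `]-1, 0[ -> segment_pt L x != 0.
Proof.
move=> xD; apply: segment_pt_neq0; first exact: slit_log_strip.
exact: subset_itv_oo_cc.
Qed.

Let subE x : t - x%:C = t * segment_pt L x.
Proof. by rewrite segment_pt_slit// mulrC divfK// slit_neq0. Qed.

Let sub0 x : x \in `]-1, 0[ -> t - x%:C != 0.
Proof. by move=> xD; rewrite subE mulf_neq0 ?(slit_neq0 t_itv) ?seg0. Qed.

Let subV x : (t - x%:C)^-1 = t^-1 * (segment_pt L x)^-1.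
Proof. by rewrite subE invfM. Qed.

Lemma cbounded_slit_cauchy : cbounded (fun x => (t - x%:C)^-1).
Proof.
have [mr mi [C VC]] := segment_ptV_cbounded (slit_log_strip t_itv).
apply: (@cder_cbounded R _ _ (nc t^-1 * C)) => x xD; last first.
  by rewrite subV// Normc.normcM ler_wpM2l ?normc_ge0// VC.
have n0 := sub0 xD.
exact: (cderV (f := fun x => t - x%:C) n0 (cderD (cder_cst t x) (cderN (cder_id x)))).
Qed.

Lemma fubini_density_cauchy_slit :
  weighted_integral p (fun x => (t - x%:C)^-1) = (t * (t + 1) * L)^-1.
Proof.
have t0 := slit_neq0 t_itv; have t1 := slit_add1_neq0 t_itv.
have L0 := slit_log_neq0 t_itv; have Lpi := slit_log_strip t_itv.
have bV := segment_ptV_cbounded Lpi.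
have -> : weighted_integral p (fun x => (t - x%:C)^-1) = t^-1 * ((1 - cexp (- L)) / L).
  rewrite -fubini_density_cauchy// -[RHS]addr0.
  rewrite -[X in _ = _ + X](mul0r (weighted_integral p (fun x => (segment_pt L x)^-1))).
  rewrite -(weighted_integral_lin _ _ (integrable_fubini_density R))//.
  by apply: eq_weighted_integral => x _; rewrite mul0r addr0.
have e0 := cexp_neq0 L; have -> : cexp (- L) = t / (t + 1).
  apply: (mulIf e0); rewrite -cexpD addNr cexp0 cexp_slit_log//.
  by field; rewrite t0.
by field; rewrite t0 t1 L0.
Qed.

Lemma measurable_slit_log : measurable_fun D (fun x => ln (nc (t - x%:C))).
Proof.
apply: measurable_continuous_itv => x xD.
have n0 := sub0 xD.
exact: der_continuous (der_ln_normc (f := fun x => t - x%:C) n0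
  (cderD (cder_cst t x) (cderN (cder_id x)))).
Qed.

Let lnE x : x \in `]-1, 0[ -> ln (nc (t - x%:C)) = ln (nc t) + ln (nc (segment_pt L x)).
Proof.
by move=> xD; rewrite subE Normc.normcM lnM// posrE normc_gt0// ?seg0// (slit_neq0 t_itv).
Qed.

Lemma bounded_slit_log : exists C : R, {in `]-1, 0[, forall x : R, `|ln (nc (t - x%:C))| <= C}.
Proof.
have Lpi := slit_log_strip t_itv.
have [|C lnC] := @ln_segment_bounded R `|Re L| `|Im L|; first by rewrite normr_ge0.
exists (`|ln (nc t)| + C) => x xD; rewrite lnE//.
by apply: le_trans (ler_normD _ _) _; rewrite lerD2l lnC.
Qed.

Lemma fubini_density_log_slit :
  \int[leb]_(x in D) (p x * ln (nc (t - x%:C))) = - ln (nc L).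
Proof.
have Lpi := slit_log_strip t_itv; have L0 := slit_log_neq0 t_itv.
have t0 := slit_neq0 t_itv.
have [|C lnC] := @ln_segment_bounded R `|Re L| `|Im L|; first by rewrite normr_ge0.
have ms : measurable_fun D (fun x => ln (nc (segment_pt L x))).
  apply: measurable_continuous_itv => x xD.
  exact: der_continuous (der_ln_normc (seg0 xD) (cder_segment_pt_x L x)).
have mD : measurable (D : set (measurableTypeR R)) by exact: measurable_itv.
have ip := integrable_fubini_density R.
transitivity (\int[leb]_(x in D) (p x * ln (nc t) + p x * ln (nc (segment_pt L x)))).
  by apply: eq_Rintegral => x /set_mem xD; rewrite lnE// mulrDr.
rewrite RintegralD//; first 1 last.
- by have := @integrable_weightM R _ (fun=> ln (nc t)) `|ln (nc t)| ip (measurable_cst _); apply.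
- by have := @integrable_weightM R _ _ C ip ms; apply=> x xD; exact: lnC.
rewrite RintegralZr// [X in X * _]/Rintegral integral_fubini_density mul1r.
have -> : \int[leb]_(x in D) (p x * ln (nc (segment_pt L x))) = log_potential L.
  apply: eq_Rintegral => x /set_mem xD.
  by rewrite gtr0_norm// fubini_density_gt0.
rewrite log_potentialE// cexp_slit_log// addrAC subrr add0r Normc.normcV.
by rewrite lnV ?posrE ?normc_gt0//; ring.
Qed.

End slit_formulas.

(** * The limit law *)

Section fubini_law.
Variable R : realType.
Local Notation leb := (@lebesgue_measure R).
Local Notation D := (`]-1, 0[%classic : set (measurableTypeR R)).
Local Notation p := (@fubini_density R).
Implicit Types (f : R -> R) (E : set (measurableTypeR R)).

Let q (x : measurableTypeR R) : R := \1_D x * p x.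

Let mD : measurable D. Proof. exact: measurable_itv. Qed.

Let q_ge0 x : 0 <= q x.
Proof.
rewrite /q indicE; case: (boolP (x \in D)) => [|_]; rewrite ?mul0r// mul1r inE => xD.
exact/ltW/fubini_density_gt0.
Qed.

Let mq : measurable_fun setT q.
Proof.
rewrite (_ : q = p \_ D).
  by apply/(measurable_restrictT p mD); exact: measurable_fubini_density.
by apply/funext => x; rewrite /q patchE indicE; case: ifP; rewrite ?mul1r ?mul0r.
Qed.

Let int_q E : (\int[leb]_(x in E) (q x)%:E = \int[leb]_(x in E `&` D) (p x)%:E)%E.
Proof.
rewrite integral_mkcondr; apply: eq_integral => x _.
by rewrite patchE /q indicE; case: ifP; rewrite ?mul1r ?mul0r.
Qed.

Definition fubini_law E : \bar R := (\int[leb]_(x in E) (q x)%:E)%E.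

Let fubini_law0 : fubini_law set0 = 0%E.
Proof. exact: integral_set0. Qed.

Let fubini_law_ge0 E : (0 <= fubini_law E)%E.
Proof. by apply: integral_ge0 => x _; rewrite lee_fin q_ge0. Qed.

Let fubini_law_sigma_additive : semi_sigma_additive fubini_law.
Proof.
move=> /= F mF tF mUF; rewrite /fubini_law; apply: cvg_toP.
  apply: ereal_nondecreasing_is_cvgn => m n mn.
  apply: lee_sum_nneg_natr => // k _ _; exact: fubini_law_ge0.
rewrite ge0_integral_bigcup//=.
- by apply: measurable_funTS; apply: measurableT_comp.
- by move=> x _; rewrite lee_fin q_ge0.
Qed.

HB.instance Definition _ := isMeasure.Build _ _ _ fubini_law
  fubini_law0 fubini_law_ge0 fubini_law_sigma_additive.

Lemma fubini_lawE E : E `<=` D -> fubini_law E = (\int[leb]_(x in E) (p x)%:E)%E.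
Proof. by move=> ED; rewrite /fubini_law int_q setIidl. Qed.

Lemma fubini_law_itv : fubini_law D = 1%E.
Proof. by rewrite fubini_lawE// integral_fubini_density. Qed.

Let fubini_lawT : fubini_law setT = 1%E.
Proof. by rewrite /fubini_law int_q setTI integral_fubini_density. Qed.

HB.instance Definition _ := @Measure_isProbability.Build _ _ R fubini_law fubini_lawT.

Let fubini_law_dom : fubini_law `<< leb.
Proof.
apply/null_content_dominatesP => A mA A0; rewrite /fubini_law.
by apply: null_set_integral => //; apply/measurable_EFinP/measurable_funTS.
Qed.

Lemma bounded_integrable_fubini_law E f (C : R) : measurable E -> measurable_fun E f ->
  (forall x, E x -> `|f x| <= C) -> fubini_law.-integrable E (EFin \o f).
Proof.
move=> mE mf fC; apply: measurable_bounded_integrable => //.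
- by rewrite (le_lt_trans (probability_le1 _ _))// ltry.
- exists C; split; first exact: num_real.
  by move=> y Cy x Ex; rewrite /= (le_trans (fC x Ex))// ltW.
Qed.

(** The density is a Radon-Nikodym derivative of the law, which is unique almost
    everywhere. *)
Lemma integral_fubini_law E f (C : R) : measurable E -> measurable_fun E f ->
  (forall x, E x -> `|f x| <= C) ->
  (\int[fubini_law]_(x in E) (f x)%:E = \int[leb]_(x in E `&` D) (p x * f x)%:E)%E.
Proof.
move=> mE mf fC.
rewrite -(Radon_Nikodym_change_of_variables fubini_law_dom mE
  (bounded_integrable_fubini_law mE mf fC)).
transitivity (\int[leb]_(x in E) ((f x)%:E * (q x)%:E))%E; last first.
  rewrite integral_mkcondr; apply: eq_integral => x _.
  rewrite patchE /q indicE -EFinM; case: ifP; first by rewrite mul1r mulrC.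
  by rewrite mul0r mulr0.
have mRN : measurable_fun E (Radon_Nikodym (charge_of_finite_measure fubini_law) leb).
  apply: (measurable_int leb); apply: (integrableS measurableT) => //=.
  by apply: Radon_Nikodym_integrable; exact: fubini_law_dom.
apply: ae_eq_integral => //.
- by apply: emeasurable_funM => //; exact/measurable_EFinP.
- by apply: emeasurable_funM; apply/measurable_EFinP => //; exact: measurable_funTS.
- apply: ae_eqe_mul2l; apply: integral_ae_eq => //.
  + apply: (integrableS measurableT) => //.
    by apply: Radon_Nikodym_integrable; exact: fubini_law_dom.
  + by apply/measurable_EFinP; exact: measurable_funTS.
  + by move=> A AE mA; rewrite -Radon_Nikodym_integral//; exact: fubini_law_dom.
Qed.

Lemma integral_fubini_law_itv f (C : R) : measurable_fun D f ->
  {in `]-1, 0[, forall x : R, `|f x| <= C} ->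
  (\int[fubini_law]_(x in D) (f x)%:E = (\int[leb]_(x in D) (p x * f x))%:E)%E.
Proof.
move=> mf fC; rewrite (integral_fubini_law mD mf fC) setIid EFin_Rintegral//.
by have := integrable_weightM (integrable_fubini_density R) mf fC; exact.
Qed.

Lemma integral_fubini_law_setT f (C : R) : measurable_fun setT f ->
  (forall x, `|f x| <= C) ->
  (\int[fubini_law]_x (f x)%:E = (\int[fubini_law]_(x in D) f x)%:E)%E.
Proof.
move=> mf fC; rewrite (@integral_fubini_law setT f C)// setTI.
have mfD : measurable_fun D f by exact: measurable_funTS.
rewrite -EFin_Rintegral//.
  by rewrite (@integral_fubini_law D f C)// setIid.
exact: (@bounded_integrable_fubini_law _ _ C).
Qed.

End fubini_law.

(** * Weak convergence *)

Lemma continuous_borel_measurable (T : ptopologicalType) (R : realType) (f : T -> R) :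
  continuous f -> measurable_fun [set: borel T] (f : borel T -> R).
Proof.
move=> cf; apply: (@measurability _ _ (borel T) _ setT f _ (RGenOpens.measurableE R)).
move=> _ [_ [a [b ->]] <-]; rewrite setTI.
by apply: sub_sigma_algebra; move/continuousP : cf; apply; exact: interval_open.
Qed.

Section weak_convergence.
Variable R : realType.
Local Notation S := (borel (sphere R)).

Let zd n := zero_distribution n (fubini_poly R[i] n).

(** Since [F n] has degree exactly [n], no mass sits at infinity. *)
Lemma ge0_integral_zero_distribution_fubini n (g : S -> \bar R) :
  measurable_fun setT g -> (forall z, 0 <= g z)%E ->
  (\int[zd n]_z g z = n%:R^-1%:E * \sum_(x <- fubini_zeros R n) g (Some x%:C))%E.
Proof.
move=> mg g0; have n0 : 0 <= (n%:R^-1 : R) by [].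
rewrite (eq_measure_integral (mscale (n%:R^-1 : R)%:nng
  (msum (fun k => \d_(Some (nth 0 (zeros (fubini_poly R[i] n)) k) : S))
    (size (zeros (fubini_poly R[i] n)))))); last first.
  move=> A mA _; rewrite /zd /= /zero_distribution size_fubini_poly subnn mul0r mul0e adde0.
  by rewrite /mscale /msum /= (big_nth 0%R) big_mkord.
rewrite ge0_integral_mscale//; congr (_ * _)%E.
rewrite ge0_integral_measure_sum// zeros_fubiniE size_map.
rewrite (big_nth 0%R) big_mkord; apply: eq_bigr => k _.
by rewrite integral_dirac// diracT mul1e (nth_map 0%R).
Qed.

Lemma integral_zero_distribution_fubini n (f : S -> R) : measurable_fun setT f ->
  (\int[zd n]_z (f z)%:E =
   (n%:R^-1 * \sum_(x <- fubini_zeros R n) f (Some x%:C))%:E)%E.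
Proof.
move=> mf; have mfE : measurable_fun setT (EFin \o f) by exact/measurable_EFinP.
rewrite integralE !ge0_integral_zero_distribution_fubini//; first last.
- exact: measurable_funepos.
- exact: measurable_funeneg.
have pE z : ((EFin \o f)^\+ z = (Num.max (f z) 0)%:E)%E by rewrite funeposE EFin_max.
have nE z : ((EFin \o f)^\- z = (Num.max (- f z) 0)%:E)%E.
  by rewrite funenegE /= EFin_max.
under eq_bigr do rewrite pE; under [X in (_ - _ * X)%E]eq_bigr do rewrite nE.
rewrite !sumEFin -!EFinM -EFinB -mulrBr -sumrB; congr (_ * _)%:E.
by apply: eq_bigr => x _; case: (leP (f _) 0); case: (leP (- f _) 0); lra.
Qed.

(** A continuous function on the sphere restricts to a continuous function on the
    real line, so the convergence is that of [continuous_mean_cvg]. *)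
Lemma weakly_cvg_fubini : 
  weakly_cvg (fun n => zero_distribution n (fubini_poly R[i] n)) (on_sphere (@fubini_law R)).
Proof.
move=> f cf [M [_ fM]].
have mf : measurable_fun [set: S] (f : S -> R) by exact: continuous_borel_measurable.
pose g : R -> R := f \o @real_to_sphere R.
have cg : continuous g.
  move=> x; apply: (@continuous_comp _ _ _ (@real_to_sphere R : R -> sphere R) f).
    exact: continuous_real_to_sphere.
  exact: cf.
have mg : measurable_fun [set: measurableTypeR R] g.
  exact: continuous_measurable_fun.
have fC z : `|f z| <= M + 1 by apply: (fM (M + 1)) => //; rewrite ltrDl.
have gC (x : R) : `|g x| <= M + 1 by exact: fC.
under eq_fun do rewrite integral_zero_distribution_fubini//.
rewrite /on_sphere integral_pushforward//; first last.
- by apply: (@bounded_integrable_fubini_law _ setT g (M + 1)) => // x _; exact: fC.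
- exact/measurable_EFinP.
- exact: measurable_real_to_sphere.
rewrite preimage_setT (_ : _ \o _ = fun x => (g x)%:E)//.
rewrite (@integral_fubini_law_setT R g (M + 1))//.
apply: cvg_EFin; first exact: nearW.
apply: (@continuous_mean_cvg R (@fubini_law R) (fubini_law_itv R) (fubini_zeros R)
  (size_fubini_zeros R) (@fubini_zeros_itv R) g (@fubini_moment R) cg).
  by move=> k; exact: fubini_moment_cvg.
move=> k; rewrite /Rintegral (@integral_fubini_law_itv R (fun x => x ^+ k) 1).
- by rewrite fubini_density_moment.
- exact: measurable_realfun.measurable_funX.
- by move=> x; exact: pow_itv_le1.
Qed.

End weak_convergence.

Theorem theorem4p4 (R : realType) :
  exists mu : probability (measurableTypeR R) R,
    [/\ mu `]-1, 0[%classic = 1%E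
      & weakly_cvg (fun n => zero_distribution n (fubini_poly R[i] n))
                   (on_sphere mu)] /\
    [/\ forall t : R[i], ~ (exists2 x : R, x \in `[-1, 0] & t = x%:C) ->
          has_cintegral mu `]-1, 0[ (fun z => (t - z%:C)^-1)
            (t * (t + 1) * clog (1 + t^-1))^-1,
        forall A : set R, measurable A -> A `<=` `]-1, 0[ ->
          mu A = (\int[lebesgue_measure]_(x in A) (fubini_density x)%:E)%E,
        forall k : nat,
          (\int[mu]_(x in [set` `]-1, 0[%R]) (x ^+ k)%:E)%E =
            ((-1) ^+ k * (cauchy_number R k / k`!%:R))%:E
      & forall t : R[i], ~ (exists2 x : R, x \in `[-1, 0] & t = x%:C) ->
          (\int[mu]_(z in [set` `]-1, 0[%R]) (ln (Normc.normc (t - z%:C)))%:E)%E =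
            (- ln (Normc.normc (clog (1 + t^-1))))%:E].

Proof.
exists (@fubini_law R); split.
  split; first exact: fubini_law_itv.
  exact: weakly_cvg_fubini.
split.
- move=> t t_itv; have [mr mi [C tC]] := cbounded_slit_cauchy t_itv.
  rewrite -fubini_density_cauchy_slit//; split.
    by apply: (integral_fubini_law_itv mr (C := C)) => x /tC; apply: le_trans (Re_le_normc _).
  by apply: (integral_fubini_law_itv mi (C := C)) => x /tC; apply: le_trans (Im_le_normc _).
- by move=> A _ AD; rewrite -fubini_lawE.
- move=> k; rewrite (@integral_fubini_law_itv R (fun x => x ^+ k) 1).
  + by rewrite fubini_density_moment.
  + exact: measurable_realfun.measurable_funX.
  + by move=> x; exact: pow_itv_le1.
- move=> t t_itv; have [C tC] := bounded_slit_log t_itv.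
  rewrite (@integral_fubini_law_itv R _ C (measurable_slit_log t_itv) tC).
  by rewrite fubini_density_log_slit.
Qed.
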